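(* Consider the two-transmitter, two-receiver distributed-CSI channel described in the context, with CSI scalings $\alpha_i^{(j)}\in[0,1]$, $i,j\in\{1,2\}$. When both transmitted symbols are precoded with conventional Zero Forcing (cZF), the total multiplexing gain is $$\mathrm{M_G}^{\mathrm{cZF}}=2\min_{i,j\in\{1,2\}}\alpha_i^{(j)}.$$
   Context: Setting. Two transmitters TX1, TX2 and two receivers RX1, RX2, each with a single antenna. RX $i$ receives $y_i=\bm{h}_i^{H}\bm{x}+\eta_i$, where $\bm{h}_i^{H}\in\mathbb{C}^{1\times 2}$ is the channel from the two TXs to RX $i$, the entries of $\mathbf{H}=[\bm{h}_1^H;\bm{h}_2^H]$ are i.i.d. $\mathcal{CN}(0,1)$ (block fading), and $\eta_i\sim\mathcal{CN}(0,1)$ i.i.d. The normalized channel is $\tilde{\bm{h}}_i=\bm{h}_i/\|\bm{h}_i\|$. The transmit signal is $\bm{x}=\bm{t}_1s_1+\bm{t}_2s_2$ with independent symbols $s_i\sim\mathcal{CN}(0,1)$ and beamformers $\bm{t}_i\in\mathbb{C}^2$; $P$ is the transmit power (SNR). For $i\in\{1,2\}$ let $\bar i$ denote the other index. The rate of RX $i$ is $R_i(P)=\mathrm{E}_{\mathbf{H},\mathcal{W}}\big[\log_2\big(1+\frac{|\bm{h}_i^H\bm{t}_i|^2}{1+|\bm{h}_i^H\bm{t}_{\bar i}|^2}\big)\big]$, the expectation being over the channel and the random quantization codebooks; the multiplexing gain (MG) at RX $i$ is $\mathrm{M_G}_i=\lim_{P\to\infty}R_i(P)/\log_2 P$ and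 the total MG is $\mathrm{M_G}_1+\mathrm{M_G}_2$. Distributed CSI via random vector quantization. Every unit vector $\bm{u}\in\mathbb{C}^2$ is multiplied by a unit-modulus complex scalar making its first entry real, and identified with $\bm{u}_{\mathbb{R}^3}=[\mathrm{Re}(u_1),\mathrm{Re}(u_2),\mathrm{Im}(u_2)]^T\in\mathbb{R}^3$; the angle between two such vectors is $\angle(\bm{u},\bm{v})=\arccos\big(|\bm{u}_{\mathbb{R}^3}^T\bm{v}_{\mathbb{R}^3}|/(\|\bm{u}_{\mathbb{R}^3}\|\|\bm{v}_{\mathbb{R}^3}\|)\big)$. TX $j$ holds its own estimate $\tilde{\bm{h}}_i^{(j)}$ of $\tilde{\bm{h}}_i$, chosen as the codeword $\bm{c}$ of a random codebook (of $2^{B_i^{(j)}}$ independently, isotropically generated unit vectors, with the same phase normalization, independent across $i,j$) maximizing $|\bm{c}_{\mathbb{R}^3}^T\tilde{\bm{h}}_{i,\mathbb{R}^3}|$. The CSI scaling is $\alpha_i^{(j)}=\lim_{P\to\infty}B_i^{(j)}/\log_2 P\in[0,1]$. Distributed precoding. TX $j$ computes a full precoder $[\bm{t}_1^{(j)},\bm{t}_2^{(j)}]$ from its own estimates, but only its $j$-th row is transmitted: the effective beamformer for symbol $i$ is $\bm{t}_i=[t_{1i}^{(1)},t_{2i}^{(2)}]^T$, where $t_{ki}^{(j)}$ is the $k$-th entry of $\bm{t}_i^{(j)}$. Conventional ZF: with $\Pi^{\perp}_{\bm{u}}(\bm{v})=\bm{v}-\bm{u}\bm{u}^H\bm{v}/\|\bm{u}\|^2$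 the projection onto the orthogonal complement of $\bm{u}$, $\bm{t}_i^{(j)}=\sqrt{P/2}\,\Pi^{\perp}_{\tilde{\bm{h}}_{\bar i}^{(j)}}(\tilde{\bm{h}}_i^{(j)})/\|\Pi^{\perp}_{\tilde{\bm{h}}_{\bar i}^{(j)}}(\tilde{\bm{h}}_i^{(j)})\|$ for $j\in\{1,2\}$. *)

(* Defs.v *)
From HB Require Import structures.
From mathcomp Require Import all_boot all_order all_algebra.
From mathcomp Require Import all_classical all_reals all_analysis.
From mathcomp Require Import complex.

Set Implicit Arguments.
Unset Strict Implicit.
Unset Printing Implicit Defensive.

Import Order.TTheory GRing.Theory Num.Theory.
Import numFieldNormedType.Exports.
Local Open Scope classical_set_scope.
Local Open Scope ring_scope.

Section DistributedCSI.
Variable R : realType.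

Notation C := (R[i]).
Definition cvec := 'I_2 -> C.

Definition ocplx (a : R) : C := Complex a 0.
Definition abs2 (z : C) : R := complex.Re z ^+ 2 + complex.Im z ^+ 2.
Definition cabs (z : C) : R := Num.sqrt (abs2 z).

Definition dotH (u v : cvec) : C := \sum_(k < 2) conjc (u k) * v k.
Definition vnorm (u : cvec) : R := Num.sqrt (\sum_(k < 2) abs2 (u k)).
Definition scalev (c : C) (u : cvec) : cvec := fun k => c * u k.
Definition normalize (u : cvec) : cvec := scalev (ocplx (vnorm u)^-1) u.

(** phase normalisation: multiply by a unit-modulus scalar so that the first
    entry becomes real (and nonnegative) *)
Definition phase_norm (u : cvec) : cvec :=
  if u ord0 == 0 then u else scalev (conjc (u ord0) / ocplx (cabs (u ord0))) u.

(** the R^3 representation [Re u1, Re u2, Im u2] of a (phase-normalised) vector *)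
Definition r3 (u : cvec) : 'I_3 -> R :=
  fun l => if val l == 0%N then complex.Re (u ord0)
           else if val l == 1%N then complex.Re (u ord_max) else complex.Im (u ord_max).
Definition r3dot (u v : cvec) : R := \sum_(l < 3) r3 u l * r3 v l.
Definition qscore (c h : cvec) : R := `| r3dot (phase_norm c) (phase_norm h) |.

Definition best_index (N : nat) (f : nat -> R) : nat :=
  foldl (fun b n => if f b < f n then n else b) 0%N (iota 1 N.-1).

Definition proj_perp (u v : cvec) : cvec :=
  fun k => v k - u k * (dotH u v / ocplx (vnorm u ^+ 2)).

Definition other (i : 'I_2) : 'I_2 := if i == ord0 then ord_max else ord0.

Definition log2 (x : R) : R := ln x / ln 2.

(** real Gaussian source variables:
    inl (i, k, b)       : real (b = false) / imaginary (b = true) part of H_{ik}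
    inr (i, j, n, l, b) : real / imaginary part of entry l of the n-th
                          (unnormalised) Gaussian vector generating the n-th
                          codeword of the codebook used by TX j for h_i *)
Definition gidx := (('I_2 * 'I_2 * bool) + ('I_2 * 'I_2 * nat * 'I_2 * bool))%type.

Variables (d : measure_display) (T : measurableType d).
Variable G : gidx -> T -> R.

Definition Hent (i k : 'I_2) (w : T) : C :=
  Complex (G (inl (i, k, false)) w) (G (inl (i, k, true)) w).
(** h_i, so that the i-th row of H is h_i^H *)
Definition hvec (i : 'I_2) (w : T) : cvec := fun k => conjc (Hent i k w).
Definition htilde (i : 'I_2) (w : T) : cvec := normalize (hvec i w).

(** n-th codeword of the codebook of TX j for h_i: isotropic unit vector,
    phase normalised *)
Definition codeword (i j : 'I_2) (n : nat) (w : T) : cvec :=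
  phase_norm (normalize (fun l =>
    Complex (G (inr (i, j, n, l, false)) w) (G (inr (i, j, n, l, true)) w))).

Variable B : 'I_2 -> 'I_2 -> R -> nat.  (* B i j P = B_i^{(j)} at power P *)

Definition estimate (P : R) (i j : 'I_2) (w : T) : cvec :=
  codeword i j
    (best_index (2 ^ B i j P) (fun n => qscore (codeword i j n w) (htilde i w))) w.

Definition czf (P : R) (j i : 'I_2) (w : T) : cvec :=
  scalev (ocplx (Num.sqrt (P / 2)))
    (normalize (proj_perp (estimate P (other i) j w) (estimate P i j w))).

(** effective beamformer of symbol i: TX k transmits entry k of its own
    precoder *)
Definition teff (P : R) (i : 'I_2) (w : T) : cvec := fun k => czf P k i w k.

Definition rate_integrand (P : R) (i : 'I_2) (w : T) : R :=
  log2 (1 + abs2 (dotH (hvec i w) (teff P i w)) /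
            (1 + abs2 (dotH (hvec i w) (teff P (other i) w)))).

Variable Pr : probability T R.

Definition rate (P : R) (i : 'I_2) : \bar R :=
  (\int[Pr]_w (rate_integrand P i w)%:E)%E.

End DistributedCSI.

Definition mutually_independent {R : realType} {d : measure_display}
  {T : measurableType d} (Pr : probability T R) {I : eqType} (X : I -> T -> R) :=
  forall (s : seq I), uniq s -> forall (A : I -> set R), (forall k, measurable (A k)) ->
    Pr (\bigcap_(k in [set` s]) (X k @^-1` A k)) = (\prod_(k <- s) Pr (X k @^-1` A k))%E.

(* Main.v *)
(** Both multiplexing gains equal the smallest scaling a = min alpha_i^(j).  By the domination
    log2 (1 + S / (1 + I)) <= log2 P + |h_i|^2 / ln 2 it suffices to know, with probability tending
    to one, that 1 + I = P^(1 - a + o(1)), that S <= P^(1 + o(1)), and, when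
    a > 0, that S >= P^(1 - o(1)).

    Quantization: the planar parameter c_2 / c_1 of an isotropic codeword has a density that is
    bounded, and bounded below on compact sets.  Hence among 2^B ~ P^alpha codewords one lies at
    distance P^(-alpha/2 + o(1)) from the true direction, and the selected one is then as close.

    Upper bound on I: zero forcing is Lipschitz in the estimates and exact for perfect ones.

    Lower bound on I: fix one codebook and condition on everything else.  The interference is
    a sum X_1 + X_2 of the contributions of the two transmitters, and |X_1 + X_2| <= r forces the
    phase of one of them, hence a real affine function of one Gaussian coordinate of the codeword in
    use, into an interval of length O(r).  A codeword that lies in this strip and within
    P^(-alpha/2 + o(1)) of the channel has probability O(r P^(-alpha/2 + o(1))); the union bound over
    the P^alpha codewords excludes r = P^(-alpha/2 - delta).  This holds for each of the four
    codebooks, because the precoder for one receiver depends on the estimates of both channels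
    through the common phase. *)

Require Import Defs.
From HB Require Import structures.
From mathcomp Require Import all_boot all_order all_algebra.
From mathcomp Require Import all_classical all_reals all_analysis.
From mathcomp Require Import complex.
From mathcomp Require Import measurable_realfun simple_functions ring lra.
Import Order.TTheory GRing.Theory Num.Theory.
Import numFieldNormedType.Exports.
Local Open Scope classical_set_scope.
Local Open Scope ring_scope.

Set Implicit Arguments.
Unset Strict Implicit.
Unset Printing Implicit Defensive.

(** * Sub-sigma-algebras generated by independent variables *)

(** Conditioning uses no product structure on [T]: the coordinates in a set [K] generate a
    sub-sigma-algebra, and Tonelli integrates out one coordinate outside [K] at a time. The selected
    index depends on its entire codebook, so the selected codeword has no convenient law; bad events
    are therefore stated for codeword [n] as if it were in use, bounded for each [n], and evaluated
    at the selected index only at the end. The phase of the other transmitter's contribution can be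
    frozen because that transmitter owns separate codebooks. With the unnormalised Gaussian vectors,
    a precoder entry becomes, once positive factors are cleared, affine in one entry of the codeword
    ([zfdir_cword]), so intervals of a real Gaussian suffice. Channel and norm constants are
    absorbed in factors P^e. The exception is the search for a close codeword: its success
    probability involves a Gaussian density at the size of the channel slope, so there the channel
    bound must be a constant. Scaling 0 gives no localization; there the subpolynomial number of
    codewords makes all of them nondegenerate instead. *)

Section SubSigmaAlgebra.
Context (R : realType) (d : measure_display) (T : measurableType d).
Context (Pr : probability T R) (I : eqType) (X : I -> T -> R).
Hypothesis mX : forall k, measurable_fun setT (X k).
Hypothesis indX : mutually_independent Pr X.

Definition cylinders (K : set I) : set (set T) :=
  [set C | exists (s : seq I) (A : I -> set R),
     [/\ uniq s, (forall k, k \in s -> K k), (forall k, measurable (A k)) &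
        C = \bigcap_(k in [set` s]) (X k @^-1` A k)]].

(** The same points as [T], with fewer measurable sets: measurability out of [genT K] is how a
    quantity is said to depend on the coordinates in [K] only. *)
Definition genT (K : set I) := g_sigma_algebraType (cylinders K).

Lemma cylinders_setI (K : set I) : setI_closed (cylinders K).
Proof.
move=> _ _ [s [A [us sK mA ->]]] [s' [A' [us' sK' mA' ->]]].
pose B k := (if k \in s then A k else setT) `&` (if k \in s' then A' k else setT).
exists (undup (s ++ s')), B; split.
- exact: undup_uniq.
- by move=> k; rewrite mem_undup mem_cat => /orP[/sK|/sK'].
- by move=> k; apply: measurableI; case: ifP => // _; exact: measurableT.
- apply/seteqP; split=> [w [h1 h2] k /=|w h].
    rewrite mem_undup mem_cat => hk; rewrite /B; split.
      by case: ifP => // ks; exact: (h1 k ks).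
    by case: ifP => // ks; exact: (h2 k ks).
  by split=> k /= ks; have := h k; rewrite /= mem_undup mem_cat ks ?orbT => /(_ isT);
    rewrite /B /= ks => -[].
Qed.

Lemma cylinders_measurable (K : set I) : cylinders K `<=` measurable.
Proof.
move=> _ [s [A [_ _ mA ->]]]; apply: fin_bigcap_measurable; first exact: finite_seq.
by move=> k _; rewrite -[X in measurable X]setTI; exact: mX.
Qed.

Lemma genT_measurable (K : set I) (A : set (genT K)) :
  measurable A -> measurable (A : set T).
Proof.
move=> mA; apply: smallest_sub mA; last exact: cylinders_measurable.
split; first exact: measurable0.
  by move=> B mB; rewrite setTD; exact: measurableC.
by move=> F mF; exact: bigcup_measurable.
Qed.

Lemma genT_id_measurable (K : set I) :
  measurable_fun setT ((fun w => w) : T -> genT K).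
Proof. by move=> _ A mA; rewrite setTI; exact: (genT_measurable mA). Qed.

Lemma genT_fun_measurable (K : set I) d' (U : measurableType d')
    (f : genT K -> U) :
  measurable_fun setT f -> measurable_fun setT (f : T -> U).
Proof. by move=> mf _ A mA; exact: (genT_measurable (mf measurableT A mA)). Qed.

Lemma genT_coord_measurable (K : set I) k : K k ->
  measurable_fun setT (X k : genT K -> R).
Proof.
move=> Kk _ A mA; rewrite setTI; apply: sub_sigma_algebra.
exists [:: k], (fun=> A); split => //; first by move=> k'; rewrite inE => /eqP ->.
apply/seteqP; split=> [w hw k' /=|w /(_ k)]; first by rewrite inE => /eqP ->.
by apply; rewrite /= inE.
Qed.

Lemma genT_indep (K : set I) k (A : set (genT K)) (S : set R) : ~ K k ->
  measurable A -> measurable S ->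
  Pr ((A : set T) `&` X k @^-1` S) = (Pr (A : set T) * Pr (X k @^-1` S))%E.
Proof.
move=> nKk mA mS.
have mY : measurable (X k @^-1` S) by rewrite -[X in measurable X]setTI; exact: mX.
set Y := X k @^-1` S in mY *.
pose H := [set C : set T | measurable C /\ Pr (C `&` Y) = (Pr C * Pr Y)%E].
suff : <<s cylinders K >> `<=` H by move=> /(_ A mA) [].
apply: lambda_system_subset => //; first exact: cylinders_setI.
- apply/dynkin_lambda_system; split.
  + by split; [exact: measurableT|rewrite setTI probability_setT mul1e].
  + move=> B [mB hB]; split; first exact: measurableC.
    have fY : Pr Y \is a fin_num by exact: fin_num_measure.
    have fB : Pr B \is a fin_num by exact: fin_num_measure.
    rewrite probability_setC// muleBl//.
    rewrite mul1e -hB setIC -setDE measureD//; last first.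
      by rewrite ltey_eq fin_num_measure.
    by rewrite setIC.
  + move=> F tF HF; split; first by apply: bigcup_measurable => n _; case: (HF n).
    rewrite setI_bigcupl !measure_bigcup//=.
    * have fY : Pr Y \is a fin_num by exact: fin_num_measure.
      rewrite muleC -(fineK fY) -nneseriesZl//.
      by apply: eq_eseriesr => n _; rewrite (fineK fY) muleC; case: (HF n).
    * by move=> n _; case: (HF n).
    * by move=> n _; apply: measurableI => //; case: (HF n).
    * apply/trivIsetP => i j _ _ ij; move/trivIsetP : tF => /(_ i j Logic.I Logic.I ij).
      by rewrite setIACA => ->; rewrite set0I.
- move=> C CK; have mC := cylinders_measurable CK; split => //.
  case: CK => s [B [us sK mB ->]].
  have ks : k \notin s by apply/negP => /sK.
  (* Since [k] is not in [s], adding the constraint at [k] turns both the cylinder and its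
     intersection with [Y] into instances of mutual independence for one family [B']. *)
  pose B' k' := if k' == k then S else B k'.
  have e1 : \bigcap_(k0 in [set` s]) X k0 @^-1` B k0 =
            \bigcap_(k0 in [set` s]) X k0 @^-1` B' k0.
    apply: eq_bigcapr => k' /= k's; rewrite /B'; case: eqP => // e.
    by rewrite -e k's in ks.
  have e2 : \bigcap_(k0 in [set` s]) X k0 @^-1` B' k0 `&` Y =
      \bigcap_(k0 in [set` (k :: s)]) X k0 @^-1` B' k0.
    apply/seteqP; split=> [w [h1 h2] k' /=|w h].
      by rewrite inE => /orP[/eqP ->|/h1//]; rewrite /B' eqxx.
    split=> [k' /= k's|]; first by apply: h; rewrite /= inE k's orbT.
    by have := h k; rewrite /= inE eqxx /B' eqxx; exact.
  have mB' k' : measurable (B' k') by rewrite /B'; case: ifP.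
  rewrite e1 e2 indX ?indX //= ?ks// big_cons muleC; congr (_ * _)%E.
  by rewrite /B' eqxx.
Qed.

Definition genP (K : set I) : set (genT K) -> \bar R := fun A => Pr (A : set T).

Section genP_probability.
Variable K : set I.

Let genP0 : genP (set0 : set (genT K)) = 0%E.
Proof. exact: measure0. Qed.

Let genP_ge0 (A : set (genT K)) : (0 <= genP A)%E.
Proof. exact: measure_ge0. Qed.

Let genP_sigma_additive : semi_sigma_additive (@genP K).
Proof.
move=> F mF tF mUF; apply: (@measure_semi_sigma_additive _ _ _ Pr F) => //.
  by move=> n; exact: (genT_measurable (mF n)).
exact: (genT_measurable mUF).
Qed.

HB.instance Definition _ := isMeasure.Build _ _ _ (@genP K)
  genP0 genP_ge0 genP_sigma_additive.

Let genP_setT : genP (setT : set (genT K)) = 1%E.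
Proof. exact: probability_setT. Qed.

HB.instance Definition _ :=
  @Measure_isProbability.Build _ _ R (@genP K) genP_setT.

End genP_probability.

(** The law of the pair formed by [X k] and the identity into [genT K], that is, of the coordinate
    together with all the information of [K]. *)
Definition jointP (K : set I) (k : I) : set (measurableTypeR R * genT K) -> \bar R :=
  fun A => Pr [set w : T | A (X k w, w)].

Section jointP_measure.
Variables (K : set I) (k : I).

Let mpair : measurable_fun setT (fun w : T => ((X k w : measurableTypeR R), (w : genT K))).
Proof.
apply: (measurable_fun_pair (f := X k : T -> measurableTypeR R)).
  exact: mX.
exact: genT_id_measurable.
Qed.

Let jointP0 : @jointP K k set0 = 0%E.
Proof. exact: measure0. Qed.

Let jointP_ge0 (A : set (measurableTypeR R * genT K)) : (0 <= jointP k A)%E.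
Proof. exact: measure_ge0. Qed.

Let jointP_sigma_additive : semi_sigma_additive (@jointP K k).
Proof. exact: (@measure_semi_sigma_additive _ _ _ (pushforward Pr _)). Qed.

HB.instance Definition _ := isMeasure.Build _ _ _ (@jointP K k)
  jointP0 jointP_ge0 jointP_sigma_additive.

Lemma jointP_integral (F : measurableTypeR R * genT K -> \bar R) :
  measurable_fun setT F -> (forall z, 0 <= F z)%E ->
  (\int[jointP k]_z F z = \int[Pr]_w F (X k w, w))%E.
Proof.
move=> mF F0.
have /= := ge0_integral_pushforward mpair Pr measurableT mF.
rewrite preimage_setT => <- //; by move=> z _; exact: F0.
Qed.

End jointP_measure.

(** By [genT_indep] the joint law agrees on rectangles with the product of [mu] and the restriction
    of [Pr], hence everywhere; Tonelli for the product then gives the iterated integral. *)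
Lemma genT_fubini (mu : probability (measurableTypeR R) R) (K : set I) (k : I)
    (F : measurableTypeR R * genT K -> \bar R) :
  (forall S, measurable S -> Pr (X k @^-1` S) = mu S) ->
  ~ K k -> measurable_fun setT F -> (forall z, 0 <= F z)%E ->
  (\int[Pr]_w F (X k w, w) = \int[Pr]_w \int[mu]_x F (x, w))%E.
Proof.
move=> lawX nKk mF F0; rewrite -jointP_integral//.
rewrite (@eq_measure_integral _ _ _ _ (mu \x @genP K)%E); last first.
  move=> A mA _; apply/esym/product_measure_unique => //= B C mB mC.
  have e : Pr ((C : set T) `&` X k @^-1` B) = (mu B * genP C)%E.
    by rewrite (genT_indep nKk mC mB) lawX// muleC.
  rewrite -e /jointP; congr (Pr _).
  by apply/seteqP; split=> w [].
rewrite fubini_tonelli2//.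
have /= := ge0_integral_pushforward (@genT_id_measurable K) Pr measurableT
  (measurable_fun_fubini_tonelli_G (m1 := mu) F mF F0).
by rewrite preimage_setT => <- // w _; exact: integral_ge0.
Qed.

End SubSigmaAlgebra.

(** The integral of a nonnegative function is a supremum over the simple functions below it, and
    enlarging the function enlarges this family. *)
Lemma ge0_le_integral_nomeas (R : realType) d (T : measurableType d)
    (mu : {measure set T -> \bar R}) (f g : T -> \bar R) :
  (forall x, 0 <= f x)%E -> (forall x, f x <= g x)%E ->
  (\int[mu]_x f x <= \int[mu]_x g x)%E.
Proof.
move=> f0 fg; rewrite !ge0_integralTE//; last by move=> x; exact: le_trans (fg x).
apply: le_ereal_sup => _ [h hf <-]; exists h => // x.
exact: le_trans (hf x) (fg x).
Qed.

(** * Gaussian interval estimates *)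

Section DensityBounds.
Context (R : realType).
Notation mu := (@lebesgue_measure R).
Import HBNNSimple.

(** A simple function below [f] has the same integral against [nu] as its product with [g] has
    against Lebesgue measure, and that product lies below [f * g]. This direction suffices to prove
    moments finite. *)
Lemma le_integral_density (nu : {measure set (measurableTypeR R) -> \bar R})
    (g : R -> \bar R) (f : R -> \bar R) :
  measurable_fun setT g -> (forall x, 0 <= g x)%E -> (forall x, 0 <= f x)%E ->
  (forall A, measurable A -> nu A = \int[mu]_(x in A) g x)%E ->
  (\int[nu]_x f x <= \int[mu]_x (f x * g x))%E.
Proof.
move=> mg g0 f0 nuE; rewrite ge0_integralTE//.
apply: ge_ereal_sup => _ [h hf <-].
rewrite sintegralE.
apply: (@le_trans _ _ (\int[mu]_x ((h x)%:E * g x))%E); last first.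
  apply: ge0_le_integral_nomeas => x; first by rewrite mule_ge0// lee_fin.
  by rewrite lee_wpmul2r.
under [leRHS]eq_integral => x _.
  rewrite fimfunE -fsumEFin// ge0_mule_fsuml; last first.
    by move=> y; rewrite nnfun_muleindic_ge0.
  over.
rewrite ge0_integral_fsum//; last 2 first.
- move=> y; apply: emeasurable_funM => //; apply/measurable_EFinP.
  exact: measurable_funM.
- by move=> y x _; rewrite mule_ge0// nnfun_muleindic_ge0.
apply: lee_fsum => // y [x _ <-].
have mhx : measurable (h @^-1` [set h x]) by exact: measurable_sfunP.
rewrite nuE// -ge0_integralZl//; last by rewrite lee_fin.
  rewrite (integral_mkcond (h @^-1` _)) le_eqVlt; apply/orP; left; apply/eqP.
  apply: eq_integral => z _; rewrite patchE indicE; case: ifPn => zA.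
    by rewrite mulr1.
  by rewrite mulr0 mul0e.
exact: measurable_funTS.
Qed.

Notation sg := (Num.sqrt (2^-1 : R)).

Let sg_neq0 : sg != 0.
Proof. by rewrite gt_eqF// sqrtr_gt0 invr_gt0. Qed.

Lemma normal_half_pdfE (x : R) : normal_pdf 0 sg x = normal_peak sg * expR (- x ^+ 2).
Proof.
rewrite /normal_pdf (negbTE sg_neq0) /normal_fun subr0 sqr_sqrtr ?invr_ge0//.
have -> : 2^-1 *+ 2 = 1 :> R by rewrite mulr2n ; field.
by rewrite divr1.
Qed.

Lemma normal_half_peak_le1 : normal_peak sg <= 1.
Proof.
rewrite /normal_peak sqr_sqrtr ?invr_ge0//.
have -> : 2^-1 * pi *+ 2 = pi :> R by rewrite mulr2n; field.
rewrite invf_le1 ?sqrtr_gt0 ?pi_gt0//.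
by rewrite -[leLHS]sqrtr1 ler_sqrt ?(le_trans _ (pi_ge2 R))// ?ler1n// pi_ge0.
Qed.

Let dist_itv (a l : R) : [set x : R | `|x - a| <= l] = `[a - l, a + l]%classic.
Proof.
apply/seteqP; split=> x /=; rewrite in_itv/= ler_distl //.
Qed.

Lemma measurable_dist (a l : R) : measurable [set x : R | `|x - a| <= l].
Proof. by rewrite dist_itv; exact: measurable_itv. Qed.

Lemma lebesgue_dist (a l : R) : 0 <= l ->
  mu [set x : R | `|x - a| <= l] = (2 * l)%:E.
Proof.
move=> l0; rewrite dist_itv lebesgue_measure_itv/= lte_fin.
case: ltP => [_|h]; first by rewrite -EFinB; congr EFin; ring.
by congr EFin; lra.
Qed.

(** The density of variance 1/2 peaks at 1/sqrt(pi), which is at most 1, so a probability is at most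
    a length. *)
Lemma normal_half_dist_le (a l : R) : 0 <= l ->
  (normal_prob 0 sg [set x | (`|x - a| <= l)%R] <= (2 * l)%:E)%E.
Proof.
move=> l0; rewrite -(lebesgue_dist a l0) -[leRHS]mul1e -(integral_cst mu)//; last first.
  exact: measurable_dist.
apply: ge0_le_integral => //=.
- exact: measurable_dist.
- by move=> x _; rewrite lee_fin normal_pdf_ge0.
- by apply/measurable_EFinP/measurable_funTS; exact: measurable_normal_pdf.
- move=> x _; rewrite lee_fin (le_trans _ normal_half_peak_le1)//.
  exact: normal_pdf_ub.
Qed.

(** The interval lies in [-M, M], where the density is at least its value at [M]. *)
Lemma normal_half_dist_ge (M a l : R) : 0 <= l -> `|a| + l <= M ->
  (((normal_peak sg * expR (- M ^+ 2)) * (2 * l))%:E <=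
   normal_prob 0 sg [set x | (`|x - a| <= l)%R])%E.
Proof.
move=> l0 alM; rewrite EFinM -(lebesgue_dist a l0) -(integral_cst mu)//; last first.
  exact: measurable_dist.
apply: ge0_le_integral => //=.
- exact: measurable_dist.
- by move=> x _; rewrite lee_fin mulr_ge0 ?expR_ge0// normal_peak_ge0.
- by apply/measurable_EFinP/measurable_funTS; exact: measurable_normal_pdf.
- move=> x xa; rewrite lee_fin normal_half_pdfE ler_wpM2l ?normal_peak_ge0//.
  rewrite ler_expR lerN2 -(real_normK (num_real x)) ler_sqr ?nnegrE//.
    rewrite (le_trans _ alM)// -[x](subrK a) addrC (le_trans (ler_normD _ _))//.
    by rewrite lerD2l.
  by rewrite (le_trans _ alM)// addr_ge0.
Qed.

Lemma normal_half_moment2 :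
  (\int[normal_prob 0 sg]_x (x ^+ 2)%:E < +oo)%E.
Proof.
pose g x : \bar R := (normal_pdf 0 sg x)%:E.
apply: (@le_lt_trans _ _ (\int[mu]_x ((x ^+ 2)%:E * g x))%E).
  apply: le_integral_density => //.
  - by apply/measurable_EFinP; exact: measurable_normal_pdf.
  - by move=> x; rewrite lee_fin normal_pdf_ge0.
  - by move=> x; rewrite lee_fin sqr_ge0.
(* Comparison with the standard normal density: x^2 exp(-x^2) <= 2 exp(-x^2/2), because 1 + x^2/2 <=
   exp(x^2/2); the ratio of peaks corrects the normalisation. *)
pose C := 2 * normal_peak sg / normal_peak (1 : R).
have C0 : 0 <= C by rewrite mulr_ge0 ?mulr_ge0 ?invr_ge0 ?normal_peak_ge0.
apply: (@le_lt_trans _ _ (\int[mu]_x (C%:E * (normal_pdf 0 1 x)%:E))%E).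
  apply: ge0_le_integral_nomeas => x.
    by rewrite mule_ge0// lee_fin ?sqr_ge0// normal_pdf_ge0.
  rewrite -EFinM lee_fin normal_half_pdfE /normal_pdf oner_eq0 /normal_fun subr0.
  have p1 : normal_peak (1 : R) != 0 by rewrite gt_eqF// normal_peak_gt0// oner_eq0.
  rewrite expr1n mulrCA (_ : C * _ = normal_peak sg * (2 * expR (- x ^+ 2 / 2))); last first.
    by rewrite /C; field.
  rewrite ler_wpM2l ?normal_peak_ge0//.
  have e : - x ^+ 2 = - x ^+ 2 / 2 + - (x ^+ 2 / 2) by field.
  rewrite [X in _ * expR X <= _]e expRD mulrCA mulrC.
  rewrite ler_wpM2r ?expR_ge0// expRN ler_pdivrMr ?expR_gt0//.
  by have := expR_ge1Dx (x ^+ 2 / 2); lra.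
rewrite ge0_integralZl//=; last 2 first.
- by apply/measurable_EFinP; exact: measurable_normal_pdf.
- by move=> x _; rewrite lee_fin normal_pdf_ge0.
by rewrite integral_normal_pdf mule1 ltry.
Qed.

End DensityBounds.

Lemma measurable_bool_natr (R : realType) d (T : measurableType d) (b : T -> bool) :
  measurable_fun setT b -> measurable_fun setT (fun x => (b x)%:R : R).
Proof. by move=> mb; exact: (measurableT_comp (f := fun b : bool => b%:R : R)). Qed.

Lemma measure_integral_bool (R : realType) d (T : measurableType d)
    (mu : {measure set T -> \bar R}) (b : T -> bool) : measurable [set x | b x] ->
  mu [set x | b x] = (\int[mu]_x ((b x)%:R)%:E)%E.
Proof.
move=> mb; rewrite -[X in mu X]setIT -integral_indic//.
by apply: eq_integral => x _; rewrite indicE mem_setE.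
Qed.

Section IntervalBounds.
Context (R : realType) (d : measure_display) (T : measurableType d).
Context (Pr : probability T R) (I : eqType) (X : I -> T -> R).
Hypothesis mX : forall k, measurable_fun setT (X k).
Hypothesis indX : mutually_independent Pr X.
Hypothesis lawX : forall k (A : set R), measurable A ->
  Pr (X k @^-1` A) = normal_prob 0 (Num.sqrt (2^-1)) A.
Notation genT := (genT X).
Notation sg := (Num.sqrt (2^-1 : R)).

(** Conditioning on [K]: weight, centre and width are frozen, and only the Gaussian coordinate [k]
    is integrated. *)
Lemma interval_eq (K : set I) k (f a l : genT K -> R) : ~ K k ->
  measurable_fun setT f -> measurable_fun setT a -> measurable_fun setT l ->
  (forall w, 0 <= f w) ->
  (\int[Pr]_w (f w * (`|X k w - a w| <= l w)%R%:R)%:E =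
   \int[Pr]_w ((f w)%:E * normal_prob 0 sg [set x | (`|x - a w| <= l w)%R]))%E.
Proof.
move=> nKk mf ma ml f0.
pose F (z : measurableTypeR R * genT K) : \bar R :=
  (f z.2 * (`|z.1 - a z.2| <= l z.2)%R%:R)%:E.
rewrite (genT_fubini mX indX (mu := normal_prob 0 sg) (F := F) (lawX k) nKk).
- apply: eq_integral => w _ /=.
  have -> : normal_prob 0 sg [set x | `|x - a w| <= l w] =
      (\int[normal_prob 0 sg]_x ((`|x - a w| <= l w)%R%:R)%:E)%E.
    exact: (measure_integral_bool (normal_prob 0 sg) (measurable_dist _ _)).
  rewrite -ge0_integralZl//=.
  - apply/measurable_EFinP/measurable_bool_natr/measurable_fun_ler => //.
    by apply: measurableT_comp => //; exact: measurable_funB.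
  - by rewrite lee_fin.
- apply/measurable_EFinP; apply: measurable_funM.
    exact: measurableT_comp.
  apply: measurable_bool_natr; apply: measurable_fun_ler.
    apply: measurableT_comp => //; apply: measurable_funB => //.
    exact: measurableT_comp.
  exact: measurableT_comp.
- by move=> z; rewrite lee_fin mulr_ge0.
Qed.

Lemma interval_le (K : set I) k (f a l : genT K -> R) : ~ K k ->
  measurable_fun setT f -> measurable_fun setT a -> measurable_fun setT l ->
  (forall w, 0 <= f w) -> (forall w, 0 <= l w) ->
  (\int[Pr]_w (f w * (`|X k w - a w| <= l w)%R%:R)%:E <=
   \int[Pr]_w (2 * f w * l w)%:E)%E.
Proof.
move=> nKk mf ma ml f0 l0; rewrite interval_eq//.
apply: ge0_le_integral_nomeas => w; first by rewrite mule_ge0// lee_fin.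
rewrite [2 * _]mulrC -mulrA EFinM lee_wpmul2l ?lee_fin//.
exact: normal_half_dist_le.
Qed.

Lemma interval_ge (K : set I) k (A : set (genT K)) (a : genT K -> R) (l M : R) :
  ~ K k -> measurable A -> measurable_fun setT a -> 0 <= l ->
  (forall w, A w -> `|a w| + l <= M) ->
  (((normal_peak sg * expR (- M ^+ 2)) * (2 * l))%:E * Pr (A : set T) <=
   Pr ((A : set T) `&` [set w | (`|X k w - a w| <= l)%R]))%E.
Proof.
move=> nKk mA ma l0 aM.
have mA' := genT_measurable mX mA.
have mB : measurable [set w : T | `|X k w - a w| <= l].
  rewrite -[X in measurable X]setTI; apply: measurable_fun_ler => //.
  by apply: measurableT_comp => //; apply: measurable_funB => //; exact: genT_fun_measurable.
rewrite -[X in (_ <= Pr X)%E]setIT -integral_indic//; last exact: measurableI.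
rewrite (eq_integral (fun w : T => (\1_(A : set T) w * (`|X k w - a w| <= l)%R%:R)%:E)); last first.
  move=> w _; rewrite indicI /= !indicE; congr (_ * (nat_of_bool _)%:R)%:E.
  by apply/idP/idP; rewrite inE.
rewrite (interval_eq (f := \1_A) (l := fun=> l) nKk)//.
rewrite -[X in (_ * Pr X)%E]setIT -integral_indic// -ge0_integralZl//; last 2 first.
- exact/measurable_EFinP/measurable_indic.
- by rewrite lee_fin !mulr_ge0 ?expR_ge0 ?normal_peak_ge0.
apply: ge0_le_integral_nomeas => w.
  by rewrite mule_ge0// lee_fin ?mulr_ge0 ?expR_ge0 ?normal_peak_ge0.
rewrite muleC indicE; have [Aw|nAw] := boolP (w \in A); last by rewrite !mul0e.
by rewrite !mul1e; apply: normal_half_dist_ge => //; apply: aM; rewrite inE in Aw.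
Qed.

End IntervalBounds.

(** * Complex vectors of length two *)

Section ComplexModulus.
Context (R : realType).
Notation C := (R[i]).
Implicit Types (z y : C) (a : R).

Lemma ocplxE a : ocplx a = (a%:C)%C. Proof. by []. Qed.

Lemma ocplxM a b : ocplx (a * b) = ocplx a * ocplx b :> C.
Proof. by rewrite !ocplxE rmorphM. Qed.

Lemma ocplxV a : ocplx a^-1 = (ocplx a)^-1 :> C.
Proof. by rewrite !ocplxE fmorphV. Qed.

Lemma ocplx_eq0 a : (ocplx a == 0 :> C) = (a == 0).
Proof. by rewrite ocplxE fmorph_eq0. Qed.

Lemma abs2_ge0 z : 0 <= abs2 z. Proof. by rewrite addr_ge0 ?sqr_ge0. Qed.

Lemma cabs_ge0 z : 0 <= cabs z. Proof. exact: sqrtr_ge0. Qed.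

Lemma sqr_cabs z : cabs z ^+ 2 = abs2 z.
Proof. by rewrite sqr_sqrtr// abs2_ge0. Qed.

Lemma cabsE z : (cabs z)%:C%C = `|z|. Proof. by rewrite normc_def. Qed.

Lemma cabsM z y : cabs (z * y) = cabs z * cabs y.
Proof. by apply: complexI; rewrite rmorphM /= !cabsE normrM. Qed.

Lemma cabsV z : cabs z^-1 = (cabs z)^-1.
Proof. by apply: complexI; rewrite fmorphV /= !cabsE normfV. Qed.

Lemma cabsN z : cabs (- z) = cabs z.
Proof. by apply: complexI; rewrite /= !cabsE normrN. Qed.

Lemma cabs_conj z : cabs (conjc z) = cabs z.
Proof. by apply: complexI; rewrite /= !cabsE normcJ. Qed.

Lemma cabs_ocplx a : cabs (ocplx a) = `|a|.
Proof. by rewrite /cabs /abs2 /= expr0n /= addr0 sqrtr_sqr. Qed.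

Lemma cabs0 : cabs (0 : C) = 0.
Proof. by apply: complexI; rewrite cabsE normr0. Qed.

Lemma cabs1 : cabs (1 : C) = 1.
Proof. by apply: complexI; rewrite cabsE normr1. Qed.

Lemma cabs_eq0 z : (cabs z == 0) = (z == 0).
Proof. by rewrite -(inj_eq (@complexI R)) cabsE normr_eq0. Qed.

Lemma cabs_gt0 z : (0 < cabs z) = (z != 0).
Proof. by rewrite lt_def cabs_ge0 andbT cabs_eq0. Qed.

Lemma cabsD z y : cabs (z + y) <= cabs z + cabs y.
Proof. by rewrite -lecR rmorphD /= !cabsE ler_normD. Qed.

Lemma cabsB z y : cabs (z - y) <= cabs z + cabs y.
Proof. by rewrite (le_trans (cabsD _ _))// cabsN. Qed.

Lemma cabs_distC z y : cabs (z - y) = cabs (y - z).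
Proof. by rewrite -cabsN opprB. Qed.

Lemma cabs_ler_dist z y : cabs z - cabs y <= cabs (z - y).
Proof. by rewrite lerBlDr -{1}(subrK y z) cabsD. Qed.

Lemma Re_le_cabs z : `|complex.Re z| <= cabs z.
Proof. by rewrite -sqrtr_sqr ler_wsqrtr// lerDl sqr_ge0. Qed.

Lemma Im_le_cabs z : `|complex.Im z| <= cabs z.
Proof. by rewrite -sqrtr_sqr ler_wsqrtr// lerDr sqr_ge0. Qed.

Lemma cabs_le_ReIm z : cabs z <= `|complex.Re z| + `|complex.Im z|.
Proof.
have h : 0 <= `|complex.Re z| + `|complex.Im z| by rewrite addr_ge0.
rewrite -(ger0_norm h) -sqrtr_sqr ler_wsqrtr// /abs2 -[complex.Re z ^+ 2]real_normK ?num_real//.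
rewrite -[complex.Im z ^+ 2]real_normK ?num_real//.
have := normr_ge0 (complex.Re z); have := normr_ge0 (complex.Im z); nra.
Qed.

Lemma mulcJ z : z * conjc z = ocplx (abs2 z).
Proof. by case: z => a b; rewrite /ocplx /abs2 /=; simpc; congr (_ +i* _)%C; ring. Qed.

Lemma mulJc z : conjc z * z = ocplx (abs2 z).
Proof. by rewrite mulrC mulcJ. Qed.

Lemma ocplx_cabs2 z : ocplx (cabs z) * ocplx (cabs z) = z * conjc z.
Proof. by rewrite -ocplxM -expr2 sqr_cabs mulcJ. Qed.

Lemma conjc_ocplx a : conjc (ocplx a) = ocplx a :> C.
Proof. exact: conjc_real. Qed.

Lemma conjcM z y : conjc (z * y) = conjc z * conjc y.
Proof. exact: rmorphM. Qed.

Lemma abs2M z y : abs2 (z * y) = abs2 z * abs2 y.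
Proof. by rewrite -!sqr_cabs cabsM exprMn. Qed.

(** The value 1 at 0 keeps the modulus equal to 1 everywhere. *)
Definition phase z : C := if z == 0 then 1 else z / ocplx (cabs z).

Lemma cabs_phase z : cabs (phase z) = 1.
Proof.
rewrite /phase; case: eqP => [_|/eqP z0]; first exact: cabs1.
by rewrite cabsM cabsV cabs_ocplx ger0_norm ?cabs_ge0// divff// cabs_eq0.
Qed.

Lemma phaseK z : ocplx (cabs z) * phase z = z.
Proof.
rewrite /phase; case: eqP => [->|/eqP z0]; first by rewrite cabs0 mulr1.
by rewrite mulrC divfK// ocplx_eq0 cabs_eq0.
Qed.

(** Rotating by the conjugate phase of [y] makes [y] real, so the imaginary part of the rotated sum
    sees [z] alone. A small sum thus confines [z] to a strip whose direction depends on [y] only. *)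
Lemma Im_phase_le z y r : cabs (z + y) <= r ->
  `|complex.Im (conjc (phase y) * z)| <= r.
Proof.
move=> h.
have -> : complex.Im (conjc (phase y) * z) = complex.Im (conjc (phase y) * (z + y)).
  have e : conjc (phase y) * y = ocplx (cabs y).
    rewrite -{2}(phaseK y) mulrCA mulJc -sqr_cabs cabs_phase expr1n.
    by rewrite -ocplxM mulr1.
  by rewrite mulrDr e [complex.Im _]/=; case: (_ * z) => ? ? /=; rewrite addr0.
by rewrite (le_trans (Im_le_cabs _))// cabsM cabs_conj cabs_phase mul1r.
Qed.

(** Over the denominator |z||y| the difference is z(|y| - |z|) + (z - y)|z|. For [z = 0] the
    quotient by zero is 0 and the bound reads 1 <= 2. *)
Lemma cabs_unit_dist z y : y != 0 ->
  cabs (z / ocplx (cabs z) - y / ocplx (cabs y)) <= 2 * cabs (z - y) / cabs y.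
Proof.
move=> y0; have y0' : 0 < cabs y by rewrite cabs_gt0.
have oy : ocplx (cabs y) != 0 :> C by rewrite ocplx_eq0 cabs_eq0.
have [->|z0] := eqVneq z 0.
  rewrite mul0r !sub0r !cabsN cabsM cabsV cabs_ocplx ger0_norm ?cabs_ge0//.
  by rewrite divff ?gt_eqF// -mulrA divff ?gt_eqF//; lra.
have z0' : 0 < cabs z by rewrite cabs_gt0.
have oz : ocplx (cabs z) != 0 :> C by rewrite ocplx_eq0 cabs_eq0.
have -> : z / ocplx (cabs z) - y / ocplx (cabs y) =
    (z * (ocplx (cabs y) - ocplx (cabs z)) + (z - y) * ocplx (cabs z)) /
    (ocplx (cabs z) * ocplx (cabs y)) by field; apply/andP.
rewrite cabsM cabsV cabsM !cabs_ocplx !ger0_norm ?cabs_ge0//.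
rewrite invfM mulrA ler_pM2r ?invr_gt0// ler_pdivrMr//.
rewrite (le_trans (cabsD _ _))// !cabsM cabs_ocplx (ger0_norm (cabs_ge0 z)).
have -> : ocplx (cabs y) - ocplx (cabs z) = ocplx (cabs y - cabs z) :> C.
  by rewrite !ocplxE rmorphB.
rewrite cabs_ocplx.
have : `|cabs y - cabs z| <= cabs (z - y).
  have h1 := cabs_ler_dist z y; have h2 := cabs_ler_dist y z.
  by rewrite cabs_distC in h2; rewrite ler_norml; apply/andP; split; lra.
move=> h; have := ler_wpM2l (ltW z0') h; lra.
Qed.

End ComplexModulus.

Lemma otherK : involutive other.
Proof. by case; case=> [|[|//]] ?; apply/val_inj. Qed.

Lemma other0 : other ord0 = ord_max. Proof. by []. Qed.
Lemma other1 : other ord_max = ord0. Proof. by []. Qed.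

Lemma ord2P (k : 'I_2) : k = ord0 \/ k = ord_max.
Proof. by case: k => [[|[|//]]] ?; [left|right]; apply/val_inj. Qed.

Lemma other_neq (k : 'I_2) : other k != k.
Proof. by case: (ord2P k) => ->. Qed.

Lemma big_ord2 (R : zmodType) (F : 'I_2 -> R) (k : 'I_2) :
  \sum_(l < 2) F l = F k + F (other k).
Proof.
rewrite big_ord_recl big_ord1.
have -> : lift ord0 ord0 = ord_max :> 'I_2 by apply/val_inj.
by case: (ord2P k) => ->; rewrite ?other0 ?other1// addrC.
Qed.

(** * Zero forcing and quantization scores expressed by two-by-two determinants *)

Section PlaneGeometry.
Context (R : realType).
Notation C := (R[i]).
Notation cvec := (cvec R).
Implicit Types (u v a b h : cvec) (k : 'I_2).

(** The determinant with entry [k] listed first, so that passing to the other entry flips the sign;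
    the zero-forcing formulas then have one shape for both antennas. *)
Definition det2 k u v : C := u k * v (other k) - u (other k) * v k.
(** Serves both for the codeword generated by a Gaussian vector and for the phase-normalised true
    channel direction. *)
Definition cword a : cvec := phase_norm (normalize a).
Definition zfdir u v : cvec := normalize (proj_perp u v).

Lemma vnorm_ge0 u : 0 <= vnorm u. Proof. exact: sqrtr_ge0. Qed.

Lemma sqr_vnorm u k : vnorm u ^+ 2 = cabs (u k) ^+ 2 + cabs (u (other k)) ^+ 2.
Proof.
rewrite sqr_sqrtr; first by rewrite (big_ord2 _ k) !sqr_cabs.
by apply: sumr_ge0 => l _; exact: abs2_ge0.
Qed.

Lemma cabs_le_vnorm u k : cabs (u k) <= vnorm u.
Proof.
rewrite -(@ler_sqr _ (cabs _)) ?nnegrE ?cabs_ge0 ?vnorm_ge0// (sqr_vnorm u k).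
by rewrite lerDl sqr_ge0.
Qed.

Lemma vnorm_le_cabs u k : vnorm u <= cabs (u k) + cabs (u (other k)).
Proof.
have h0 := cabs_ge0 (u k); have h1 := cabs_ge0 (u (other k)).
rewrite -(@ler_sqr _ (vnorm _)) ?nnegrE ?addr_ge0 ?vnorm_ge0// (sqr_vnorm u k).
by nra.
Qed.

Lemma vnorm_gt0 u k : u k != 0 -> 0 < vnorm u.
Proof. by rewrite -cabs_gt0 => h; exact: lt_le_trans h (cabs_le_vnorm u k). Qed.

Lemma vnorm_scale c u : vnorm (scalev c u) = cabs c * vnorm u.
Proof.
apply/eqP; rewrite -(@eqrXn2 _ 2) ?vnorm_ge0 ?mulr_ge0 ?cabs_ge0 ?vnorm_ge0//.
by rewrite exprMn !(sqr_vnorm _ ord0) /scalev !cabsM !exprMn mulrDr.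
Qed.

Lemma cabs_normalize_le1 u k : cabs (normalize u k) <= 1.
Proof.
rewrite /normalize /scalev cabsM cabs_ocplx ger0_norm ?invr_ge0 ?vnorm_ge0//.
have := vnorm_ge0 u; rewrite le_eqVlt => /orP[/eqP <-|h]; first by rewrite invr0 mul0r.
by rewrite mulrC ler_pdivrMr// mul1r cabs_le_vnorm.
Qed.

Lemma det2_other k u v : det2 (other k) u v = - det2 k u v.
Proof. by rewrite /det2 otherK opprB. Qed.

Lemma det2C k u v : det2 k u v = - det2 k v u.
Proof. by rewrite /det2; ring. Qed.

Lemma cabs_det2 k u v : cabs (det2 k u v) = cabs (det2 ord0 u v).
Proof. by case: (ord2P k) => -> //; rewrite -other0 det2_other cabsN. Qed.

Lemma cabs_det2_le k u v : cabs (det2 k u v) <= vnorm u * vnorm v.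
Proof.
rewrite (le_trans (cabsB _ _))// !cabsM.
rewrite -(@ler_sqr _ _ (_ * _)) ?nnegrE ?addr_ge0 ?mulr_ge0 ?cabs_ge0 ?vnorm_ge0//.
rewrite exprMn (sqr_vnorm u k) (sqr_vnorm v k).
set x := cabs _; set y := cabs _; set z := cabs _; set t := cabs _.
by have := sqr_ge0 (x * t - z * y); nra.
Qed.

Lemma det2_scale k (c c' : C) u v : det2 k (scalev c u) (scalev c' v) = c * c' * det2 k u v.
Proof. by rewrite /det2 /scalev; ring. Qed.

Lemma phase_norm_idem u : phase_norm (phase_norm u) = phase_norm u.
Proof.
rewrite {2 3}/phase_norm; case: eqP => [e|/eqP u0].
  by rewrite /phase_norm e eqxx.
have h : conjc (u ord0) / ocplx (cabs (u ord0)) * u ord0 = ocplx (cabs (u ord0)).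
  have o : ocplx (cabs (u ord0)) != 0 :> C by rewrite ocplx_eq0 cabs_eq0.
  by apply: (mulfI o); rewrite ocplx_cabs2; field.
set u' := scalev _ u; have hu' : u' ord0 = ocplx (cabs (u ord0)) by [].
rewrite /phase_norm hu' ocplx_eq0 cabs_eq0 (negbTE u0).
rewrite conjc_ocplx cabs_ocplx ger0_norm ?cabs_ge0// divff ?ocplx_eq0 ?cabs_eq0//.
by apply/funext => k; rewrite /scalev mul1r.
Qed.

Lemma cwordE a k : a ord0 != 0 ->
  cword a k = conjc (a ord0) / ocplx (cabs (a ord0) * vnorm a) * a k.
Proof.
move=> a0; have na := vnorm_gt0 a0.
have on : ocplx (vnorm a) != 0 :> C by rewrite ocplx_eq0 gt_eqF.
have oa : ocplx (cabs (a ord0)) != 0 :> C by rewrite ocplx_eq0 cabs_eq0.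
rewrite /cword /phase_norm /normalize {1}/scalev mulf_eq0 ocplx_eq0 invr_eq0.
rewrite gt_eqF//= (negbTE a0) /scalev conjcM conjc_ocplx cabsM cabs_ocplx.
rewrite ger0_norm ?invr_ge0 ?vnorm_ge0// ocplxM [in RHS]ocplxM ocplxV.
by field; apply/andP.
Qed.

Lemma cword_scale a : a ord0 != 0 ->
  cword a = scalev (conjc (a ord0) / ocplx (cabs (a ord0) * vnorm a)) a.
Proof. by move=> a0; apply/funext => k; rewrite cwordE. Qed.

Lemma cword_coef_abs a : a ord0 != 0 ->
  cabs (conjc (a ord0) / ocplx (cabs (a ord0) * vnorm a)) = (vnorm a)^-1.
Proof.
move=> a0; rewrite cabsM cabsV cabs_conj cabs_ocplx.
rewrite ger0_norm ?mulr_ge0 ?cabs_ge0 ?vnorm_ge0// invfM mulrA divff ?mul1r//.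
by rewrite cabs_eq0.
Qed.

Lemma cabs_cword a k : a ord0 != 0 -> cabs (cword a k) = cabs (a k) / vnorm a.
Proof. by move=> a0; rewrite cwordE// cabsM cword_coef_abs// mulrC. Qed.

Lemma cword0 a : a ord0 != 0 -> cword a ord0 = ocplx (cabs (a ord0) / vnorm a).
Proof.
move=> a0; rewrite cwordE// mulrAC mulJc -ocplxV -ocplxM -sqr_cabs; congr ocplx.
by field; rewrite cabs_eq0 a0 gt_eqF// (vnorm_gt0 a0).
Qed.

Lemma vnorm_cword a : a ord0 != 0 -> vnorm (cword a) = 1.
Proof.
move=> a0; rewrite cword_scale// vnorm_scale cword_coef_abs// mulVf//.
by rewrite gt_eqF// (vnorm_gt0 a0).
Qed.

Lemma cword_neq0 a : cword a ord0 != 0 -> a ord0 != 0.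
Proof.
apply: contra => /eqP h; rewrite /cword /phase_norm /normalize {1}/scalev h mulr0 eqxx.
by rewrite /scalev h mulr0.
Qed.

(** In dimension two the orthogonal complement of [u] is a line: writing the coefficient 1 of [v k]
    as |u_k|^2 + |u_other|^2 exposes the determinant. *)
Lemma proj_perp_unit u v k : vnorm u = 1 ->
  proj_perp u v k = - conjc (u (other k)) * det2 k u v.
Proof.
move=> nu; rewrite /proj_perp nu expr1n divr1 /dotH (big_ord2 _ k).
have e : u k * conjc (u k) + u (other k) * conjc (u (other k)) = 1.
  rewrite !mulcJ -!sqr_cabs !ocplxE -rmorphD /= -sqr_vnorm nu expr1n.
  by [].
apply/eqP; rewrite -subr_eq0; apply/eqP; rewrite -[RHS](mulr0 (v k)) -(subrr 1).
by rewrite -[X in 1 - X]e /det2; ring.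
Qed.

Lemma vnorm_proj_perp u v : vnorm u = 1 ->
  vnorm (proj_perp u v) = cabs (det2 ord0 u v).
Proof.
move=> nu; apply/eqP; rewrite -(@eqrXn2 _ 2) ?vnorm_ge0 ?cabs_ge0//.
rewrite (sqr_vnorm _ ord0) !proj_perp_unit// !cabsM !cabsN !cabs_conj otherK.
rewrite (cabs_det2 (other ord0)) !exprMn -mulrDl addrC -sqr_vnorm nu expr1n.
by rewrite mul1r.
Qed.

Lemma zfdir_unit u v k : vnorm u = 1 ->
  zfdir u v k = - conjc (u (other k)) * (det2 k u v / ocplx (cabs (det2 k u v))).
Proof.
move=> nu; rewrite /zfdir /normalize /scalev vnorm_proj_perp// proj_perp_unit//.
by rewrite (cabs_det2 k) ocplxV; ring.
Qed.

Lemma cabs_det2_cword a b k : a ord0 != 0 -> b ord0 != 0 ->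
  cabs (det2 k (cword a) (cword b)) =
  (vnorm a)^-1 * (vnorm b)^-1 * cabs (det2 k a b).
Proof.
move=> a0 b0.
by rewrite !cword_scale// det2_scale cabsM [cabs (_ * _)]cabsM !cword_coef_abs.
Qed.

(** The phase normalisation of [a] occurs once conjugated and once in the determinant, so it
    cancels; that of [b] survives as the last factor. Apart from it the right side is polynomial in
    the entries and their conjugates, and affine in [a k]. *)
Lemma zfdir_cword a b k : a ord0 != 0 -> b ord0 != 0 ->
  ocplx (vnorm a * cabs (det2 k a b)) * zfdir (cword a) (cword b) k =
  - conjc (a (other k)) * det2 k a b * (conjc (b ord0) / ocplx (cabs (b ord0))).
Proof.
move=> a0 b0.
have na := vnorm_gt0 a0; have nb := vnorm_gt0 b0.
rewrite zfdir_unit ?vnorm_cword// cabs_det2_cword// !cword_scale// det2_scale.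
rewrite /scalev !conjcM conjcK.
have [->|D0] := eqVneq (det2 k a b) 0.
  by rewrite cabs0 !mulr0 !mul0r.
have oD : ocplx (cabs (det2 k a b)) != 0 :> C by rewrite ocplx_eq0 cabs_eq0.
have oa : ocplx (cabs (a ord0)) != 0 :> C by rewrite ocplx_eq0 cabs_eq0.
have ob : ocplx (cabs (b ord0)) != 0 :> C by rewrite ocplx_eq0 cabs_eq0.
have ona : ocplx (vnorm a) != 0 :> C by rewrite ocplx_eq0 gt_eqF.
have onb : ocplx (vnorm b) != 0 :> C by rewrite ocplx_eq0 gt_eqF.
rewrite conjc_inv conjc_ocplx !ocplxM !ocplxV.
have e : conjc (a ord0) = ocplx (cabs (a ord0)) * ocplx (cabs (a ord0)) / a ord0.
  by rewrite ocplx_cabs2 mulrAC divff// mul1r.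
rewrite e; field.
by rewrite oD oa ob ona onb a0.
Qed.


Lemma r3dotE u v : r3dot u v = complex.Re (u ord0) * complex.Re (v ord0) +
  complex.Re (conjc (u ord_max) * v ord_max).
Proof.
rewrite /r3dot !big_ord_recl big_ord0 /r3 /= addr0.
by case: (u ord_max) => x y; case: (v ord_max) => z t /=; ring.
Qed.

(** With real first entries the product in R^3 is the real part of the Hermitian one, so scores and
    Euclidean distances determine each other. *)
Lemma r3dot_dist u v : complex.Im (u ord0) = 0 -> complex.Im (v ord0) = 0 ->
  vnorm u = 1 -> vnorm v = 1 ->
  cabs (u ord0 - v ord0) ^+ 2 + cabs (u ord_max - v ord_max) ^+ 2 = 2 - 2 * r3dot u v.
Proof.
move=> u0 v0 nu nv; have := sqr_vnorm u ord0; have := sqr_vnorm v ord0.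
rewrite nu nv expr1n other0 !sqr_cabs r3dotE.
move: u0 v0; rewrite /abs2.
case: (u ord0) => x y; case: (v ord0) => z t; case: (u ord_max) => x1 y1.
case: (v ord_max) => z1 t1 /= -> -> h1 h2.
by nra.
Qed.

Lemma r3dotN u v : r3dot (fun k => - u k) v = - r3dot u v.
Proof.
rewrite !r3dotE; case: (u ord0) => x y; case: (v ord0) => z t.
case: (u ord_max) => x1 y1; case: (v ord_max) => z1 t1 /=; ring.
Qed.

Lemma vnormN u : vnorm (fun k => - u k) = vnorm u.
Proof.
by apply/eqP; rewrite -(@eqrXn2 _ 2) ?vnorm_ge0// !(sqr_vnorm _ ord0) !cabsN.
Qed.

(** The absolute value in the score leaves the alternative that [u] is near [- v]. It is excluded by
    the first entries: that of [u] is nonnegative and that of [v] exceeds [rho]. *)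
Lemma qscore_near (u v : cvec) (rho : R) : 0 <= rho ->
  complex.Im (u ord0) = 0 -> complex.Im (v ord0) = 0 ->
  vnorm u = 1 -> vnorm v = 1 -> 0 <= complex.Re (u ord0) ->
  rho < complex.Re (v ord0) -> 1 - rho ^+ 2 / 2 <= `|r3dot u v| ->
  forall k, cabs (u k - v k) <= rho.
Proof.
move=> rho0 iu iv nu nv ru rv; rewrite ler_normr => /orP[h|h] k.
  have e := r3dot_dist iu iv nu nv.
  rewrite -(@ler_sqr _ (cabs _)) ?nnegrE ?cabs_ge0//.
  have q0 := sqr_ge0 (cabs (u ord0 - v ord0)).
  have q1 := sqr_ge0 (cabs (u ord_max - v ord_max)).
  by case: (ord2P k) => ->; lra.
have iu' : complex.Im (- u ord0) = 0.
  by move: iu; case: (u ord0) => x y /= ->; rewrite oppr0.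
have := r3dot_dist (u := fun k => - u k) iu' iv.
rewrite vnormN r3dotN => /(_ nu nv) e.
have q1 := sqr_ge0 (cabs (- u ord_max - v ord_max)).
have h1 : cabs (- u ord0 - v ord0) ^+ 2 <= rho ^+ 2 by lra.
rewrite ler_sqr ?nnegrE ?cabs_ge0// in h1.
have := le_trans (Re_le_cabs _) h1; rewrite ler_norml => /andP[+ _].
have -> : complex.Re (- u ord0 - v ord0) = - complex.Re (u ord0) - complex.Re (v ord0).
  by case: (u ord0) => ? ?; case: (v ord0).
by lra.
Qed.

(** In terms of the slopes z, y the vectors are (1, z)/A and (1, y)/B, and one minus their product
    equals (|z - y|^2 - (A - B)^2)/(2AB), where AB >= 1. *)
Lemma r3dot_cword_ge a h (rho : R) : a ord0 != 0 -> h ord0 != 0 ->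
  cabs (a ord_max / a ord0 - h ord_max / h ord0) <= rho ->
  1 - rho ^+ 2 / 2 <= r3dot (cword a) (cword h).
Proof.
move=> a0 h0 rhoP.
set z := a ord_max / a ord0 in rhoP *; set y := h ord_max / h ord0 in rhoP *.
pose A := Num.sqrt (1 + abs2 z); pose B := Num.sqrt (1 + abs2 y).
have A2 : A ^+ 2 = 1 + abs2 z by rewrite sqr_sqrtr// addr_ge0// abs2_ge0.
have B2 : B ^+ 2 = 1 + abs2 y by rewrite sqr_sqrtr// addr_ge0// abs2_ge0.
have A1 : 1 <= A by rewrite -sqrtr1 ler_wsqrtr// lerDl abs2_ge0.
have B1 : 1 <= B by rewrite -sqrtr1 ler_wsqrtr// lerDl abs2_ge0.
have key (b : cvec) (t : C) (E : R) : b ord0 != 0 -> t = b ord_max / b ord0 -> 1 <= E ->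
    E ^+ 2 = 1 + abs2 t ->
    cword b ord0 = ocplx E^-1 /\ cword b ord_max = ocplx E^-1 * t.
  move=> b0 tE E1 E2; have nb := vnorm_gt0 b0.
  have E0 : 0 < E by rewrite (lt_le_trans _ E1).
  have hE : vnorm b = cabs (b ord0) * E.
    apply/eqP; rewrite -(@eqrXn2 _ 2) ?vnorm_ge0 ?mulr_ge0 ?cabs_ge0 ?(ltW E0)//.
    rewrite exprMn E2 (sqr_vnorm _ ord0) other0 mulrDr mulr1 -!sqr_cabs -exprMn -cabsM.
    by rewrite tE mulrC divfK.
  have cb0 : cabs (b ord0) != 0 by rewrite cabs_eq0.
  have e0 : cword b ord0 = ocplx E^-1.
    by rewrite cword0// hE; congr ocplx; field; rewrite cb0 gt_eqF.
  split => //; rewrite -e0 !cwordE// tE; field.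
  by rewrite b0 ocplx_eq0 mulf_neq0// gt_eqF.
have [ea0 ea1] := key a z A a0 erefl A1 A2.
have [eh0 eh1] := key h y B h0 erefl B1 B2.
have -> : r3dot (cword a) (cword h) = (1 + complex.Re (conjc z * y)) / (A * B).
  rewrite r3dotE ea0 ea1 eh0 eh1 /ocplx.
  case: (z) => x1 x2; case: (y) => y1 y2 /=; field.
  by rewrite !gt_eqF// (lt_le_trans _ A1, lt_le_trans _ B1).
have AB1 : 1 <= A * B by rewrite mulr_ege1.
have AB0 : 0 < A * B by rewrite (lt_le_trans _ AB1).
rewrite ler_pdivlMr//.
have e : cabs (z - y) ^+ 2 = A ^+ 2 + B ^+ 2 - 2 - 2 * complex.Re (conjc z * y).
  rewrite sqr_cabs A2 B2; case: (z) => x1 x2; case: (y) => y1 y2.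
  by rewrite /abs2 /=; ring.
have h1 : cabs (z - y) ^+ 2 <= rho ^+ 2.
  by rewrite ler_sqr ?nnegrE ?cabs_ge0// (le_trans _ rhoP)// cabs_ge0.
have h2 : cabs (z - y) ^+ 2 <= rho ^+ 2 * (A * B).
  by rewrite (le_trans h1)// ler_peMr// sqr_ge0.
have := sqr_ge0 (A - B).
nra.
Qed.

Lemma det2_dist u v u' v' k (rho : R) :
  vnorm u = 1 -> vnorm v' = 1 -> vnorm v = 1 -> vnorm u' = 1 ->
  (forall l, cabs (u l - u' l) <= rho) -> (forall l, cabs (v l - v' l) <= rho) ->
  cabs (det2 k u v - det2 k u' v') <= 4 * rho.
Proof.
move=> nu nv' nv nu' hu hv.
have -> : det2 k u v - det2 k u' v' =
   (u k * (v (other k) - v' (other k)) + (u k - u' k) * v' (other k)) -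
   (u (other k) * (v k - v' k) + (u (other k) - u' (other k)) * v' k).
  by rewrite /det2; ring.
have p x y t : cabs x <= 1 -> cabs y <= rho -> cabs t <= 1 -> forall s,
    cabs s <= rho -> cabs (x * y + s * t) <= 2 * rho.
  move=> hx hy ht s hs; rewrite (le_trans (cabsD _ _))// !cabsM mulr2n mulrDl !mul1r.
  apply: lerD.
    by rewrite (le_trans _ hy)// ler_piMl// cabs_ge0.
  by rewrite (le_trans _ hs)// ler_piMr// cabs_ge0.
have le1 (w : cvec) l : vnorm w = 1 -> cabs (w l) <= 1.
  by move=> nw; have := cabs_le_vnorm w l; rewrite nw.
rewrite (le_trans (cabsB _ _))//.
have -> : 4 * rho = 2 * rho + 2 * rho by ring.
by apply: lerD; apply: p; rewrite ?le1.
Qed.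

(** The constant is 9 = 1 + 8: the conjugated entry moves by [rho], the determinant by at most 4
    [rho], and its phase by twice that over the modulus. The first term is absorbed since the
    determinant has modulus at most 1. *)
Lemma zfdir_dist u v u' v' k (rho : R) : 0 <= rho ->
  vnorm u = 1 -> vnorm v = 1 -> vnorm u' = 1 -> vnorm v' = 1 ->
  det2 ord0 u' v' != 0 ->
  (forall l, cabs (u l - u' l) <= rho) -> (forall l, cabs (v l - v' l) <= rho) ->
  cabs (zfdir u v k - zfdir u' v' k) <= 9 * rho / cabs (det2 ord0 u' v').
Proof.
move=> rho0 nu nv nu' nv' D0 hu hv.
have D0' : det2 k u' v' != 0 by rewrite -cabs_eq0 cabs_det2 cabs_eq0.
have Dgt0 : 0 < cabs (det2 ord0 u' v') by rewrite cabs_gt0.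
rewrite !zfdir_unit//.
set B := det2 k u v / _; set B' := det2 k u' v' / _.
have -> : - conjc (u (other k)) * B - - conjc (u' (other k)) * B' =
   - (conjc (u (other k) - u' (other k)) * B + conjc (u' (other k)) * (B - B')).
  by rewrite [conjc (_ - _)]rmorphB /=; ring.
rewrite cabsN (le_trans (cabsD _ _))//.
rewrite [cabs (conjc (u _ - _) * _)]cabsM [cabs (conjc (u' _) * _)]cabsM !cabs_conj.
have hB : cabs B <= 1.
  rewrite cabsM cabsV cabs_ocplx ger0_norm ?cabs_ge0//.
  have [->|x0] := eqVneq (cabs (det2 k u v)) 0; first by rewrite mul0r.
  by rewrite divff.
have hBB : cabs (B - B') <= 8 * rho / cabs (det2 ord0 u' v').
  rewrite (le_trans (cabs_unit_dist _ D0'))// cabs_det2 ler_pM2r ?invr_gt0//.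
  by have := det2_dist k nu nv' nv nu' hu hv; lra.
have D1 : cabs (det2 ord0 u' v') <= 1.
  by rewrite (le_trans (cabs_det2_le _ _ _))// nu' nv' mulr1.
have h1 : cabs (u (other k) - u' (other k)) * cabs B <= rho.
  by rewrite (le_trans _ (hu (other k)))// ler_piMr// cabs_ge0.
have h2 : cabs (u' (other k)) * cabs (B - B') <= 8 * rho / cabs (det2 ord0 u' v').
  by rewrite (le_trans _ hBB)// ler_piMl ?cabs_ge0// -nu' cabs_le_vnorm.
have h3 : rho <= rho / cabs (det2 ord0 u' v') by rewrite ler_pdivlMr// ler_piMr.
rewrite (le_trans (lerD h1 h2))// -!(mulrA _ rho).
by move: h3; set t := rho / _ => h3; lra.
Qed.

Lemma dotH_le u (t t' : cvec) (e : R) : vnorm u = 1 ->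
  (forall k, cabs (t k - t' k) <= e) -> cabs (dotH u t - dotH u t') <= 2 * e.
Proof.
move=> nu h; rewrite /dotH !(big_ord2 _ ord0).
set k1 := other ord0.
have -> : conjc (u ord0) * t ord0 + conjc (u k1) * t k1 -
    (conjc (u ord0) * t' ord0 + conjc (u k1) * t' k1) =
   conjc (u ord0) * (t ord0 - t' ord0) + conjc (u k1) * (t k1 - t' k1) by ring.
rewrite (le_trans (cabsD _ _))// !cabsM !cabs_conj.
have p k : cabs (u k) * cabs (t k - t' k) <= e.
  by rewrite (le_trans _ (h k))// ler_piMl ?cabs_ge0// -nu cabs_le_vnorm.
by have := p ord0; have := p k1; lra.
Qed.

Lemma dotH_zfdir_self u v : vnorm u = 1 -> dotH u (zfdir u v) = 0.
Proof.
move=> nu; rewrite /dotH (big_ord2 _ ord0) !zfdir_unit// otherK det2_other cabsN.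
by ring.
Qed.

(** This is the signal amplitude under perfect channel knowledge; it stays away from 0 exactly when
    the two channels are far from parallel. *)
Lemma cabs_dotH_zfdir u v : vnorm v = 1 ->
  cabs (dotH u (zfdir v u)) = cabs (det2 ord0 u v).
Proof.
move=> nv; rewrite /dotH (big_ord2 _ ord0) !zfdir_unit// otherK det2_other cabsN.
set k1 := other ord0.
have -> : conjc (u ord0) * (- conjc (v k1) * (det2 ord0 v u / ocplx (cabs (det2 ord0 v u)))) +
  conjc (u k1) * (- conjc (v ord0) * (- det2 ord0 v u / ocplx (cabs (det2 ord0 v u)))) =
  - (det2 ord0 v u / ocplx (cabs (det2 ord0 v u))) * conjc (det2 ord0 u v).
  by rewrite /det2 [conjc (_ - _)]rmorphB !rmorphM /=; ring.
rewrite det2C cabsM !cabsN cabsM cabsV cabs_ocplx cabs_conj cabsN ger0_norm ?cabs_ge0//.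
have [->|x0] := eqVneq (cabs (det2 ord0 u v)) 0; first by rewrite mulr0.
by rewrite divff// mul1r.
Qed.

End PlaneGeometry.

(** * Measurability *)

Section ComplexMeasurability.
Context (R : realType) (d : measure_display) (U : measurableType d).
Notation C := (R[i]).
Implicit Types (f g : U -> R) (F H : U -> C).

(** A real power is applied to the nonnegative base f^2, using 1/x = x (x^2)^(-1), an identity that
    also holds at 0 with the convention 1/0 = 0. *)
Lemma measurable_funV f : measurable_fun setT f -> measurable_fun setT (fun w => (f w)^-1).
Proof.
move=> mf; rewrite (_ : (fun w => _) = (fun w => f w * ((f w ^+ 2) `^ (-1)))); last first.
  apply/funext => w; rewrite powR_inv1 ?sqr_ge0//.
  have [->|f0] := eqVneq (f w) 0; first by rewrite invr0 mul0r.
  by field.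
apply: measurable_funM => //.
by apply: (measurableT_comp (measurable_powR _)) => //; exact: measurable_funX.
Qed.

Lemma measurable_sqrt f : (forall w, 0 <= f w) -> measurable_fun setT f ->
  measurable_fun setT (fun w => Num.sqrt (f w)).
Proof.
move=> f0 mf; rewrite (_ : (fun w => _) = (fun w => f w `^ 2^-1)); last first.
  by apply/funext => w; rewrite powR12_sqrt.
exact: (measurableT_comp (measurable_powR _)).
Qed.

(** Going through real and imaginary parts keeps all measurability statements over the reals. *)
Definition cmeas F := measurable_fun setT (fun w => complex.Re (F w)) /\
  measurable_fun setT (fun w => complex.Im (F w)).

Lemma cmeas_cst (z : C) : cmeas (fun=> z).
Proof. by split; exact: measurable_cst. Qed.

Lemma cmeasD F H : cmeas F -> cmeas H -> cmeas (fun w => F w + H w).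
Proof.
move=> [F1 F2] [H1 H2]; split.
- rewrite (_ : (fun w => _) = (fun w => complex.Re (F w) + complex.Re (H w))).
    exact: measurable_funD.
  by apply/funext => w; case: (F w) => ? ?; case: (H w).
- rewrite (_ : (fun w => _) = (fun w => complex.Im (F w) + complex.Im (H w))).
    exact: measurable_funD.
  by apply/funext => w; case: (F w) => ? ?; case: (H w).
Qed.

Lemma cmeasN F : cmeas F -> cmeas (fun w => - F w).
Proof.
move=> [F1 F2]; split.
- rewrite (_ : (fun w => _) = (fun w => - complex.Re (F w))).
    exact: measurableT_comp.
  by apply/funext => w; case: (F w).
- rewrite (_ : (fun w => _) = (fun w => - complex.Im (F w))).
    exact: measurableT_comp.
  by apply/funext => w; case: (F w).
Qed.

Lemma cmeasB F H : cmeas F -> cmeas H -> cmeas (fun w => F w - H w).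
Proof. by move=> mF mH; apply: cmeasD => //; exact: cmeasN. Qed.

Lemma cmeas_conj F : cmeas F -> cmeas (fun w => conjc (F w)).
Proof.
move=> [F1 F2]; split.
- rewrite (_ : (fun w => _) = (fun w => complex.Re (F w)))//.
  by apply/funext => w; case: (F w).
- rewrite (_ : (fun w => _) = (fun w => - complex.Im (F w))).
    exact: measurableT_comp.
  by apply/funext => w; case: (F w).
Qed.

Lemma cmeasM F H : cmeas F -> cmeas H -> cmeas (fun w => F w * H w).
Proof.
move=> [F1 F2] [H1 H2]; split.
- rewrite (_ : (fun w => _) = (fun w => complex.Re (F w) * complex.Re (H w) -
      complex.Im (F w) * complex.Im (H w))).
    by apply: measurable_funB; exact: measurable_funM.
  by apply/funext => w; case: (F w) => ? ?; case: (H w).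
- rewrite (_ : (fun w => _) = (fun w => complex.Re (F w) * complex.Im (H w) +
      complex.Im (F w) * complex.Re (H w))).
    by apply: measurable_funD; exact: measurable_funM.
  by apply/funext => w; case: (F w) => ? ?; case: (H w).
Qed.

Lemma cmeas_ocplx f : measurable_fun setT f -> cmeas (fun w => ocplx (f w)).
Proof. by move=> mf; split => //=; exact: measurable_cst. Qed.

Lemma measurable_abs2 F : cmeas F -> measurable_fun setT (fun w => abs2 (F w)).
Proof. by move=> [F1 F2]; apply: measurable_funD; exact: measurable_funX. Qed.

Lemma measurable_cabs F : cmeas F -> measurable_fun setT (fun w => cabs (F w)).
Proof.
move=> mF; apply: measurable_sqrt; first by move=> w; exact: abs2_ge0.
exact: measurable_abs2.
Qed.

Lemma cmeasV F : cmeas F -> cmeas (fun w => (F w)^-1).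
Proof.
move=> mF; rewrite (_ : (fun w => _) = (fun w => ocplx (abs2 (F w))^-1 * conjc (F w))).
  apply: cmeasM; last exact: cmeas_conj.
  by apply/cmeas_ocplx/measurable_funV; exact: measurable_abs2.
apply/funext => w; rewrite ocplxV -mulcJ.
have [->|Fw] := eqVneq (F w) 0; first by rewrite mul0r invr0 mul0r.
by field; rewrite conjc_eq0 Fw.
Qed.

Lemma measurable_ceq0 F : cmeas F -> measurable_fun setT (fun w => F w == 0).
Proof.
move=> mF; rewrite (_ : (fun w => _) = (fun w => cabs (F w) <= 0)).
  by apply: measurable_fun_ler => //; exact: measurable_cabs.
by apply/funext => w; rewrite -cabs_eq0 eq_le cabs_ge0 andbT.
Qed.

Lemma cmeas_if (b : U -> bool) F H : measurable_fun setT b -> cmeas F -> cmeas H ->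
  cmeas (fun w => if b w then F w else H w).
Proof.
move=> mb [F1 F2] [H1 H2]; split.
- rewrite (_ : (fun w => _) = (fun w => if b w then complex.Re (F w) else complex.Re (H w))).
    exact: measurable_fun_ifT.
  by apply/funext => w; case: ifP.
- rewrite (_ : (fun w => _) = (fun w => if b w then complex.Im (F w) else complex.Im (H w))).
    exact: measurable_fun_ifT.
  by apply/funext => w; case: ifP.
Qed.

Lemma cmeas_phase F : cmeas F -> cmeas (fun w => phase (F w)).
Proof.
move=> mF; apply: cmeas_if; first exact: measurable_ceq0.
  exact: cmeas_cst.
apply: cmeasM => //; apply: cmeasV; apply: cmeas_ocplx; exact: measurable_cabs.
Qed.

Definition vmeas (V : U -> cvec R) := forall k, cmeas (fun w => V w k).

Lemma measurable_vnorm V : vmeas V -> measurable_fun setT (fun w => vnorm (V w)).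
Proof.
move=> mV; apply: measurable_sqrt.
  by move=> w; apply: sumr_ge0 => k _; exact: abs2_ge0.
rewrite (_ : (fun w => _) =
    (fun w => abs2 (V w ord0) + abs2 (V w (other ord0)))).
  by apply: measurable_funD; exact: measurable_abs2.
by apply/funext => w; rewrite (big_ord2 _ ord0).
Qed.

Lemma vmeas_normalize V : vmeas V -> vmeas (fun w => normalize (V w)).
Proof.
move=> mV k; apply: cmeasM => //; apply: cmeas_ocplx; apply: measurable_funV.
exact: measurable_vnorm.
Qed.

Lemma vmeas_phase_norm V : vmeas V -> vmeas (fun w => phase_norm (V w)).
Proof.
move=> mV k; rewrite (_ : (fun w => _) = (fun w => if V w ord0 == 0 then V w k else
    conjc (V w ord0) / ocplx (cabs (V w ord0)) * V w k)).
  apply: cmeas_if => //; first exact: measurable_ceq0.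
  apply: cmeasM => //; apply: cmeasM; first exact: cmeas_conj.
  by apply/cmeasV/cmeas_ocplx/measurable_cabs.
by apply/funext => w; rewrite /phase_norm; case: ifP.
Qed.

Lemma cmeas_dotH V W : vmeas V -> vmeas W -> cmeas (fun w => dotH (V w) (W w)).
Proof.
move=> mV mW; rewrite (_ : (fun w => _) = (fun w => conjc (V w ord0) * W w ord0 +
   conjc (V w (other ord0)) * W w (other ord0))).
  by apply: cmeasD; apply: cmeasM => //; exact: cmeas_conj.
by apply/funext => w; rewrite /dotH (big_ord2 _ ord0).
Qed.

Lemma vmeas_zfdir V W : vmeas V -> vmeas W -> vmeas (fun w => zfdir (V w) (W w)).
Proof.
move=> mV mW; apply: vmeas_normalize => k; apply: cmeasB => //; apply: cmeasM => //.
apply: cmeasM; first exact: cmeas_dotH.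
by apply/cmeasV/cmeas_ocplx/measurable_funX/measurable_vnorm.
Qed.

Lemma measurable_qscore V W : vmeas V -> vmeas W ->
  measurable_fun setT (fun w => qscore (V w) (W w)).
Proof.
move=> /vmeas_phase_norm mV /vmeas_phase_norm mW; apply: measurableT_comp => //.
rewrite (_ : (fun w => _) = (fun w =>
   complex.Re (phase_norm (V w) ord0) * complex.Re (phase_norm (W w) ord0) +
   complex.Re (conjc (phase_norm (V w) ord_max) * phase_norm (W w) ord_max))).
  apply: measurable_funD.
    by apply: measurable_funM; [case: (mV ord0)|case: (mW ord0)].
  by case: (cmeasM (cmeas_conj (mV ord_max)) (mW ord_max)).
by apply/funext => w; rewrite r3dotE.
Qed.

(** The preimage splits into countably many pieces by the value of the index. This is what makes the
    selected codeword measurable. *)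
Lemma measurable_select d' (V : measurableType d') (idx : U -> nat) (f : nat -> U -> V) :
  measurable_fun setT idx -> (forall n, measurable_fun setT (f n)) ->
  measurable_fun setT (fun w => f (idx w) w).
Proof.
move=> midx mf _ S mS; rewrite setTI.
rewrite (_ : _ @^-1` S = \bigcup_n (idx @^-1` [set n] `&` f n @^-1` S)).
  apply: bigcup_measurable => n _; apply: measurableI.
    by rewrite -[X in measurable X]setTI; exact: midx.
  by rewrite -[X in measurable X]setTI; exact: mf.
apply/seteqP; split=> [w Sw|w [n _ [/= <-]]] //.
by exists (idx w).
Qed.

Lemma measurable_best_index N (f : U -> nat -> R) :
  (forall n, measurable_fun setT (f ^~ n)) ->
  measurable_fun setT (fun w => best_index N (f w)).
Proof.
move=> mf; rewrite /best_index.
suff : forall s (b : U -> nat), measurable_fun setT b -> measurable_fun setT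
    (fun w => foldl (fun b n => if f w b < f w n then n else b) (b w) s).
  by apply; exact: measurable_cst.
elim=> [|n s IH] b mb //=.
apply: (IH (fun w => if f w (b w) < f w n then n else b w)).
apply: measurable_fun_ifT => //.
apply: measurable_fun_ltr => //.
exact: (measurable_select (f := fun n w => f w n) mb).
Qed.

End ComplexMeasurability.

Lemma best_index_max (R : realType) N (f : nat -> R) n : (n < N)%N ->
  f n <= f (best_index N f).
Proof.
case: N => // N; rewrite /best_index /= ltnS => nN.
(* Invariant of the fold: the running index scores at least as well as the start and as every
   scanned index. Index 0 is the start and is not in the scanned list. *)
suff H : forall s b, let m := foldl (fun b n => if f b < f n then n else b) b s in
    f b <= f m /\ forall i, i \in s -> f i <= f m.
  have [h0 h1] := H (iota 1 N) 0%N; case: n nN => // n nN; apply: h1.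
  by rewrite mem_iota /= add1n ltnS.
elim=> [|i s IH] b //=; case: ltP => h.
  have [h0 h1] := IH i; split; first exact: le_trans (ltW h) h0.
  by move=> j; rewrite inE => /orP[/eqP ->|/h1].
have [h0 h1] := IH b; split => // j; rewrite inE => /orP[/eqP ->|/h1//].
exact: le_trans h h0.
Qed.

Lemma best_index_lt (R : realType) N (f : nat -> R) : (0 < N)%N -> (best_index N f < N)%N.
Proof.
case: N => // N _; rewrite /best_index /=.
suff H : forall s b, (b < N.+1)%N -> (forall i, i \in s -> (i < N.+1)%N) ->
    (foldl (fun b n => if (f b < f n)%R then n else b) b s < N.+1)%N.
  by apply: H => // i; rewrite mem_iota add1n => /andP[].
elim=> [|i s IH] b //= bN h; apply: IH.
  by case: ifP => // _; apply: h; rewrite inE eqxx.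
by move=> j js; apply: h; rewrite inE js orbT.
Qed.

(** * Tail bounds, and Gaussian pairs confined to thin strips *)

Section GaussianBounds.
Context (R : realType) (d : measure_display) (T : measurableType d).
Context (Pr : probability T R) (I : eqType) (X : I -> T -> R).
Hypothesis mX : forall k, measurable_fun setT (X k).
Hypothesis indX : mutually_independent Pr X.
Hypothesis lawX : forall k (A : set R), measurable A ->
  Pr (X k @^-1` A) = normal_prob 0 (Num.sqrt (2^-1)) A.
Notation genT := (genT X).
Notation sg := (Num.sqrt (2^-1 : R)).

Lemma genT_set_sub (K K' : set I) (A : set (genT K)) : K `<=` K' ->
  measurable A -> measurable (A : set (genT K')).
Proof.
move=> KK'; apply: (sub_smallest2r (@smallest_sigma_algebra _ setT _)).
move=> _ [s [A' [us sK mA' ->]]]; exists s, A'; split => // k /sK; exact: KK'.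
Qed.

Lemma genT_sub (K K' : set I) (dV : measure_display) (V : measurableType dV)
    (f : genT K -> V) : K `<=` K' ->
  measurable_fun setT f -> measurable_fun setT (f : genT K' -> V).
Proof. by move=> KK' mf _ S mS; exact: (genT_set_sub KK' (mf measurableT S mS)). Qed.

(** The number is 1/2, but it is kept as a finite nonnegative constant and never evaluated. *)
Definition gmoment2 : R := fine (\int[normal_prob 0 sg]_x (x ^+ 2)%:E)%E.

Lemma gmoment2_ge0 : 0 <= gmoment2.
Proof. by apply: fine_ge0; apply: integral_ge0 => x _; rewrite lee_fin sqr_ge0. Qed.

Lemma gmoment2E k : (\int[Pr]_w (X k w ^+ 2)%:E = gmoment2%:E)%E.
Proof.
rewrite /gmoment2 fineK; last first.
  rewrite ge0_fin_numE ?normal_half_moment2//.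
  by apply: integral_ge0 => x _; rewrite lee_fin sqr_ge0.
rewrite [RHS](@eq_measure_integral _ _ _ _ (pushforward Pr (X k : T -> measurableTypeR R)))//;
  [exact: mX|move=> mf|by move=> mf A mA _; exact/esym/lawX].
have mXk : measurable_fun setT (X k : T -> measurableTypeR R) := mX k.
have := ge0_integral_pushforward mXk Pr measurableT (f := fun x => (x ^+ 2)%:E).
rewrite preimage_setT => ->//.
  by apply/measurable_EFinP; exact: measurable_funX.
by move=> x _; rewrite lee_fin sqr_ge0.
Qed.

Lemma gauss_small k (eta : R) : 0 <= eta -> (Pr [set w | (`|X k w| <= eta)%R] <= (2 * eta)%:E)%E.
Proof.
move=> h; have := normal_half_dist_le 0 h; rewrite -(lawX k); last exact: measurable_dist.
apply: le_trans; rewrite le_eqVlt; apply/orP; left; apply/eqP; congr (Pr _).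
by apply/seteqP; split=> w /=; rewrite subr0.
Qed.

Lemma measurable_gauss_large k (M : R) : measurable [set w : T | M < `|X k w|].
Proof.
rewrite -[X in measurable X]setTI; apply: measurable_fun_ltr => //.
exact: measurableT_comp.
Qed.

Lemma gauss_large k (M : R) : 0 < M ->
  (Pr [set w | (M < `|X k w|)%R] <= (gmoment2 / M ^+ 2)%:E)%E.
Proof.
move=> M0; have mA := measurable_gauss_large k M.
rewrite mulrC EFinM -(gmoment2E k) -ge0_integralZl//; last 3 first.
- by apply/measurable_EFinP; exact: measurable_funX.
- by move=> w _; rewrite lee_fin sqr_ge0.
- by rewrite lee_fin invr_ge0 sqr_ge0.
rewrite (measure_integral_bool Pr mA).
apply: ge0_le_integral_nomeas => w; rewrite ?lee_fin//.
have [h|h] := boolP (M < _); last by rewrite mulr_ge0// ?invr_ge0 sqr_ge0.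
rewrite mulrC ler_pdivlMr ?exprn_gt0// mul1r -[leRHS]real_normK ?num_real//.
by rewrite ler_sqr ?nnegrE ?(ltW M0)// ltW.
Qed.

Lemma double_interval_le (K : set I) kx ky (a : genT (K `|` [set ky]) -> R)
    (y0 l1 l2 : genT K -> R) : ~ K kx -> ~ K ky -> kx != ky ->
  measurable_fun setT a -> measurable_fun setT y0 ->
  measurable_fun setT l1 -> measurable_fun setT l2 ->
  (forall w, 0 <= l1 w) -> (forall w, 0 <= l2 w) ->
  (\int[Pr]_w ((`|X ky w - y0 w| <= l2 w)%R%:R * (`|X kx w - a w| <= l1 w)%R%:R)%:E <=
   \int[Pr]_w (4 * l1 w * l2 w)%:E)%E.
Proof.
move=> nx ny xy ma my0 ml1 ml2 l10 l20.
have KK' : K `<=` K `|` [set ky] by exact: subsetUl.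
have nx' : ~ (K `|` [set ky]) kx by case=> [//|/= e]; rewrite e eqxx in xy.
have mX' : measurable_fun setT (X ky : genT (K `|` [set ky]) -> R).
  by apply: genT_coord_measurable; right.
pose f (w : genT (K `|` [set ky])) : R := (`|X ky w - y0 w| <= l2 w)%R%:R.
have mf : measurable_fun setT f.
  apply/measurable_bool_natr/measurable_fun_ler; last exact: genT_sub ml2.
  apply: measurableT_comp => //; apply: measurable_funB => //.
  exact: genT_sub my0.
have h1 := interval_le mX indX lawX nx' mf ma (genT_sub KK' ml1) (fun w => ler0n _ _) l10.
apply: (le_trans h1).
have := interval_le mX indX lawX ny (f := fun w => 2 * l1 w) (a := y0) (l := l2) _ my0 ml2 _ l20.
move=> h; apply: le_trans; last first.
  apply: le_trans (h _ _) _.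
  - exact: measurable_funM.
  - by move=> w; rewrite mulr_ge0.
  rewrite le_eqVlt; apply/orP; left; apply/eqP; apply: eq_integral => w _.
  by congr EFin; ring.
rewrite le_eqVlt; apply/orP; left; apply/eqP; apply: eq_integral => w _.
by congr EFin; ring.
Qed.

(* One of the two real coordinates of g enters Im (m g) with a coefficient at least |m|/2, so once
   the other coordinate is fixed the strip confines it to an interval of length O(r |g_o|). *)
Lemma strip_le (K : set I) kx ky (m z0 : genT K -> R[i]) (kappa go : genT K -> R)
    (r rho : R) (b : T -> bool) : ~ K kx -> ~ K ky -> kx != ky ->
  cmeas m -> cmeas z0 -> measurable_fun setT kappa -> measurable_fun setT go ->
  (forall w, 0 <= go w) -> 0 <= r -> 0 <= rho -> measurable [set w | b w] ->
  (forall w, b w -> let g := Complex (X kx w) (X ky w) in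
     [/\ m w != 0, `|complex.Im (m w * g) - kappa w| <= cabs (m w) * (r * go w) &
         cabs (g - z0 w) <= rho * go w]) ->
  (Pr [set w | b w] <= \int[Pr]_w (16 * (r * rho) * go w ^+ 2)%:E)%E.
Proof.
move=> nx ny xy [mm1 mm2] [mz1 mz2] mk mgo go0 r0 rho0 mb hb.
pose p w := complex.Re (m w); pose q w := complex.Im (m w).
pose x0 w := complex.Re (z0 w); pose y0 w := complex.Im (z0 w).
pose ax w := (kappa w - p w * X ky w) / q w.
pose ay w := (kappa w - q w * X kx w) / p w.
pose l1 (w : genT K) := 2 * r * go w; pose l2 (w : genT K) := rho * go w.
have l10 w : 0 <= l1 w by rewrite /l1 !mulr_ge0.
have l20 w : 0 <= l2 w by rewrite /l2 mulr_ge0.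
have ml1 : measurable_fun setT l1 by exact: measurable_funM.
have ml2 : measurable_fun setT l2 by exact: measurable_funM.
have mlin k (f g : genT K -> R) : measurable_fun setT f -> measurable_fun setT g ->
    measurable_fun setT
      ((fun w => (kappa w - f w * X k w) / g w) : genT (K `|` [set k]) -> R).
  move=> mf mg; have KK' : K `<=` K `|` [set k] by exact: subsetUl.
  apply: measurable_funM; last by apply: measurable_funV; exact: (genT_sub KK' mg).
  apply: measurable_funB; first exact: genT_sub mk.
  apply: measurable_funM; first exact: genT_sub mf.
  by apply: genT_coord_measurable; right.
have yx : ky != kx by rewrite eq_sym.
have h1 := double_interval_le nx ny xy (mlin ky p q mm1 mm2) mz2 ml1 ml2 l10 l20.
have h2 := double_interval_le ny nx yx (mlin kx q p mm2 mm1) mz1 ml1 ml2 l10 l20.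
have mE k k' (f g : genT K -> R) (e : genT K -> R) : measurable_fun setT f ->
    measurable_fun setT g -> measurable_fun setT e -> measurable_fun setT (fun w : T =>
   ((`|X k w - e w| <= l2 w)%R%:R *
    (`|X k' w - (kappa w - f w * X k w) / g w| <= l1 w)%R%:R)%:E : \bar R).
  move=> mf mg me; have up f' : measurable_fun setT (f' : genT K -> R) ->
    measurable_fun setT (f' : T -> R) by move=> ?; exact: genT_fun_measurable.
  apply/measurable_EFinP; apply: measurable_funM.
    apply/measurable_bool_natr/measurable_fun_ler; last exact: up.
    by apply: measurableT_comp => //; apply: measurable_funB => //; exact: up.
  apply/measurable_bool_natr/measurable_fun_ler; last exact: up.
  apply: measurableT_comp => //; apply: measurable_funB => //.
  apply: measurable_funM; last exact/measurable_funV/up.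
  by apply: measurable_funB; [exact: up|apply: measurable_funM => //; exact: up].
rewrite (measure_integral_bool Pr mb).
(* The two cases, dominant real part or dominant imaginary part of [m], each cost 4 l1 l2 = 8 r rho
   go^2, and both are charged. *)
have -> : (\int[Pr]_w (16 * (r * rho) * go w ^+ 2)%:E =
    \int[Pr]_w (4 * l1 w * l2 w)%:E + \int[Pr]_w (4 * l1 w * l2 w)%:E)%E.
  rewrite -ge0_integralD//.
  - by apply: eq_integral => w _; rewrite -EFinD /l1 /l2; congr EFin; ring.
  - by move=> w _; rewrite lee_fin !mulr_ge0.
  - apply/measurable_EFinP; apply: measurable_funM; last exact: (genT_fun_measurable mX ml2).
    by apply: measurable_funM => //; exact: (genT_fun_measurable mX ml1).
  - by move=> w _; rewrite lee_fin !mulr_ge0.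
  - apply/measurable_EFinP; apply: measurable_funM; last exact: (genT_fun_measurable mX ml2).
    by apply: measurable_funM => //; exact: (genT_fun_measurable mX ml1).
apply: le_trans (leeD h1 h2); rewrite -ge0_integralD//; last 2 first.
- exact: (mE ky kx p q y0).
- exact: (mE kx ky q p x0).
apply: ge0_le_integral_nomeas => w; first by rewrite lee_fin.
rewrite -EFinD lee_fin; case: (boolP (b w)) => [bw|_]; last by rewrite addr_ge0.
have [mw hI hC] := hb w bw.
have eI : complex.Im (m w * Complex (X kx w) (X ky w)) = p w * X ky w + q w * X kx w.
  by rewrite /p /q; case: (m w).
have hx : `|X kx w - x0 w| <= l2 w.
  apply: le_trans hC; apply: le_trans (Re_le_cabs _).
  by rewrite /x0; case: (z0 w).
have hy : `|X ky w - y0 w| <= l2 w.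
  apply: le_trans hC; apply: le_trans (Im_le_cabs _).
  by rewrite /y0; case: (z0 w).
rewrite eI in hI.
have mpq : cabs (m w) <= `|p w| + `|q w| by exact: cabs_le_ReIm.
have [pq|qp] := leP `|p w| `|q w|.
  have q0 : q w != 0.
    apply: contra mw => /eqP q0; move: pq; rewrite q0 normr0 normr_le0 => /eqP p0.
    by move: p0 q0; rewrite /p /q; case: (m w) => ? ? /= -> ->.
  have e1 : `|X kx w - (kappa w - p w * X ky w) / q w| <= l1 w.
    have -> : X kx w - (kappa w - p w * X ky w) / q w =
       (p w * X ky w + q w * X kx w - kappa w) / q w by field.
    rewrite normrM normfV ler_pdivrMr ?normr_gt0// (le_trans hI)//.
    have hs : cabs (m w) <= 2 * `|q w| by lra.
    by have := ler_wpM2r (mulr_ge0 r0 (go0 w)) hs; rewrite /l1; lra.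
  by rewrite hy e1 ?mulr1 ?lerDl.
have p0 : p w != 0 by rewrite -normr_gt0 (le_lt_trans _ qp).
have e1 : `|X ky w - (kappa w - q w * X kx w) / p w| <= l1 w.
  have -> : X ky w - (kappa w - q w * X kx w) / p w =
     (p w * X ky w + q w * X kx w - kappa w) / p w by field.
  rewrite normrM normfV ler_pdivrMr ?normr_gt0// (le_trans hI)//.
  have hs : cabs (m w) <= 2 * `|p w| by lra.
  by have := ler_wpM2r (mulr_ge0 r0 (go0 w)) hs; rewrite /l1; lra.
by rewrite hx e1 ?mulr1 ?lerDr.
Qed.

End GaussianBounds.

(** * Asymptotics and events of high probability *)

Section Powers.
Context (R : realType).
Implicit Types (P x y K : R).

Lemma near_ge (c : R) : \forall P \near +oo, c <= P.
Proof. exact: nbhs_pinfty_ge (num_real c). Qed.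

Lemma near_powR_ge (K e : R) : 0 < e -> \forall P \near +oo, K <= P `^ e.
Proof.
move=> e0; near=> P.
have hP : (Num.max K 1) `^ e^-1 <= P by near: P; exact: near_ge.
have m0 : 0 < Num.max K 1 by rewrite lt_max ltr01 orbT.
apply: (@le_trans _ _ (Num.max K 1)); first by rewrite le_max lexx.
rewrite -[leLHS](powRr1 (ltW m0)) -(mulVf (lt0r_neq0 e0)) powRrM.
by rewrite ge0_ler_powR ?nnegrE ?powR_ge0 ?(ltW e0)// (le_trans _ hP)// powR_ge0.
Unshelve. all: by end_near. Qed.

Lemma near_powR_le (e eps : R) : e < 0 -> 0 < eps -> \forall P \near +oo, P `^ e <= eps.
Proof.
move=> e0 eps0; have : 0 < - e by rewrite oppr_gt0.
move=> /(near_powR_ge eps^-1) [M [Mr hM]]; exists (Num.max M 0).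
split; first exact: num_real.
move=> P; rewrite gt_max => /andP[MP P0].
rewrite -[e]opprK powRN -[leRHS]invrK lef_pV2 ?posrE ?invr_gt0// ?powR_gt0//.
exact: hM.
Qed.

Lemma powR_exp_le P x y : 1 <= P -> x <= y -> P `^ x <= P `^ y.
Proof. by move=> P1 xy; rewrite ler_powR. Qed.

Lemma powR_add P x y : 0 < P -> P `^ (x + y) = P `^ x * P `^ y.
Proof. by move=> P0; rewrite powRD// implybE (gt_eqF P0) orbT. Qed.

Lemma near_powR_cmp (K x y : R) : x < y -> \forall P \near +oo, K * P `^ x <= P `^ y.
Proof.
move=> xy; have xy0 : 0 < y - x by rewrite subr_gt0.
near=> P; have P0 : 0 < P by near: P; exact: nbhs_pinfty_gt.
have -> : y = (y - x) + x by ring.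
rewrite powR_add// ler_wpM2r ?powR_ge0//.
by near: P; exact: near_powR_ge.
Unshelve. all: by end_near. Qed.

Lemma near_log2_ge (K : R) : \forall P \near +oo, K <= log2 P.
Proof.
near=> P; rewrite /log2 ler_pdivlMr ?ln_gt0 ?ltr1n//.
have hP : expR (K * ln 2) <= P by near: P; exact: near_ge.
by rewrite -[leLHS]expRK ler_ln ?posrE ?expR_gt0// (lt_le_trans _ hP)// expR_gt0.
Unshelve. all: by end_near. Qed.

Lemma log2_le x y : 0 < x -> x <= y -> log2 x <= log2 y.
Proof.
move=> x0 xy; rewrite /log2 ler_pM2r ?invr_gt0 ?ln_gt0 ?ltr1n//.
by rewrite ler_ln ?posrE// (lt_le_trans x0 xy).
Qed.

Lemma log2_powR P x : log2 (P `^ x) = x * log2 P.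
Proof. by rewrite /log2 ln_powR mulrA. Qed.

(** The codebook size is P to the exact power B / log2 P, so convergence of that exponent gives
    polynomial bounds with arbitrarily small loss. *)
Lemma near_bits (B : R -> nat) (al e : R) : 0 < e ->
  (B P)%:R / log2 P @[P --> +oo] --> al ->
  \forall P \near +oo, P `^ (al - e) <= (2 ^ B P)%:R <= P `^ (al + e).
Proof.
move=> e0 hB; near=> P.
have P1 : 1 < P by near: P; exact: nbhs_pinfty_gt.
have P0 : 0 < P by rewrite (lt_trans _ P1).
have l2 : 0 < ln (2 : R) by rewrite ln_gt0// ltr1n.
have lP : 0 < ln P by rewrite ln_gt0.
have lgP : 0 < log2 P by rewrite divr_gt0.
have : `|al - (B P)%:R / log2 P| <= e.
  by near: P; move/cvgrPdist_le : hB; apply.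
have -> : (2 ^ B P)%:R = P `^ ((B P)%:R / log2 P).
  rewrite /powR gt_eqF// /log2 invf_div -mulrA divfK ?gt_eqF//.
  by rewrite mulrC expRM_natr lnK ?posrE// natrX.
rewrite ler_distl => /andP[h1 h2].
by apply/andP; split; apply: powR_exp_le; rewrite ?(ltW P1)//; lra.
Unshelve. all: by end_near. Qed.

End Powers.

Section WithHighProbability.
Context (R : realType) (d : measure_display) (T : measurableType d).
Context (Pr : probability T R).

Lemma union_bound (J : eqType) (s : seq J) (A : J -> set T) (c : R) :
  (forall j, measurable (A j)) -> (forall j, j \in s -> Pr (A j) <= c%:E)%E ->
  measurable [set w | exists2 j, j \in s & A j w] /\
  (Pr [set w | exists2 j, j \in s & A j w] <= ((size s)%:R * c)%:E)%E.
Proof.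
move=> mA; elim: s => [|j s IH] hc.
  have -> : [set w | exists2 j, j \in [::] & A j w] = set0.
    by apply/seteqP; split=> w // [].
  by split; rewrite ?measure0 ?mul0r.
have -> : [set w | exists2 j', j' \in j :: s & A j' w] =
    A j `|` [set w | exists2 j, j \in s & A j w].
  apply/seteqP; split=> w.
    by case=> j'; rewrite inE => /orP[/eqP ->|js] Aw; [left|right; exists j'].
  by case=> [Aw|[j' js Aw]]; [exists j|exists j'] => //; rewrite inE ?eqxx ?js ?orbT.
have [|mN PN] := IH; first by move=> j' js; apply: hc; rewrite inE js orbT.
split; first exact: measurableU.
apply: le_trans (measureU2 _ (mA j) mN) _.
rewrite /= -natr1 mulrDl mul1r addrC EFinD leeD//.
by apply: hc; rewrite inE eqxx.
Qed.

(* Phrased with an exceptional measurable set so that E P itself need not be measurable. *)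
Definition whp (E : R -> set T) := forall eps : R, 0 < eps -> \forall P \near +oo,
  exists N : set T, [/\ measurable N, (Pr N <= eps%:E)%E & ~` N `<=` E P].

Lemma whpW (E F : R -> set T) : whp E -> (\forall P \near +oo, E P `<=` F P) -> whp F.
Proof.
move=> hE EF eps e0; near=> P.
have [|N [mN hN NE]] := near (hE eps e0) P; first by [].
exists N; split => //; apply: subset_trans NE _.
by near: P.
Unshelve. all: by end_near. Qed.

Lemma whpI (E F : R -> set T) : whp E -> whp F -> whp (fun P => E P `&` F P).
Proof.
move=> hE hF eps e0; have e20 : 0 < eps / 2 by rewrite divr_gt0.
near=> P.
have [|N [mN hN NE]] := near (hE _ e20) P; first by [].
have [|M [mM hM MF]] := near (hF _ e20) P; first by [].
exists (N `|` M); split; first exact: measurableU.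
  apply: le_trans (measureU2 _ mN mM) _.
  by rewrite [eps]splitr EFinD leeD.
by rewrite setCU; move=> w [/NE ? /MF].
Unshelve. all: by end_near. Qed.

Lemma whp_fin (J : finType) (E : J -> R -> set T) : (forall j, whp (E j)) ->
  whp (fun P => [set w | forall j, E j P w]).
Proof.
move=> hE; have H : forall s : seq J, whp (fun P => [set w | forall j, j \in s -> E j P w]).
  elim=> [|j s IH].
    move=> eps e0; near=> P; exists set0; split => //.
    by rewrite measure0 lee_fin ltW.
  refine (whpW (whpI (hE j) IH) _); near=> P => w [h1 h2] j'.
  by rewrite inE => /orP[/eqP ->|/h2].
refine (whpW (H (enum J)) _); near=> P => w h j; apply: h; exact: mem_enum.
Unshelve. all: by end_near. Qed.

Lemma whp_near (E : R -> set T) : (\forall P \near +oo, E P = setT) -> whp E.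
Proof.
move=> h eps e0; near=> P; exists set0; split => //.
  by rewrite measure0 lee_fin ltW.
have -> : E P = setT by near: P.
by [].
Unshelve. all: by end_near. Qed.

Lemma whp_bound (E : R -> set T) (f : R -> R) : (forall P, measurable (E P)) ->
  (\forall P \near +oo, (Pr (E P) <= (f P)%:E)%E) ->
  (forall eps, 0 < eps -> \forall P \near +oo, f P <= eps) ->
  whp (fun P => ~` E P).
Proof.
move=> mE h f0 eps e0; near=> P; exists (E P); split => //.
apply: (@le_trans _ _ (f P)%:E); first by near: P.
by rewrite lee_fin; near: P; exact: f0.
Unshelve. all: by end_near. Qed.

(** For events that vary with [P] only through a threshold, a fixed threshold already has
    probability close to 1, and P^(-e) eventually falls below it. *)
Lemma whp_static (E : R -> set T) (e : R) : 0 < e ->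
  (forall eta eta', 0 < eta' -> eta' <= eta -> E eta `<=` E eta') ->
  (forall eps : R, 0 < eps -> exists2 eta : R, 0 < eta &
     exists N : set T, [/\ measurable N, (Pr N <= eps%:E)%E & ~` N `<=` E eta]) ->
  whp (fun P => E (P `^ (- e))).
Proof.
move=> e0 mono h eps eps0; have [eta eta0 [N [mN hN NE]]] := h _ eps0.
near=> P; exists N; split => //; apply: subset_trans NE _; apply: mono.
  by rewrite powR_gt0//; near: P; exact: nbhs_pinfty_gt.
by near: P; apply: near_powR_le; rewrite ?oppr_lt0.
Unshelve. all: by end_near. Qed.

Lemma whp_power (E : R -> set T) (K e : R) : 0 < e -> (forall P, measurable (E P)) ->
  (\forall P \near +oo, (Pr (E P) <= (K * P `^ (- e))%:E)%E) -> whp (fun P => ~` E P).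
Proof.
move=> e0 mE h; apply: whp_bound h _ => // eps eps0.
have K0 : 0 < `|K| + 1 by rewrite ltr_wpDl.
have e0' : - e < 0 by rewrite oppr_lt0.
have := near_powR_le e0' (divr_gt0 eps0 K0).
apply: filterS => P; rewrite ler_pdivlMr// => hP.
apply: le_trans hP; rewrite mulrC ler_wpM2l ?powR_ge0//.
by rewrite (le_trans (ler_norm K))// lerDl.
Qed.

End WithHighProbability.

(** * The channel and the quantization codebooks *)

Section ModelMeasurability.
Context (R : realType) (d : measure_display) (U : measurableType d).
Context (G : gidx -> U -> R) (B : 'I_2 -> 'I_2 -> R -> nat).
Context (K : set gidx) (mG : forall k, K k -> measurable_fun setT (G k)).

Definition gvec (i j : 'I_2) (n : nat) (w : U) : cvec R :=
  fun l => Complex (G (inr (i, j, n, l, false)) w) (G (inr (i, j, n, l, true)) w).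

Definition selidx (P : R) (i j : 'I_2) (w : U) : nat :=
  best_index (2 ^ B i j P) (fun n => qscore (codeword G i j n w) (htilde G i w)).

(** The unnormalised Gaussian source of the selected codeword; conditioning acts on its independent
    entries, not on the normalised estimate. *)
Definition gsel (P : R) (i j : 'I_2) (w : U) : cvec R := gvec i j (selidx P i j w) w.

(* teff without the power factor sqrt (P / 2): entry k comes from the precoder of TX k *)
Definition zfbeam (P : R) (i : 'I_2) (w : U) : cvec R :=
  fun k => zfdir (estimate G B P (other i) k w) (estimate G B P i k w) k.

Lemma estimateE P i j w : estimate G B P i j w = cword (gsel P i j w).
Proof. by []. Qed.

(** The score phase-normalises a codeword that is phase-normalised already, which changes
    nothing. *)
Lemma qscore_codeword i j n w :
  qscore (codeword G i j n w) (htilde G i w) =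
  `|r3dot (cword (gvec i j n w)) (cword (hvec G i w))|.
Proof. by rewrite /qscore /codeword phase_norm_idem. Qed.

Lemma teffE P i w : teff G B P i w = scalev (ocplx (Num.sqrt (P / 2))) (zfbeam P i w).
Proof. by apply/funext => k; rewrite /teff /czf /zfbeam /zfdir /scalev. Qed.

Lemma cmeas_hvec i k : (forall b, K (inl (i, k, b))) -> cmeas (fun w => hvec G i w k).
Proof. by move=> h; apply: cmeas_conj; split; apply: mG. Qed.

Lemma cmeas_gvec i j n l : (forall b, K (inr (i, j, n, l, b))) ->
  cmeas (fun w => gvec i j n w l).
Proof. by move=> h; split; apply: mG. Qed.

Hypothesis KH : forall i k b, K (inl (i, k, b)).

Lemma vmeas_hvec i : vmeas (fun w => hvec G i w).
Proof. by move=> k; exact: cmeas_hvec. Qed.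

(** Over [genT K] this says that a selection depends on the channel and on its own codebook only;
    the conditioning on the remaining codebooks rests on it. *)
Lemma measurable_selidx P i j : (forall n l b, K (inr (i, j, n, l, b))) ->
  measurable_fun setT (selidx P i j).
Proof.
move=> h; apply: measurable_best_index => n; apply: measurable_qscore.
  apply/vmeas_phase_norm/vmeas_normalize => l; exact: cmeas_gvec.
exact/vmeas_normalize/vmeas_hvec.
Qed.

Lemma vmeas_gsel P i j : (forall n l b, K (inr (i, j, n, l, b))) -> vmeas (gsel P i j).
Proof.
move=> h l; have ms := measurable_selidx P h; split.
  by apply: (measurable_select (f := fun n w => complex.Re (gvec i j n w l)) ms) => n;
    case: (@cmeas_gvec i j n l).
by apply: (measurable_select (f := fun n w => complex.Im (gvec i j n w l)) ms) => n;
  case: (@cmeas_gvec i j n l).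
Qed.

Lemma vmeas_estimate P i j : (forall n l b, K (inr (i, j, n, l, b))) ->
  vmeas (estimate G B P i j).
Proof. by move=> h; apply/vmeas_phase_norm/vmeas_normalize/vmeas_gsel. Qed.

End ModelMeasurability.

Section Model.
Context (R : realType) (d : measure_display) (T : measurableType d).
Context (Pr : probability T R) (G : gidx -> T -> R).
Hypothesis mG : forall k, measurable_fun setT (G k).
Hypothesis indG : mutually_independent Pr G.
Hypothesis lawG : forall k (A : set R), measurable A ->
  Pr (G k @^-1` A) = normal_prob 0 (Num.sqrt (2^-1)) A.
Notation hv := (hvec G).
Notation m2 := (gmoment2 R).

Lemma cabs_hvec i k w : cabs (hv i w k) <= `|G (inl (i, k, false)) w| + `|G (inl (i, k, true)) w|.
Proof. by rewrite cabs_conj; exact: cabs_le_ReIm. Qed.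

Lemma measurable_gauss_small k (e : R) : measurable [set w : T | `|G k w| <= e].
Proof.
rewrite -[X in measurable X]setTI; apply: measurable_fun_ler => //.
exact: measurableT_comp.
Qed.

(** The determinant is an entry of the first channel times the distance of one entry of the second
    channel from a point [z] fixed by the other entries; the real part of that entry is a Gaussian
    independent of [z]. *)
Lemma hvec_det_small (e : R) : 0 < e ->
  exists N : set T, [/\ measurable N, (Pr N <= (2 * e)%:E)%E &
    forall w, ~ N w -> e <= cabs (hv ord0 w ord0) ->
      e ^+ 2 <= cabs (det2 ord0 (hv ord0 w) (hv ord_max w))].
Proof.
move=> e0; pose kx : gidx := inl (ord_max, ord_max, false).
pose K := ~` [set kx].
have nK : ~ K kx by apply.
pose z (w : T) := hv ord0 w ord_max * hv ord_max w ord0 / hv ord0 w ord0.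
have mz : cmeas (z : genT G K -> R[i]).
  have mKG k : K k -> measurable_fun setT (G k : genT G K -> R).
    by move=> Kk; exact: genT_coord_measurable.
  apply: cmeasM; last apply: cmeasV.
    by apply: cmeasM; apply: (cmeas_hvec mKG) => b.
  by apply: (cmeas_hvec mKG) => b.
pose N := [set w | `|G kx w - complex.Re (z w)| <= e].
have mN : measurable N.
  rewrite /N -[X in measurable X]setTI; apply: measurable_fun_ler => //.
  apply: measurableT_comp => //; apply: measurable_funB => //.
  by apply: (genT_fun_measurable (K := K) mG); case: mz.
exists N; split => //.
  rewrite (measure_integral_bool Pr mN).
  have := interval_le mG indG lawG nK (f := fun=> 1) (a := fun w => complex.Re (z w))
    (l := fun=> e) (measurable_cst _) mz.1 (measurable_cst _) (fun=> ler01) (fun=> ltW e0).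
  move=> h; apply: le_trans (le_trans _ h) _.
    by apply: ge0_le_integral_nomeas => w; rewrite ?mul1r ?lee_fin.
  by rewrite integral_cst//= probability_setT mule1 mulr1.
move=> w /negP; rewrite -ltNge => h h0; apply: ltW.
have h00 : hv ord0 w ord0 != 0 by rewrite -cabs_gt0 (lt_le_trans e0).
have -> : det2 ord0 (hv ord0 w) (hv ord_max w) =
   hv ord0 w ord0 * (hv ord_max w ord_max - z w).
  by rewrite /det2 other0 /z; field.
rewrite cabsM expr2 (@lt_le_trans _ _ (e * cabs (hv ord_max w ord_max - z w)))//.
  rewrite ltr_pM2l// (lt_le_trans h)//.
  apply: le_trans (Re_le_cabs _).
  by rewrite /hvec /Hent /=; case: (z w).
by rewrite ler_wpM2r// cabs_ge0.
Qed.

(** One threshold governs all bounds, so the event grows as [eta] decreases and can be used both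
    with constant [eta] and with [eta] = P^(-e). *)
Definition Hgood (eta : R) : set T := [set w |
  (forall i k, eta <= cabs (hv i w k) /\ cabs (hv i w k) <= eta^-1) /\
  forall i, eta <= cabs (det2 ord0 (hv i w) (hv (other i) w))].

Lemma Hgood_mono eta eta' : 0 < eta' -> eta' <= eta -> Hgood eta `<=` Hgood eta'.
Proof.
move=> e0 ee w [h1 h2]; split=> [i k|i]; last exact: le_trans ee (h2 i).
have [h3 h4] := h1 i k; split; first exact: le_trans h3.
by rewrite (le_trans h4)// lef_pV2 ?posrE// (lt_le_trans e0).
Qed.

Lemma HgoodP (eps : R) : 0 < eps -> exists2 eta : R, 0 < eta &
  exists N : set T, [/\ measurable N, (Pr N <= eps%:E)%E & ~` N `<=` Hgood eta].
Proof.
move=> eps0.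
have m20 : 0 <= m2 by exact: gmoment2_ge0.
(* Budget: 2e for the determinant, 8e for four small real parts, and 32 m2 e^2 <= 16 m2 e for eight
   large coordinates, the last by e <= 1/2. *)
pose e := Num.min (2^-1) (eps / (18 + 32 * m2)).
have c0 : 0 < 18 + 32 * m2 by lra.
have e0 : 0 < e by rewrite lt_min invr_gt0 ltr0n/= divr_gt0.
have e12 : e <= 2^-1 by rewrite ge_min lexx.
have ee : e * (18 + 32 * m2) <= eps by rewrite -ler_pdivlMr// ge_min lexx orbT.
have [N0 [mN0 PN0 hN0]] := hvec_det_small e0.
pose S (p : 'I_2 * 'I_2) := [set w | `|G (inl (p.1, p.2, false)) w| <= e].
pose L (p : 'I_2 * 'I_2 * bool) := [set w | (2 * e)^-1 < `|G (inl p) w|].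
have mS p : measurable (S p) by exact: measurable_gauss_small.
have mL p : measurable (L p) by exact: measurable_gauss_large.
have [mNS PS] := @union_bound _ _ _ Pr _ (enum {: 'I_2 * 'I_2}) S (2 * e) mS
  (fun p _ => gauss_small lawG _ (ltW e0)).
have i2e : 0 < (2 * e)^-1 by rewrite invr_gt0 mulr_gt0.
have [mNL PL] := @union_bound _ _ _ Pr _ (enum {: 'I_2 * 'I_2 * bool}) L
  (m2 / ((2 * e)^-1) ^+ 2) mL (fun p _ => gauss_large mG lawG _ i2e).
set NS := [set w | _] in mNS PS; set NL := [set w | _] in mNL PL.
rewrite -cardE !card_prod !card_ord !natrM in PS.
rewrite -cardE !card_prod !card_ord card_bool !natrM exprVn invrK in PL.
(* The square is forced by the determinant, whose lower bound is [e] times the entry bound [e]. *)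
exists (e ^+ 2); first by rewrite exprn_gt0.
exists (N0 `|` (NS `|` NL)); split; first by do 2 apply: measurableU => //.
  apply: le_trans (measureU2 _ _ _) _ => //; first exact: measurableU.
  apply: (@le_trans _ _ ((2 * e)%:E + ((2 * 2 * (2 * e))%:E +
      (2 * 2 * 2 * (m2 * (2 * e) ^+ 2))%:E))%E).
    rewrite leeD//; apply: le_trans (measureU2 _ _ _) _ => //.
    by rewrite leeD.
  rewrite -!EFinD lee_fin; apply: le_trans ee.
  have h1 := mulr_ge0 m20 (ltW e0).
  have h2 : (m2 * e) * e <= (m2 * e) * 2^-1 by rewrite ler_wpM2l.
  have -> : m2 * (2 * e) ^+ 2 = 4 * ((m2 * e) * e) by ring.
  have -> : e * (18 + 32 * m2) = 18 * e + 32 * (m2 * e) by ring.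
  by lra.
move=> w /not_orP[n0 /not_orP[nS nL]].
have hS i k : e <= cabs (hv i w k).
  rewrite cabs_conj; apply: le_trans (Re_le_cabs _) => /=; rewrite leNgt; apply/negP => h.
  by apply: nS; exists (i, k); [rewrite mem_enum|exact: ltW].
have hL i k : cabs (hv i w k) <= e^-1.
  apply: le_trans (cabs_hvec _ _ _) _.
  have hb b : `|G (inl (i, k, b)) w| <= (2 * e)^-1.
    rewrite leNgt; apply/negP => h.
    by apply: nL; exists (i, k, b); rewrite ?mem_enum.
  by rewrite (le_trans (lerD (hb _) (hb _)))// invfM; lra.
have e2 : e ^+ 2 <= e by rewrite expr2 ler_piMl ?ltW//; lra.
split=> [i k|i].
  split; first exact: le_trans e2 _.
  by rewrite (le_trans (hL i k))// lef_pV2 ?posrE ?exprn_gt0.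
have := hN0 w n0 (hS _ _).
case: (ord2P i) => ->; rewrite ?other0 ?other1//.
by rewrite det2C cabsN.
Qed.

End Model.

Section Codebook.
Context (R : realType) (d : measure_display) (T : measurableType d).
Context (Pr : probability T R) (G : gidx -> T -> R).
Context (B : 'I_2 -> 'I_2 -> R -> nat).
Hypothesis mG : forall k, measurable_fun setT (G k).
Hypothesis indG : mutually_independent Pr G.
Hypothesis lawG : forall k (A : set R), measurable A ->
  Pr (G k @^-1` A) = normal_prob 0 (Num.sqrt (2^-1)) A.
Notation hv := (hvec G).
Notation m2 := (gmoment2 R).
Notation gv := (gvec G).

Let mGT k : setT k -> measurable_fun setT (G k). Proof. by []. Qed.

Lemma cmeas_gvecT i j n l : cmeas (fun w => gv i j n w l).
Proof. exact: (cmeas_gvec mGT). Qed.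

Lemma integral_gvec2 i j n l :
  (\int[Pr]_w (cabs (gv i j n w l) ^+ 2)%:E = (2 * m2)%:E)%E.
Proof.
under eq_integral do rewrite sqr_cabs /abs2 /= EFinD.
rewrite ge0_integralD//; last 4 first.
- by move=> w _; rewrite lee_fin sqr_ge0.
- by apply/measurable_EFinP; exact: measurable_funX.
- by move=> w _; rewrite lee_fin sqr_ge0.
- by apply/measurable_EFinP; exact: measurable_funX.
by rewrite !(gmoment2E mG lawG) -EFinD; congr EFin; ring.
Qed.

(** Outside this event entry [p.2] is not negligible against the other entry; the real part is used
    so that a single Gaussian coordinate decides. *)
Definition flat_code i j (e : R) (p : nat * 'I_2) : set T :=
  [set w | `|G (inr (i, j, p.1, p.2, false)) w| <= 2 * e * cabs (gv i j p.1 w (other p.2))].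

Lemma measurable_flat_code i j e p : measurable (flat_code i j e p).
Proof.
rewrite -[X in measurable X]setTI; apply: measurable_fun_ler => //.
  exact: measurableT_comp.
by apply: measurable_funM => //; exact/measurable_cabs/cmeas_gvecT.
Qed.

(** Given the other entry x, the probability is at most 4e|x|, and |x| <= 1 + |x|^2 reduces the
    average to the second moment. *)
Lemma flat_code_le i j (e : R) p : 0 <= e ->
  (Pr (flat_code i j e p) <= (4 * e * (1 + 2 * m2))%:E)%E.
Proof.
move=> e0; rewrite (measure_integral_bool Pr (measurable_flat_code i j e p)).
pose kx : gidx := inr (i, j, p.1, p.2, false); pose K := ~` [set kx].
have nK : ~ K kx by apply.
have mKG k : K k -> measurable_fun setT (G k : genT G K -> R).
  by move=> Kk; exact: genT_coord_measurable.
pose len (w : genT G K) := 2 * e * cabs (gv i j p.1 w (other p.2)).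
have ml : measurable_fun setT len.
  apply: measurable_funM => //; apply/measurable_cabs/(cmeas_gvec mKG) => b /=.
  by case=> /eqP; rewrite (negbTE (other_neq _)).
have l0 w : 0 <= len w by rewrite /len !mulr_ge0 ?cabs_ge0.
have := interval_le mG indG lawG nK (f := fun=> 1) (a := fun=> 0)
  (measurable_cst _) (measurable_cst _) ml (fun=> ler01) l0.
move=> h; apply: le_trans (le_trans _ h) _.
  by apply: ge0_le_integral_nomeas => w; rewrite ?mul1r ?subr0 ?lee_fin.
apply: (@le_trans _ _ (\int[Pr]_w ((4 * e)%:E * (1%:E + (cabs (gv i j p.1 w (other p.2)) ^+ 2)%:E)))%E).
  apply: ge0_le_integral_nomeas => w; first by rewrite lee_fin mulr_ge0// mulr1.
  rewrite -EFinD -EFinM lee_fin mulr1 /len.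
  set x := cabs _; have x0 : 0 <= x by exact: cabs_ge0.
  have -> : 2 * (2 * e * x) = 4 * e * x by ring.
  by rewrite ler_wpM2l ?mulr_ge0//; nra.
have mx : measurable_fun setT (fun w : T => (cabs (gv i j p.1 w (other p.2)) ^+ 2)%:E).
  apply/measurable_EFinP; apply: measurable_funX; exact/measurable_cabs/cmeas_gvecT.
have x0 (w : T) : setT w -> (0 <= (cabs (gv i j p.1 w (other p.2)) ^+ 2)%:E)%E.
  by rewrite lee_fin sqr_ge0.
rewrite ge0_integralZl//; last 3 first.
- by apply: emeasurable_funD.
- by move=> w Tw; rewrite adde_ge0// x0.
- by rewrite lee_fin mulr_ge0.
rewrite ge0_integralD// integral_cst//= probability_setT mule1 integral_gvec2.
by rewrite -EFinD -EFinM.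
Qed.

(** With scaling 0 there are at most P^(e/2) codewords, and the union bound over their 2 P^(e/2)
    entries beats the individual probability O(P^(-e)). *)
Lemma whp_code_nondegenerate i j (e : R) : 0 < e ->
  (B i j P)%:R / log2 P @[P --> +oo] --> (0 : R) ->
  whp Pr (fun P => [set w | forall n l, (n < 2 ^ B i j P)%N ->
    gv i j n w l != 0 /\ P `^ (- e) * vnorm (gv i j n w) <= cabs (gv i j n w l)]).
Proof.
move=> e0 hB; have e20 : 0 < e / 2 by rewrite divr_gt0.
pose s P := allpairs (fun (n : nat) (l : 'I_2) => (n, l)) (iota 0 (2 ^ B i j P)) (enum 'I_2).
pose E P := [set w | exists2 p, p \in s P & flat_code i j (P `^ (- e)) p w].
have hE P := @union_bound _ _ _ Pr _ (s P) (flat_code i j (P `^ (- e)))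
  (4 * (P `^ (- e)) * (1 + 2 * m2)) (measurable_flat_code i j _)
  (fun p _ => flat_code_le i j p (powR_ge0 _ _)).
have m20 := gmoment2_ge0 R.
refine (whpW (@whp_power _ _ _ Pr E (8 * (1 + 2 * m2)) (e / 2) e20 _ _) _).
- by move=> P; case: (hE P).
- near=> P; case: (hE P) => _ h; apply: le_trans h _; rewrite lee_fin.
  have P0 : 0 < P by near: P; exact: nbhs_pinfty_gt.
  have /andP[_ hN] : P `^ (0 - e / 2) <= (2 ^ B i j P)%:R <= P `^ (0 + e / 2).
    by near: P; exact: near_bits.
  rewrite add0r in hN.
  rewrite size_allpairs size_iota size_enum_ord natrM.
  have -> : P `^ (- (e / 2)) = P `^ (e / 2) * P `^ (- e).
    by rewrite -powR_add//; congr (_ `^ _); field.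
  have p0 := powR_ge0 P (- e).
  have := ler_wpM2r (mulr_ge0 p0 (addr_ge0 ler01 (mulr_ge0 (ler0n _ 2) m20))) hN.
  by nra.
- near=> P => w nE n l nN.
  have P0 : 0 < P by near: P; exact: nbhs_pinfty_gt.
  have e12 : P `^ (- e) <= 2^-1.
    by near: P; apply: near_powR_le; rewrite ?oppr_lt0// invr_gt0.
  have p0 : 0 < P `^ (- e) by rewrite powR_gt0.
  set g := gv i j n w.
  have h : 2 * P `^ (- e) * cabs (g (other l)) < cabs (g l).
    apply: (@lt_le_trans _ _ `|G (inr (i, j, n, l, false)) w|); last exact: (Re_le_cabs (g l)).
    rewrite ltNge; apply/negP => h; apply: nE; exists (n, l) => //.
    by apply/allpairsP; exists (n, l); rewrite mem_iota add0n nN mem_enum.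
  have g0 := cabs_ge0 (g (other l)).
  have gl : 0 < cabs (g l) by rewrite (le_lt_trans _ h)// !mulr_ge0// ltW.
  split; first by rewrite -cabs_gt0.
  apply: le_trans (ler_wpM2l (ltW p0) (vnorm_le_cabs g l)) _.
  by nra.
Unshelve. all: by end_near. Qed.

End Codebook.

Section IntervalStep.
Context (R : realType) (d : measure_display) (T : measurableType d).
Context (Pr : probability T R) (I : eqType) (X : I -> T -> R).
Hypothesis mX : forall k, measurable_fun setT (X k).
Hypothesis indX : mutually_independent Pr X.
Hypothesis lawX : forall k (A : set R), measurable A ->
  Pr (X k @^-1` A) = normal_prob 0 (Num.sqrt (2^-1)) A.
Notation genT := (genT X).

Definition gdens (M : R) := normal_peak (Num.sqrt (2^-1)) * expR (- M ^+ 2).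

Lemma gdens_gt0 M : 0 < gdens M.
Proof.
rewrite mulr_gt0 ?expR_gt0// normal_peak_gt0// gt_eqF// sqrtr_gt0 invr_gt0//.
Qed.

Lemma gdens_le1 M : gdens M <= 1.
Proof.
rewrite mulr_ile1 ?expR_ge0 ?normal_peak_ge0 ?normal_half_peak_le1//.
by rewrite -[leRHS]expR0 ler_expR oppr_le0 sqr_ge0.
Qed.

(** The new event is measurable with [k] added to [K], so the step can be iterated over the
    coordinates of a codeword, each centre depending on the earlier ones. *)
Lemma interval_step (K : set I) k (A : set (genT K)) (a : genT K -> R) (l M : R) :
  ~ K k -> measurable A -> measurable_fun setT a -> 0 <= l ->
  (forall w, A w -> `|a w| + l <= M) ->
  measurable ((A : set T) `&` [set w | `|X k w - a w| <= l] : set (genT (K `|` [set k]))) /\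
  ((gdens M * (2 * l))%:E * Pr (A : set T) <=
     Pr ((A : set T) `&` [set w | (`|X k w - a w| <= l)%R]))%E.
Proof.
move=> nK mA ma l0 hM; split; last exact: interval_ge.
have KK' : K `<=` K `|` [set k] by exact: subsetUl.
apply: measurableI; first exact: (genT_set_sub KK' mA).
rewrite -[X in measurable X]setTI; apply: measurable_fun_ler => //.
apply: measurableT_comp => //; apply: measurable_funB.
  by apply: genT_coord_measurable; right.
exact: genT_sub ma.
Qed.
End IntervalStep.

(** * Existence of a codeword close to the channel direction *)

Section CloseCodeword.
Context (R : realType) (d : measure_display) (T : measurableType d).
Context (Pr : probability T R) (G : gidx -> T -> R).
Hypothesis mG : forall k, measurable_fun setT (G k).
Hypothesis indG : mutually_independent Pr G.
Hypothesis lawG : forall k (A : set R), measurable A ->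
  Pr (G k @^-1` A) = normal_prob 0 (Num.sqrt (2^-1)) A.
Notation hv := (hvec G).
Notation gv := (gvec G).

Definition other_than (i j : 'I_2) (n : nat) : set gidx :=
  ~` [set k | exists l b, k = inr (i, j, n, l, b)].

Definition close_code i j (rho : R) n (w : T) : bool :=
  (gv i j n w ord0 != 0) &&
  (cabs (gv i j n w ord_max / gv i j n w ord0 - hv i w ord_max / hv i w ord0) <= rho).

Definition no_close i j (M rho : R) n : set T := [set w |
  (cabs (hv i w ord_max / hv i w ord0) <= M) && all (fun m => ~~ close_code i j rho m w) (iota 0 n)].

Lemma measurable_close_code (d' : measure_display) (U : measurableType d') (G' : gidx -> U -> R)
    (K : set gidx) i j rho n :
  (forall k, K k -> measurable_fun setT (G' k)) -> (forall i k b, K (inl (i, k, b))) ->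
  (forall l b, K (inr (i, j, n, l, b))) ->
  measurable_fun setT (fun w => (gvec G' i j n w ord0 != 0) &&
  (cabs (gvec G' i j n w ord_max / gvec G' i j n w ord0 -
         hvec G' i w ord_max / hvec G' i w ord0) <= rho)).
Proof.
move=> mK KH KC.
have mg l := cmeas_gvec mK (KC l); have mh k := cmeas_hvec mK (KH i k).
apply: measurable_and; first exact/measurable_neg/measurable_ceq0.
apply: measurable_fun_ler => //; apply/measurable_cabs/cmeasB.
  by apply: cmeasM => //; exact: cmeasV.
by apply: cmeasM => //; exact: cmeasV.
Qed.

(** Only codewords before [n] occur, so the event is independent of codeword [n]; this drives the
    induction of [no_close_le]. *)
Lemma measurable_no_close i j M rho n :
  measurable (no_close i j M rho n : set (genT G (other_than i j n))).
Proof.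
have mK k : other_than i j n k -> measurable_fun setT (G k : genT G (other_than i j n) -> R).
  by move=> Kk; exact: genT_coord_measurable.
have KH i' k b : other_than i j n (inl (i', k, b)) by case=> l [b' //].
have KC m : (m < n)%N -> forall l b, other_than i j n (inr (i, j, m, l, b)).
  by move=> mn l b [l' [b' []]] e; move: mn; rewrite e ltnn.
rewrite -[X in measurable X]setTI /no_close.
suff mb : measurable_fun setT ((fun w => (cabs (hv i w ord_max / hv i w ord0) <= M) &&
    all (fun m => ~~ close_code i j rho m w) (iota 0 n)) : genT G (other_than i j n) -> bool).
  exact: (mb measurableT [set true]).
have mh k := cmeas_hvec mK (KH i k).
apply: measurable_and.
  apply: measurable_fun_ler => //; apply/measurable_cabs.
  by apply: cmeasM; [exact: mh|apply: cmeasV; exact: mh].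
have : {in iota 0 n, forall m, (m < n)%N} by move=> m; rewrite mem_iota.
elim: (iota 0 n) => [|m s IH] hs /=; first exact: measurable_cst.
apply: measurable_and; last by apply: IH => m' ms; apply: hs; rewrite inE ms orbT.
apply/measurable_neg.
by apply: (measurable_close_code _ mK KH); apply: KC; apply: hs; rewrite inE eqxx.
Qed.

(** A box of codewords suffices: g_0 in a fixed rectangle away from 0, and both coordinates of g_1
    within rho/2 of those of g_0 z. Each of the four intervals contributes one density factor, and
    the last two contribute rho^2. *)
Lemma close_code_ge i j n (A : set (genT G (other_than i j n))) (M rho : R) :
  measurable A -> 0 <= M -> 0 < rho -> rho <= 1 ->
  (forall w, A w -> cabs (hv i w ord_max / hv i w ord0) <= M) ->
  ((gdens (3 * M + 3) ^+ 4 * rho ^+ 2)%:E * Pr (A : set T) <=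
   Pr ((A : set T) `&` [set w | close_code i j rho n w]))%E.
Proof.
move=> mA M0 r0 r1 hA.
set K := other_than i j n in A mA hA *.
pose kx0 : gidx := inr (i, j, n, ord0, false); pose ky0 : gidx := inr (i, j, n, ord0, true).
pose kx1 : gidx := inr (i, j, n, ord_max, false); pose ky1 : gidx := inr (i, j, n, ord_max, true).
pose K1 := K `|` [set kx0]; pose K2 := K1 `|` [set ky0]; pose K3 := K2 `|` [set kx1].
pose z (w : T) := hv i w ord_max / hv i w ord0.
pose g0 (w : T) := gv i j n w ord0.
have n0 : ~ K kx0 by apply; exists ord0, false.
have n1 : ~ K1 ky0 by case=> [|//]; apply; exists ord0, true.
have n2 : ~ K2 kx1 by case=> [[|//]|//]; apply; exists ord_max, false.
have n3 : ~ K3 ky1 by case=> [[[|//]|//]|//]; apply; exists ord_max, true.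
have KH i' k b : K (inl (i', k, b)) by case=> l [b' //].
have mzg (K' : set gidx) : K2 `<=` K' -> cmeas ((fun w => g0 w * z w) : genT G K' -> R[i]).
  move=> KK'; have mK' k : K' k -> measurable_fun setT (G k : genT G K' -> R).
    by move=> Kk; exact: genT_coord_measurable.
  have mh k : cmeas ((fun w => hv i w k) : genT G K' -> R[i]).
    by apply: (cmeas_hvec mK') => b; apply: KK'; do 2 left; exact: KH.
  apply: cmeasM; first by apply: (cmeas_gvec mK') => -[]; apply: KK'; [right|left; right].
  by apply: cmeasM => //; exact: cmeasV.
set c := gdens (3 * M + 3); have c0 : 0 < c := gdens_gt0 _.
have h12 : 0 <= 2^-1 :> R by rewrite invr_ge0.
have rho20 : 0 <= rho / 2 by rewrite divr_ge0// ltW.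
(* Re g_0 in [1, 2] and |Im g_0| <= 1 give 1 <= |g_0| <= 3. Hence |g_0 z| <= 3M, all centres and
   radii fit below 3M + 3, and dividing by g_0 does not enlarge distances. *)
have [] := interval_step mG indG lawG (a := fun=> 3 / 2) (M := 3 * M + 3) n0 mA (measurable_cst _) h12.
  by move=> w _; rewrite ger0_norm; lra.
set A1 := _ `&` _ => mA1 P1.
have [] := interval_step mG indG lawG (A := A1) (a := fun=> 0) (M := 3 * M + 3) n1 mA1 (measurable_cst _) ler01.
  by move=> w _; rewrite normr0; lra.
set A2 := _ `&` _ => mA2 P2.
have hg w : A2 w -> [/\ 1 <= cabs (g0 w), cabs (g0 w) <= 3 & cabs (z w) <= M].
  case=> -[Aw hx] hy; split; last exact: hA.
    apply: le_trans (Re_le_cabs _); rewrite /g0 /gvec /=.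
    move: hx; rewrite /= ler_distl => /andP[h1 _]; rewrite ger0_norm; lra.
  apply: le_trans (cabs_le_ReIm _) _; rewrite /g0 /gvec /=.
  move: hx hy; rewrite /= subr0 ler_distl => /andP[h1 h2] h3.
  rewrite ger0_norm; lra.
have hgz w : A2 w -> cabs (g0 w * z w) <= 3 * M.
  by case/hg => _ h1 h2; rewrite cabsM ler_pM ?cabs_ge0.
have [] := interval_step mG indG lawG (A := A2) (a := fun w => complex.Re (g0 w * z w))
    (M := 3 * M + 3) n2 mA2 (mzg K2 (@subset_refl _ _)).1 rho20.
  by move=> w /hgz h; have := Re_le_cabs (g0 w * z w); lra.
set A3 := _ `&` _ => mA3 P3.
have [] := interval_step mG indG lawG (A := A3) (a := fun w => complex.Im (g0 w * z w))
    (M := 3 * M + 3) n3 mA3 (mzg K3 (@subsetUl _ _ _)).2 rho20.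
  by move=> w [/hgz h _]; have := Im_le_cabs (g0 w * z w); lra.
set A4 := _ `&` _ => mA4 P4.
apply: (@le_trans _ _ (Pr A4)); last first.
  apply: le_measure; rewrite ?inE.
  - exact: (genT_measurable mG mA4).
  - apply: measurableI; first exact: (genT_measurable mG mA).
    have mb := measurable_close_code (K := setT) rho (i := i) (j := j) (n := n) (fun k _ => mG k)
      (fun _ _ _ => Logic.I) (fun _ _ => Logic.I).
    by rewrite -[X in measurable X]setTI; exact: (mb measurableT [set true]).
  - move=> w [[A2w hx] hy]; split; first by case: A2w => -[].
    have [h1 _ _] := hg w A2w.
    have g00 : g0 w != 0 by rewrite -cabs_gt0 (lt_le_trans _ h1).
    apply/andP; split => //.
    have -> : gv i j n w ord_max / gv i j n w ord0 - hv i w ord_max / hv i w ord0 =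
        (gv i j n w ord_max - g0 w * z w) / g0 w.
      rewrite -/(z w) -/(g0 w) mulrBl [g0 w * _]mulrC mulfK//.
    rewrite cabsM cabsV ler_pdivrMr ?cabs_gt0//.
    apply: (@le_trans _ _ rho); last by rewrite ler_peMr// ltW.
    apply: le_trans (cabs_le_ReIm _) _.
    move: hx hy; rewrite /gvec /=; case: (g0 w * z w) => x y /= hx hy; lra.
rewrite mulrC.
have chain (x y : R) (p p' p'' : \bar R) : 0 <= x -> (x%:E * p' <= p'')%E -> (y%:E * p <= p')%E ->
    ((x * y)%:E * p <= p'')%E.
  move=> x0 h1 h2; apply: le_trans h1; rewrite EFinM -muleA.
  by apply: lee_wpmul2l.
have q1 : 0 <= c * (2 * (rho / 2)) by rewrite mulr_ge0 ?(ltW c0)// mulr_ge0.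
have q2 : 0 <= c * (2 * 1) by rewrite mulr_ge0 ?(ltW c0)// mulr_ge0.
have H := chain _ _ _ _ _ q1 P4 (chain _ _ _ _ _ q1 P3 (chain _ _ _ _ _ q2 P2 P1)).
apply: le_trans H; apply: lee_wpmul2r; first exact: measure_ge0.
rewrite lee_fin.
have -> : c * (2 * (rho / 2)) * (c * (2 * (rho / 2)) * (c * (2 * 1) * (c * (2 * 2^-1)))) =
  2 * (rho ^+ 2 * c ^+ 4) by field.
have : 0 <= rho ^+ 2 * c ^+ 4 by rewrite mulr_ge0 ?exprn_ge0// ltW.
by lra.
Qed.

(** Given that the first [n] codewords miss, the next one hits with conditional probability at least
    [q], so the failure probability decays geometrically. *)
Lemma no_close_le i j (M rho : R) n : 0 <= M -> 0 < rho -> rho <= 1 ->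
  (Pr (no_close i j M rho n) <= ((1 - gdens (3 * M + 3) ^+ 4 * rho ^+ 2) ^+ n)%:E)%E.
Proof.
move=> M0 r0 r1; set q := _ * rho ^+ 2.
have q0 : 0 <= q by rewrite mulr_ge0 ?sqr_ge0// exprn_ge0// ltW// gdens_gt0.
have q1 : q <= 1.
  by rewrite mulr_ile1 ?sqr_ge0 ?exprn_ge0 ?expr_le1 ?gdens_le1// ltW// gdens_gt0.
elim: n => [|n IH].
  have m0 := genT_measurable mG (@measurable_no_close i j M rho 0).
  by rewrite expr0; exact: probability_le1.
have mA := @measurable_no_close i j M rho n.
have mA' := genT_measurable mG mA.
have h := close_code_ge mA M0 r0 r1.
have -> : no_close i j M rho n.+1 = no_close i j M rho n `\` [set w | close_code i j rho n w].
  have aS (p : pred nat) : all p (iota 0 n.+1) = all p (iota 0 n) && p n.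
    by rewrite -[in LHS]addn1 iotaD all_cat /= andbT add0n.
  apply/seteqP; split=> w; rewrite /no_close /mkset aS.
    by case/and3P => h1 h2 /negP h3; split => //; rewrite /mkset h1 h2.
  by case=> /andP[h1 h2] /negP h3; rewrite h1 h2.
have mC : measurable [set w | close_code i j rho n w].
  have mb := measurable_close_code (K := setT) rho (i := i) (j := j) (n := n) (fun k _ => mG k)
    (fun _ _ _ => Logic.I) (fun _ _ => Logic.I).
  by rewrite -[X in measurable X]setTI; exact: (mb measurableT [set true]).
rewrite measureD//; last by rewrite ltey_eq fin_num_measure.
have fA : Pr (no_close i j M rho n) \is a fin_num by exact: fin_num_measure.
have fI : Pr (no_close i j M rho n `&` [set w | close_code i j rho n w]) \is a fin_num.
  by apply: fin_num_measure; exact: measurableI.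
have {}h : (q%:E * Pr (no_close i j M rho n) <=
  Pr (no_close i j M rho n `&` [set w | close_code i j rho n w]))%E.
  by apply: h => w /andP[].
move: h IH; set p' := (X in (_ - X)%E); set p := (X in (X - _)%E).
move: fA fI; rewrite -/p -/p'; move: p p' => [p| |] [p'| |] // _ _.
rewrite -EFinM -EFinB !lee_fin => h IH.
rewrite exprS; apply: (@le_trans _ _ ((1 - q) * p)); first by lra.
by rewrite ler_wpM2l// subr_ge0.
Qed.

End CloseCodeword.

(** Bernoulli gives n q <= (1 + q)^n, and (1 - q)^n (1 + q)^n <= 1. This polynomial bound replaces
    the exponential one. *)
Lemma expr_onem_le (R : realType) (q : R) n : 0 < q -> q <= 1 -> (1 - q) ^+ n.+1 <= (n.+1%:R * q)^-1.
Proof.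
move=> q0 q1.
have nq : 0 < n.+1%:R * q by rewrite mulr_gt0.
rewrite -[leRHS]mul1r ler_pdivlMr//.
have h : n.+1%:R * q <= (1 + q) ^+ n.+1.
  have : 1 + n.+1%:R * q <= (1 + q) ^+ n.+1.
    elim: n.+1 => [|m IH]; first by rewrite mul0r addr0 expr0.
    rewrite exprS -natr1; apply: le_trans (ler_wpM2l _ IH); last by lra.
    have : 0 <= m%:R * q * q by rewrite !mulr_ge0// ltW.
    by lra.
  by lra.
apply: le_trans (ler_wpM2l _ h) _; first by rewrite exprn_ge0// subr_ge0.
rewrite -exprMn; apply: exprn_ile1; first by rewrite mulr_ge0 ?subr_ge0//; lra.
have := sqr_ge0 q; lra.
Qed.

(** * Closeness and nondegeneracy of the selected estimate *)

Section Localization.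
Context (R : realType) (d : measure_display) (T : measurableType d).
Context (Pr : probability T R) (G : gidx -> T -> R).
Context (B : 'I_2 -> 'I_2 -> R -> nat).
Hypothesis mG : forall k, measurable_fun setT (G k).
Hypothesis indG : mutually_independent Pr G.
Hypothesis lawG : forall k (A : set R), measurable A ->
  Pr (G k @^-1` A) = normal_prob 0 (Num.sqrt (2^-1)) A.
Notation hv := (hvec G).
Notation gv := (gvec G).
Notation est := (estimate G B).

Lemma whp_Hgood (e : R) : 0 < e -> whp Pr (fun P => Hgood G (P `^ (- e))).
Proof.
move=> e0; apply: whp_static => //; first exact: Hgood_mono.
by move=> eps eps0; exact: (HgoodP mG indG lawG).
Qed.

(** The channel is controlled by a constant [eta], not by P^(-e): the density factor decays like
    exp(-M^2) and would overwhelm every power of [P] if [M] grew polynomially. The expected number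
    of close codewords is then at least a constant times P^e. *)
Lemma whp_close_code i j (al e : R) : 0 < e -> e < al / 2 ->
  (B i j P)%:R / log2 P @[P --> +oo] --> al ->
  whp Pr (fun P => [set w | exists2 n, (n < 2 ^ B i j P)%N &
    close_code G i j (P `^ (- (al / 2) + e)) n w]).
Proof.
move=> e0 eal hB eps eps0.
have eps20 : 0 < eps / 2 by rewrite divr_gt0.
have [eta eta0 [N1 [mN1 PN1 hN1]]] := HgoodP mG indG lawG eps20.
(* Bound on the slope |h_1|/|h_0|: numerator at most 1/eta, denominator at least eta. *)
pose M := eta^-1 * eta^-1.
have M0 : 0 <= M by rewrite mulr_ge0// invr_ge0 ltW.
set c := gdens (3 * M + 3); have c0 : 0 < c ^+ 4 by rewrite exprn_gt0// gdens_gt0.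
near=> P.
have P1 : 1 < P by near: P; exact: nbhs_pinfty_gt.
have P0 : 0 < P by rewrite (lt_trans _ P1).
set rho := P `^ _.
have rho0 : 0 < rho by rewrite powR_gt0.
have rho1 : rho <= 1 by rewrite -(powRr0 P); apply: powR_exp_le; [exact: ltW|lra].
pose Nn := (2 ^ B i j P)%N.
have mA := genT_measurable mG (@measurable_no_close _ _ _ G i j M rho Nn).
exists (N1 `|` no_close G i j M rho Nn); split; first exact: measurableU.
  apply: le_trans (measureU2 _ mN1 mA) _; rewrite [eps]splitr EFinD leeD//.
  apply: le_trans (no_close_le mG indG lawG i j Nn M0 rho0 rho1) _; rewrite lee_fin -/c.
  have NS : Nn = Nn.-1.+1 by rewrite prednK// expn_gt0.
  have q0 : 0 < c ^+ 4 * rho ^+ 2 by rewrite mulr_gt0// exprn_gt0.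
  have q1 : c ^+ 4 * rho ^+ 2 <= 1.
    by rewrite mulr_ile1 ?sqr_ge0 ?(ltW c0) ?expr_le1 ?gdens_le1// ltW// gdens_gt0.
  rewrite NS; apply: le_trans (expr_onem_le _ q0 q1) _; rewrite -NS.
  have /andP[hN _] : P `^ (al - e) <= (2 ^ B i j P)%:R <= P `^ (al + e).
    by near: P; exact: near_bits.
  have hr : rho ^+ 2 * P `^ (al - e) = P `^ e.
    rewrite expr2 /rho -!powR_add//. by congr (_ `^ _); field.
  have h1 : c ^+ 4 * P `^ e <= Nn%:R * (c ^+ 4 * rho ^+ 2).
    have -> : c ^+ 4 * P `^ e = c ^+ 4 * rho ^+ 2 * P `^ (al - e) by rewrite -hr mulrA.
    by rewrite [leRHS]mulrC ler_wpM2l// ltW.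
  have h2 : (eps / 2 * c ^+ 4)^-1 <= P `^ e by near: P; exact: near_powR_ge.
  have nq : 0 < Nn%:R * (c ^+ 4 * rho ^+ 2) by rewrite pmulr_lgt0// ltr0n expn_gt0.
  rewrite -[leRHS]invrK lef_pV2 ?posrE ?invr_gt0//.
  apply: le_trans h1.
  have -> : (eps / 2)^-1 = c ^+ 4 * (eps / 2 * c ^+ 4)^-1.
    by rewrite [(_ * c ^+ 4)^-1]invfM mulrCA divff ?mulr1// gt_eqF.
  exact: ler_wpM2l (ltW c0) _ _ h2.
move=> w /not_orP[n1 n2]; have [hH _] := hN1 w n1.
apply: contrapT => hno; apply: n2; apply/andP; split.
  have [h1 _] := hH i ord0; have [_ h2] := hH i ord_max.
  rewrite cabsM cabsV /M ler_pM ?invr_ge0 ?cabs_ge0// lef_pV2 ?posrE//.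
  exact: lt_le_trans eta0 h1.
apply/allP => n; rewrite mem_iota add0n => /andP[_ nN]; apply/negP => h; apply: hno.
by exists n.
Unshelve. all: by end_near. Qed.

(** For scaling 0 the last clause allows distance P^e and holds trivially for unit vectors; the
    clause on the entries carries the information then. *)
Definition localized i j (al e : R) (P : R) : set T := [set w |
  [/\ gsel G B P i j w ord0 != 0, hv i w ord0 != 0,
   (forall l, P `^ (- e) <= cabs (est P i j w l)) &
   forall l, cabs (est P i j w l - cword (hv i w) l) <= P `^ (- (al / 2) + e)]].

Lemma cword_Hgood (e : R) i l w : 0 < e -> Hgood G e w ->
  hv i w ord0 != 0 /\ e ^+ 2 / 2 <= cabs (cword (hv i w) l).
Proof.
move=> e0 [h _]; have h0 k : hv i w k != 0.
  by rewrite -cabs_gt0; have [h1 _] := h i k; exact: lt_le_trans h1.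
split => //; rewrite cabs_cword// ler_pdivlMr ?(vnorm_gt0 (h0 ord0))//.
have [h1 _] := h i l.
have := vnorm_le_cabs (hv i w) ord0.
have [_ h2] := h i ord0; have [_ h3] := h i (other ord0) => hn.
apply: le_trans h1.
have : vnorm (hv i w) <= 2 / e by lra.
move=> /(ler_wpM2l (_ : 0 <= e ^+ 2 / 2)); rewrite divr_ge0 ?sqr_ge0// => /(_ isT).
by rewrite [X in _ <= X](_ : _ = e)//; field; rewrite gt_eqF.
Qed.

(** The selected codeword scores at least as well as the close one, and a score near 1 forces
    closeness because the first entry of the channel direction exceeds [rho]. *)
Lemma whp_localized_pos i j (al e : R) : 0 < al -> 0 < e ->
  (B i j P)%:R / log2 P @[P --> +oo] --> al -> whp Pr (localized i j al e).
Proof.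
move=> al0 e0 hB.
(* [e1] is the loss of the close codeword, [e2] that of the channel bounds. The caps by [al] make
   P^(-al/2 + e1) negligible against P^(-2 e2); those by [e] keep the final losses below [e]. *)
pose e1 := Num.min (e / 2) (al / 4); pose e2 := Num.min (al / 16) (e / 8).
have e10 : 0 < e1 by rewrite lt_min; apply/andP; split; lra.
have e20 : 0 < e2 by rewrite lt_min; apply/andP; split; lra.
have e1e : e1 <= e / 2 by rewrite ge_min lexx.
have e1a : e1 <= al / 4 by rewrite ge_min lexx orbT.
have e2a : e2 <= al / 16 by rewrite ge_min lexx.
have e2e : e2 <= e / 8 by rewrite ge_min lexx orbT.
have e1al : e1 < al / 2 by lra.
refine (whpW (whpI (whp_Hgood e20) (whp_close_code e10 e1al hB)) _).
near=> P => w [hH [n nN]].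
have P1 : 1 < P by near: P; exact: nbhs_pinfty_gt.
have P0 : 0 < P by rewrite (lt_trans _ P1).
set rho := P `^ (- (al / 2) + e1).
have rho0 : 0 < rho by rewrite powR_gt0.
have et0 : 0 < P `^ (- e2) by rewrite powR_gt0.
have sq : P `^ (- e2) ^+ 2 = P `^ (- (2 * e2)).
  by rewrite expr2 -powR_add//; congr (_ `^ _); ring.
have hh l : P `^ (- (2 * e2)) / 2 <= cabs (cword (hv i w) l).
  by rewrite -sq; case: (cword_Hgood i l et0 hH).
have h0 : hv i w ord0 != 0 by case: (cword_Hgood i ord0 et0 hH).
have hrho : 4 * P `^ (- (al / 2) + e1) <= P `^ (- (2 * e2)).
  by near: P; apply: near_powR_cmp; lra.
rewrite -/rho in hrho.
have hpe : 4 * P `^ (- e) <= P `^ (- (2 * e2)).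
  by near: P; apply: near_powR_cmp; lra.
have p20 : 0 < P `^ (- (2 * e2)) by rewrite powR_gt0.
move=> /andP[gn0 hz].
have sn := r3dot_cword_ge gn0 h0 hz.
have sbest : 1 - rho ^+ 2 / 2 <= `|r3dot (est P i j w) (cword (hv i w))|.
  apply: le_trans sn _; apply: le_trans (ler_norm _) _.
  have := best_index_max (fun n => qscore (codeword G i j n w) (htilde G i w)) nN.
  by rewrite /= !qscore_codeword.
(* With first entry 0 the score would be at most the modulus x of the second channel entry, where
   x^2 <= 1 - 4 rho^2, against the lower bound 1 - rho^2/2. *)
have gs0 : gsel G B P i j w ord0 != 0.
  apply/negP => /eqP g0; have := sbest.
  have e0' : est P i j w ord0 = 0.
    apply/eqP; apply: contraT => h; move/cword_neq0: h; rewrite -[X in X != 0]/(gsel G B P i j w ord0).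
    by rewrite g0 eqxx.
  have hc1 : cabs (est P i j w ord_max) <= 1.
    rewrite /estimate /codeword /phase_norm; case: ifP => _; first exact: cabs_normalize_le1.
    rewrite /scalev cabsM cabsM cabs_conj cabsV cabs_ocplx ger0_norm ?cabs_ge0//.
    rewrite -[leRHS]mul1r ler_pM ?mulr_ge0 ?invr_ge0 ?cabs_ge0 ?cabs_normalize_le1//.
    by set x := cabs _; have [->|x0] := eqVneq x 0; rewrite ?mul0r ?divff.
  have hn := sqr_vnorm (cword (hv i w)) ord0; rewrite vnorm_cword// expr1n other0 in hn.
  have hh0 : 2 * rho <= cabs (cword (hv i w) ord0) by have := hh ord0; lra.
  have h2 : `|r3dot (est P i j w) (cword (hv i w))| <= cabs (cword (hv i w) ord_max).
    rewrite r3dotE e0' /= mul0r add0r; apply: le_trans (Re_le_cabs _) _.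
    by rewrite cabsM cabs_conj ler_piMl ?cabs_ge0.
  have x0 := cabs_ge0 (cword (hv i w) ord_max).
  have h4 : 4 * rho ^+ 2 <= cabs (cword (hv i w) ord0) ^+ 2.
    by rewrite (_ : 4 * _ = (2 * rho) ^+ 2); [rewrite ler_sqr ?nnegrE ?cabs_ge0 ?mulr_ge0 ?(ltW rho0)|ring].
  move=> h5; set x := cabs _ in h2 x0 hn; set y := cabs _ ^+ 2 in h4 hn.
  have : 0 < rho ^+ 2 by rewrite exprn_gt0.
  nra.
have near_h l : cabs (est P i j w l - cword (hv i w) l) <= rho.
  have ee0 : est P i j w ord0 =
      ocplx (cabs (gsel G B P i j w ord0) / vnorm (gsel G B P i j w)) by exact: cword0.
  apply: (qscore_near (ltW rho0)) => //.
  - by rewrite ee0.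
  - by rewrite cword0.
  - exact: vnorm_cword.
  - exact: vnorm_cword.
  - by rewrite ee0 /= divr_ge0 ?cabs_ge0 ?vnorm_ge0.
  - have := hh ord0; rewrite cword0// cabs_ocplx /= ger0_norm ?divr_ge0 ?cabs_ge0 ?vnorm_ge0//.
    by lra.
split => // l.
- have h1 := hh l; have h2 := near_h l.
  have := cabs_ler_dist (cword (hv i w) l) (est P i j w l); rewrite cabs_distC; lra.
- apply: le_trans (near_h l) _; apply: powR_exp_le; [exact: ltW|lra].
Unshelve. all: by end_near. Qed.

Lemma whp_localized0 i j (e : R) : 0 < e ->
  (B i j P)%:R / log2 P @[P --> +oo] --> (0 : R) -> whp Pr (localized i j 0 e).
Proof.
move=> e0 hB.
refine (whpW (whpI (whp_Hgood e0) (whp_code_nondegenerate mG indG lawG e0 hB)) _).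
near=> P => w [hH hn].
have P1 : 1 < P by near: P; exact: nbhs_pinfty_gt.
have P0 : 0 < P by rewrite (lt_trans _ P1).
have et0 : 0 < P `^ (- e) by rewrite powR_gt0.
have h0 : hv i w ord0 != 0 by case: (cword_Hgood i ord0 et0 hH).
have sN : (selidx G B P i j w < 2 ^ B i j P)%N.
  by apply: best_index_lt; rewrite expn_gt0.
have gs0 : gsel G B P i j w ord0 != 0 by case: (hn _ ord0 sN).
split => // l.
  rewrite estimateE cabs_cword// ler_pdivlMr ?(vnorm_gt0 gs0)//.
  by case: (hn _ l sN).
have h2 : 2 <= P `^ (- (0 / 2) + e).
  by rewrite mul0r oppr0 add0r; near: P; exact: near_powR_ge.
apply: le_trans h2; apply: le_trans (cabsB _ _) _.
have le1 (u : cvec R) : vnorm u = 1 -> cabs (u l) <= 1.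
  by move=> nu; have := cabs_le_vnorm u l; rewrite nu.
have := le1 _ (vnorm_cword h0); have := le1 _ (vnorm_cword gs0).
by rewrite -estimateE; lra.
Unshelve. all: by end_near. Qed.

Lemma whp_localized i j (al e : R) : 0 <= al -> 0 < e ->
  (B i j P)%:R / log2 P @[P --> +oo] --> al -> whp Pr (localized i j al e).
Proof.
rewrite le_eqVlt => /orP[/eqP <-|al0] e0 hB; first exact: whp_localized0.
exact: whp_localized_pos.
Qed.

End Localization.

(** * Lower bound on the interference *)

Section StripGeometry.
Context (R : realType).
Notation C := (R[i]).
Notation cvec := (cvec R).
Implicit Types (a b g h : cvec) (X : C) (k l : 'I_2) (e r rho : R).

Definition balanced e g := (e * vnorm g <= cabs (g ord0)) && (e * vnorm g <= cabs (g ord_max)).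

Definition tame e h := [&& e <= cabs (h ord0), e <= cabs (h ord_max),
  cabs (h ord0) <= e^-1 & cabs (h ord_max) <= e^-1].

(** The factor by which phase normalisation rotates [b]; it depends on the first entry of [b]
    alone. *)
Definition unitphase b : C := conjc (b ord0) / ocplx (cabs (b ord0)).

Lemma balancedE e g l : balanced e g -> e * vnorm g <= cabs (g l).
Proof. by case/andP; case: (ord2P l) => ->. Qed.

Lemma tame_ge e h l : tame e h -> e <= cabs (h l).
Proof. by case/and4P; case: (ord2P l) => ->. Qed.

Lemma tame_vnorm e h : tame e h -> vnorm h <= 2 / e.
Proof. by case/and4P=> _ _ h0 h1; have := vnorm_le_cabs h ord0; rewrite other0; lra. Qed.

Lemma cabs_unitphase b : b ord0 != 0 -> cabs (unitphase b) = 1.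
Proof.
move=> b0; rewrite cabsM cabsV cabs_conj cabs_ocplx ger0_norm ?cabs_ge0//.
by rewrite divff// cabs_eq0.
Qed.

Lemma Im_ocplxM (t : R) (z : C) : complex.Im (ocplx t * z) = t * complex.Im z.
Proof. by case: z => x y; rewrite /ocplx /=; ring. Qed.

Lemma ImB (x y : C) : complex.Im (x - y) = complex.Im x - complex.Im y.
Proof. by case: x => ? ?; case: y. Qed.

(** [Im_phase_le] removes the other transmitter, and multiplying by |a| |det| clears the
    denominators of the precoder entry at the price of at most |a|^2 |b|. *)
Lemma strip_core a b h X k r : a ord0 != 0 -> b ord0 != 0 ->
  cabs (conjc (h k) * zfdir (cword a) (cword b) k + X) <= r ->
  `|complex.Im (conjc (phase X) * conjc (h k) *
     (- conjc (a (other k)) * det2 k a b * unitphase b))| <= r * (vnorm a ^+ 2 * vnorm b).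
Proof.
move=> a0 b0 /Im_phase_le h1.
have r0 : 0 <= r by apply: le_trans h1.
rewrite /unitphase -zfdir_cword//.
rewrite (_ : _ * _ * _ = ocplx (vnorm a * cabs (det2 k a b)) *
  (conjc (phase X) * (conjc (h k) * zfdir (cword a) (cword b) k))); last by ring.
have t0 : 0 <= vnorm a * cabs (det2 k a b) by rewrite mulr_ge0 ?vnorm_ge0 ?cabs_ge0.
rewrite Im_ocplxM normrM ger0_norm// mulrC; apply: ler_pM => //.
by rewrite expr2 -mulrA ler_wpM2l ?vnorm_ge0// cabs_det2_le.
Qed.

(** With [a (other k)] and [b] frozen, the determinant is affine in [a k]. The four powers of [e]
    pay for |h_k|, for |a|^2 and for |b|, each replaced by moduli of entries. *)
Lemma strip_first a b h X k e r : 0 < e -> a ord0 != 0 -> b ord0 != 0 ->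
  balanced e a -> balanced e b -> tame e h ->
  cabs (conjc (h k) * zfdir (cword a) (cword b) k + X) <= r ->
  let c := conjc (phase X) * conjc (h k) * conjc (a (other k)) * unitphase b in
  let m := - c * b (other k) in
  m != 0 /\ `|complex.Im (m * a k) - complex.Im (- (c * a (other k) * b k))| <=
    cabs m * (r / e ^+ 4 * cabs (a (other k))).
Proof.
move=> e0 a0 b0 ga gb th hr; move: (cabs_unitphase b0) (strip_core a0 b0 hr).
move: (unitphase b) => p cp hs c m.
have r0 : 0 <= r by apply: le_trans hr; exact: cabs_ge0.
have na := vnorm_gt0 a0; have nb := vnorm_gt0 b0.
have ak := balancedE (other k) ga; have bk := balancedE (other k) gb; have hk := tame_ge k th.
have cm : cabs m = cabs (h k) * cabs (a (other k)) * cabs (b (other k)).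
  by rewrite cabsM cabsN !cabsM !cabs_conj cabs_phase cp mul1r mulr1.
have A0 : 0 < cabs (a (other k)) by rewrite (lt_le_trans _ ak)// mulr_gt0.
have B0 : 0 < cabs (b (other k)) by rewrite (lt_le_trans _ bk)// mulr_gt0.
have H0 : 0 < cabs (h k) by rewrite (lt_le_trans e0).
split; first by rewrite -cabs_gt0 cm !mulr_gt0.
have -> : complex.Im (m * a k) - complex.Im (- (c * a (other k) * b k)) =
   complex.Im (m * a k - - (c * a (other k) * b k)).
  by rewrite ImB.
rewrite (_ : m * a k - - (c * a (other k) * b k) = conjc (phase X) * conjc (h k) *
     (- conjc (a (other k)) * det2 k a b * p)); last by rewrite /m /c /det2; ring.
apply: le_trans hs _; rewrite cm.
rewrite [X in _ <= X](_ : _ = r * (cabs (h k) * cabs (a (other k)) ^+ 2 * cabs (b (other k)) / e ^+ 4)); last by ring.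
rewrite ler_wpM2l// ler_pdivlMr ?exprn_gt0//.
rewrite (_ : _ * e ^+ 4 = e * (e * vnorm a) ^+ 2 * (e * vnorm b)); last by ring.
have := ltW na; have := ltW nb => nb' na'.
apply: ler_pM; rewrite ?mulr_ge0 ?sqr_ge0 ?(ltW e0)//.
apply: ler_pM; rewrite ?sqr_ge0 ?(ltW e0)//.
by rewrite ler_sqr ?nnegrE ?cabs_ge0// mulr_ge0// ltW.
Qed.

(** Puts the determinant in the fixed order 0, 1 whatever the transmitting antenna [k]. *)
Definition osign k : C := if k == ord0 then 1 else -1.

Lemma det2_osign k a b : det2 k a b = osign k * (a ord0 * b ord_max - a ord_max * b ord0).
Proof. by case: (ord2P k) => ->; rewrite /osign /det2 ?other0 ?other1 /=; ring. Qed.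

(** Here [b] varies. Its first entry also sets the common phase, so that entry is frozen and the
    affine variable is the last entry, for both values of [k]; this is why [osign] appears. *)
Lemma strip_second a b h X k e r : 0 < e -> a ord0 != 0 -> b ord0 != 0 ->
  balanced e a -> balanced e b -> tame e h ->
  cabs (conjc (h k) * zfdir (cword a) (cword b) k + X) <= r ->
  let c := conjc (phase X) * conjc (h k) * conjc (a (other k)) * unitphase b * osign k in
  let m := - c * a ord0 in
  m != 0 /\ `|complex.Im (m * b ord_max) - complex.Im (- (c * a ord_max * b ord0))| <=
    cabs m * (r / e ^+ 4 * cabs (b ord0)).
Proof.
move=> e0 a0 b0 ga gb th hr; move: (cabs_unitphase b0) (strip_core a0 b0 hr).
move: (unitphase b) => p cp hs c m.
have r0 : 0 <= r by apply: le_trans hr; exact: cabs_ge0.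
have na := vnorm_gt0 a0; have nb := vnorm_gt0 b0.
have ak := balancedE (other k) ga; have a0k := balancedE ord0 ga.
have bk := balancedE ord0 gb; have hk := tame_ge k th.
have cs : cabs (osign k) = 1 by rewrite /osign; case: ifP; rewrite ?cabsN cabs1.
have cm : cabs m = cabs (h k) * cabs (a (other k)) * cabs (a ord0).
  by rewrite cabsM cabsN !cabsM !cabs_conj cabs_phase cp cs mul1r !mulr1.
have A0 : 0 < cabs (a (other k)) by rewrite (lt_le_trans _ ak)// mulr_gt0.
have A1 : 0 < cabs (a ord0) by rewrite cabs_gt0.
have H0 : 0 < cabs (h k) by rewrite (lt_le_trans e0).
split; first by rewrite -cabs_gt0 cm !mulr_gt0.
have -> : complex.Im (m * b ord_max) - complex.Im (- (c * a ord_max * b ord0)) =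
   complex.Im (m * b ord_max - - (c * a ord_max * b ord0)).
  by rewrite ImB.
rewrite (_ : m * b ord_max - - (c * a ord_max * b ord0) = conjc (phase X) * conjc (h k) *
     (- conjc (a (other k)) * det2 k a b * p)); last first.
  by rewrite /m /c det2_osign; ring.
apply: le_trans hs _; rewrite cm.
rewrite [X in _ <= X](_ : _ = r * (cabs (h k) * cabs (a (other k)) * cabs (a ord0) * cabs (b ord0) / e ^+ 4)); last by ring.
rewrite ler_wpM2l// ler_pdivlMr ?exprn_gt0//.
rewrite (_ : _ * e ^+ 4 = e * (e * vnorm a) * (e * vnorm a) * (e * vnorm b)); last by ring.
have := ltW na; have := ltW nb => nb' na'; have e0' := ltW e0.
apply: ler_pM; rewrite ?mulr_ge0//.
apply: ler_pM; rewrite ?mulr_ge0//.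
by apply: ler_pM; rewrite ?mulr_ge0.
Qed.

(** Closeness of directions bounds the determinant; divided by [h (other l)] it becomes a disc for
    [g l] whose centre depends only on [g (other l)] and the channel. *)
Lemma ball_of_det g h l e rho : 0 < e -> 0 <= rho -> g ord0 != 0 -> balanced e g -> tame e h ->
  cabs (det2 l g h) <= 2 * rho * (vnorm g * vnorm h) ->
  cabs (g l - g (other l) * h l / h (other l)) <= 4 * rho / e ^+ 3 * cabs (g (other l)).
Proof.
move=> e0 rho0 g0 bg th hd.
have h1 := tame_ge (other l) th.
have H0 : 0 < cabs (h (other l)) by rewrite (lt_le_trans e0).
have h0 : h (other l) != 0 by rewrite -cabs_gt0.
have -> : g l - g (other l) * h l / h (other l) = det2 l g h / h (other l).
  by rewrite /det2; field.
rewrite cabsM cabsV ler_pdivrMr//; apply: le_trans hd _.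
have hg := balancedE (other l) bg; have hh := tame_vnorm th.
have ng := ltW (vnorm_gt0 g0).
apply: (@le_trans _ _ (2 * rho * (vnorm g * (2 / e)))).
  by rewrite ler_wpM2l ?mulr_ge0// ler_wpM2l.
rewrite (_ : 2 * rho * _ = 4 * rho / e ^+ 3 * (e * vnorm g) * e); last first.
  by field; rewrite gt_eqF.
have c0 : 0 <= 4 * rho / e ^+ 3 by rewrite divr_ge0 ?mulr_ge0 ?exprn_ge0// ltW.
have e0' := ltW e0; apply: ler_pM => //.
  by apply: mulr_ge0 => //; exact: mulr_ge0.
by rewrite ler_wpM2l.
Qed.

Lemma det2_near u v l rho : vnorm v = 1 -> (forall k, cabs (u k - v k) <= rho) ->
  cabs (det2 l u v) <= 2 * rho.
Proof.
move=> nv h; have -> : det2 l u v =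
   (u l - v l) * v (other l) - (u (other l) - v (other l)) * v l by rewrite /det2; ring.
have le1 k : cabs (v k) <= 1 by have := cabs_le_vnorm v k; rewrite nv.
have p k k' : cabs (u k - v k) * cabs (v k') <= rho.
  by rewrite (le_trans _ (h k))// ler_piMr ?cabs_ge0.
rewrite (le_trans (cabsB _ _))// !cabsM.
by have := p l (other l); have := p (other l) l; lra.
Qed.

(** [a] and [b] feed the precoder of the antenna [k] heard through [h], and [X] is the other
    antenna's contribution. The codeword [g], quantizing [hg], is the one whose entry [l] is random;
    it is [a] or [b]. *)
Definition bad_event e r rho a b h g hg l k X : bool :=
  [&& a ord0 != 0, b ord0 != 0, balanced e a, balanced e b, tame e h, tame e hg,
   cabs (det2 l g hg) <= 2 * rho * (vnorm g * vnorm hg) &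
   cabs (conjc (h k) * zfdir (cword a) (cword b) k + X) <= r].

End StripGeometry.

Section BadEventMeasurability.
Context (R : realType) (d : measure_display) (U : measurableType d).

Lemma measurable_balanced e (g : U -> cvec R) : vmeas g ->
  measurable_fun setT (fun w => balanced e (g w)).
Proof.
move=> mg; apply: measurable_and; apply: measurable_fun_ler;
  do ?[exact: measurable_cabs | apply: measurable_funM => //; exact: measurable_vnorm].
Qed.

Lemma measurable_tame e (h : U -> cvec R) : vmeas h ->
  measurable_fun setT (fun w => tame e (h w)).
Proof.
move=> mh; do 3?[apply: measurable_and]; apply: measurable_fun_ler => //;
  exact: measurable_cabs.
Qed.

Lemma measurable_bad_event e r rho (a b h g hg : U -> cvec R) l k (X : U -> R[i]) :
  vmeas a -> vmeas b -> vmeas h -> vmeas g -> vmeas hg -> cmeas X ->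
  measurable [set w | bad_event e r rho (a w) (b w) (h w) (g w) (hg w) l k (X w)].
Proof.
move=> ma mb mh mg mhg mX.
suff mE : measurable_fun setT
    (fun w => bad_event e r rho (a w) (b w) (h w) (g w) (hg w) l k (X w)).
  by rewrite -[X in measurable X]setTI; exact: (mE measurableT [set true]).
apply: measurable_and; first exact/measurable_neg/measurable_ceq0.
apply: measurable_and; first exact/measurable_neg/measurable_ceq0.
apply: measurable_and; first exact: measurable_balanced.
apply: measurable_and; first exact: measurable_balanced.
apply: measurable_and; first exact: measurable_tame.
apply: measurable_and; first exact: measurable_tame.
apply: measurable_and; apply: measurable_fun_ler => //.
- by apply/measurable_cabs/cmeasB; exact: cmeasM.
- apply: measurable_funM => //; apply: measurable_funM; exact: measurable_vnorm.
- apply/measurable_cabs/cmeasD => //; apply: cmeasM; first exact: cmeas_conj.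
  by apply: vmeas_zfdir; apply/vmeas_phase_norm/vmeas_normalize.
Qed.

End BadEventMeasurability.

Section InterferenceLowerBound.
Context (R : realType) (d : measure_display) (T : measurableType d).
Context (Pr : probability T R) (G : gidx -> T -> R).
Context (B : 'I_2 -> 'I_2 -> R -> nat).
Hypothesis mG : forall k, measurable_fun setT (G k).
Hypothesis indG : mutually_independent Pr G.
Hypothesis lawG : forall k (A : set R), measurable A ->
  Pr (G k @^-1` A) = normal_prob 0 (Num.sqrt (2^-1)) A.
Notation hv := (hvec G).
Notation gv := (gvec G).
Notation est := (estimate G B).
Notation gs := (gsel G B).
Notation m2 := (gmoment2 R).

Let mGT k : setT k -> measurable_fun setT (G k). Proof. by []. Qed.

Definition leak P i k (w : T) : R[i] :=
  conjc (hv i w k) * zfdir (est P i k w) (est P (other i) k w) k.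

Lemma dotH_leak P i k w :
  dotH (hv i w) (zfbeam G B P (other i) w) = leak P i k w + leak P i (other k) w.
Proof. by rewrite /dotH (big_ord2 _ k) /zfbeam otherK. Qed.

(** Codeword [n] replaces the selected one in the codebook for the nulled channel; the other
    estimates remain selected ones, hence independent of that codebook given the channel. *)
Definition bad_first P e r rho i k n (w : T) :=
  bad_event e r rho (gv i k n w) (gs P (other i) k w) (hv i w) (gv i k n w) (hv i w) k k
    (leak P i (other k) w).

(** The replaced codeword quantizes the channel of the other receiver, which reaches this
    interference through the direction of the projection and the common phase. *)
Definition bad_second P e r rho i k n (w : T) :=
  bad_event e r rho (gs P i k w) (gv (other i) k n w) (hv i w) (gv (other i) k n w)
    (hv (other i) w) ord_max k (leak P i (other k) w).

Lemma measurable_bad_first P e r rho i k n : measurable [set w | bad_first P e r rho i k n w].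
Proof.
have mh i' : vmeas (hv i') by exact: (vmeas_hvec mGT).
have mgs i' k' : vmeas (gs P i' k') by exact: (vmeas_gsel B mGT).
have mest i' k' : vmeas (est P i' k') by exact: (vmeas_estimate B mGT).
have mgv i' k' n' : vmeas (gv i' k' n') by move=> l; exact: (cmeas_gvec mGT).
apply: measurable_bad_event => //.
by apply: cmeasM; [exact/cmeas_conj/mh|exact: vmeas_zfdir].
Qed.

Lemma measurable_bad_second P e r rho i k n : measurable [set w | bad_second P e r rho i k n w].
Proof.
have mh i' : vmeas (hv i') by exact: (vmeas_hvec mGT).
have mgs i' k' : vmeas (gs P i' k') by exact: (vmeas_gsel B mGT).
have mest i' k' : vmeas (est P i' k') by exact: (vmeas_estimate B mGT).
have mgv i' k' n' : vmeas (gv i' k' n') by move=> l; exact: (cmeas_gvec mGT).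
apply: measurable_bad_event => //.
by apply: cmeasM; [exact/cmeas_conj/mh|exact: vmeas_zfdir].
Qed.

Lemma cmeas_unitphase (d' : measure_display) (U : measurableType d') (b : U -> cvec R) :
  cmeas (fun w => b w ord0) -> cmeas (fun w => unitphase (b w)).
Proof.
move=> mb; apply: cmeasM; first exact: cmeas_conj.
by apply/cmeasV/cmeas_ocplx/measurable_cabs.
Qed.

Lemma strip_moment i j n l (c : R) : 0 <= c ->
  (\int[Pr]_w (c * cabs (gv i j n w l) ^+ 2)%:E = (c * (2 * m2))%:E)%E.
Proof.
move=> c0; rewrite EFinM -(integral_gvec2 mG lawG i j n l) -ge0_integralZl//.
- by apply/measurable_EFinP; apply: measurable_funX; apply: measurable_cabs; exact: (cmeas_gvec mGT).
- by move=> w _; rewrite lee_fin sqr_ge0.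
Qed.

Lemma bad_first_le P e r rho i k n : 0 < e -> 0 <= r -> 0 <= rho ->
  (Pr [set w | bad_first P e r rho i k n w] <= (128 * m2 * (r * rho / e ^+ 7))%:E)%E.
Proof.
move=> e0 r0 rho0.
pose kx : gidx := inr (i, k, n, k, false); pose ky : gidx := inr (i, k, n, k, true).
(* Everything is frozen except the two real coordinates of entry [k] of codeword [n]; the [KC] facts
   check that all other ingredients live on [K]. *)
pose K : set gidx := ~` [set k | k = kx \/ k = ky].
have nx : ~ K kx by apply; left.
have ny : ~ K ky by apply; right.
have xy : kx != ky by apply/eqP => -[].
have mK k' : K k' -> measurable_fun setT (G k' : genT G K -> R).
  by move=> Kk; exact: genT_coord_measurable.
have KH i' k' b : K (inl (i', k', b)) by case.
have KC i' k' : (i', k') != (i, k) -> forall n' l b, K (inr (i', k', n', l, b)).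
  by move=> /eqP ne n' l b [] [] e1 e2 *; apply: ne; rewrite e1 e2.
have ko : other k != k := other_neq k; have io : other i != i := other_neq i.
have KC1 : forall n' l b, K (inr (i, other k, n', l, b)).
  by apply: KC; apply: contra ko => /eqP[->].
have KC2 : forall n' l b, K (inr (other i, other k, n', l, b)).
  by apply: KC; apply: contra ko => /eqP[_ ->].
have KC3 : forall n' l b, K (inr (other i, k, n', l, b)).
  by apply: KC; apply: contra io => /eqP[->].
have KC4 b : K (inr (i, k, n, other k, b)).
  by case=> [] [] e1 _; move: ko; rewrite e1 eqxx.
have mh i' : vmeas (hvec G i' : genT G K -> cvec R) by exact: (vmeas_hvec mK KH).
have ma : cmeas ((fun w => gv i k n w (other k)) : genT G K -> R[i]) by exact: (cmeas_gvec mK).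
have mb : vmeas (gs P (other i) k : genT G K -> cvec R) by exact: (vmeas_gsel B mK KH).
have mX : cmeas (leak P i (other k) : genT G K -> R[i]).
  apply: cmeasM; first exact/cmeas_conj/mh.
  apply: vmeas_zfdir; first exact: (vmeas_estimate B mK KH).
  exact: (vmeas_estimate B mK KH).
pose c (w : genT G K) := conjc (phase (leak P i (other k) w)) * conjc (hv i w k) *
  conjc (gv i k n w (other k)) * unitphase (gs P (other i) k w).
have mc : cmeas c.
  apply: cmeasM; last exact/cmeas_unitphase/mb.
  apply: cmeasM; last exact: cmeas_conj.
  by apply: cmeasM; [exact/cmeas_conj/cmeas_phase|exact/cmeas_conj/mh].
pose m w := - c w * gs P (other i) k w (other k).
have mm : cmeas m by apply: cmeasM; [exact: cmeasN|exact: mb].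
pose z0 (w : genT G K) := gv i k n w (other k) * hv i w k / hv i w (other k).
have mz0 : cmeas z0.
  apply: cmeasM; last exact/cmeasV/mh.
  by apply: cmeasM => //; exact: mh.
pose kap w := complex.Im (- (c w * gv i k n w (other k) * gs P (other i) k w k)).
have mkap : measurable_fun setT kap.
  have [_ //] : cmeas (fun w => - (c w * gv i k n w (other k) * gs P (other i) k w k)).
  apply: cmeasN; apply: cmeasM; last exact: mb.
  exact: cmeasM.
have mgo : measurable_fun setT ((fun w => cabs (gv i k n w (other k))) : genT G K -> R).
  exact: measurable_cabs.
have e40 : 0 <= r / e ^+ 4 by rewrite divr_ge0// exprn_ge0// ltW.
have e30 : 0 <= 4 * rho / e ^+ 3 by rewrite divr_ge0 ?exprn_ge0 ?mulr_ge0// ltW.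
apply: le_trans (strip_le mG indG lawG nx ny xy mm mz0 mkap mgo (fun=> cabs_ge0 _) e40 e30
  (measurable_bad_first P e r rho i k n) _) _ => //.
  move=> w /andP[a0 /andP[b0 /andP[ga /and5P[gb th _ hd hr]]]] g.
  have [h1 h2] := strip_first e0 a0 b0 ga gb th hr.
  by split => //; exact: ball_of_det hd.
(* The strip bound times the second moment: 16 (r/e^4)(4 rho/e^3)(2 m2) is the stated constant. *)
have c0 : 0 <= 16 * (r / e ^+ 4 * (4 * rho / e ^+ 3)) by apply: mulr_ge0 => //; exact: mulr_ge0.
rewrite strip_moment// lee_fin le_eqVlt; apply/orP; left; apply/eqP.
by field; rewrite gt_eqF.
Qed.

Lemma bad_second_le P e r rho i k n : 0 < e -> 0 <= r -> 0 <= rho ->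
  (Pr [set w | bad_second P e r rho i k n w] <= (128 * m2 * (r * rho / e ^+ 7))%:E)%E.
Proof.
move=> e0 r0 rho0.
pose kx : gidx := inr (other i, k, n, ord_max, false).
pose ky : gidx := inr (other i, k, n, ord_max, true).
pose K : set gidx := ~` [set k | k = kx \/ k = ky].
have nx : ~ K kx by apply; left.
have ny : ~ K ky by apply; right.
have xy : kx != ky by apply/eqP => -[].
have mK k' : K k' -> measurable_fun setT (G k' : genT G K -> R).
  by move=> Kk; exact: genT_coord_measurable.
have KH i' k' b : K (inl (i', k', b)) by case.
have KC i' k' : (i', k') != (other i, k) -> forall n' l b, K (inr (i', k', n', l, b)).
  by move=> /eqP ne n' l b [] [] e1 e2 *; apply: ne; rewrite e1 e2.
have ko : other k != k := other_neq k; have io : other i != i := other_neq i.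
have KC1 : forall n' l b, K (inr (i, other k, n', l, b)).
  by apply: KC; apply: contra ko => /eqP[_ ->].
have KC2 : forall n' l b, K (inr (other i, other k, n', l, b)).
  by apply: KC; apply: contra ko => /eqP[->].
have KC3 : forall n' l b, K (inr (i, k, n', l, b)).
  by apply: KC; apply: contra io => /eqP[<-].
have KC4 b : K (inr (other i, k, n, ord0, b)) by case=> [] [].
have mh i' : vmeas (hvec G i' : genT G K -> cvec R) by exact: (vmeas_hvec mK KH).
have mb : cmeas ((fun w => gv (other i) k n w ord0) : genT G K -> R[i]) by exact: (cmeas_gvec mK).
have ma : vmeas (gs P i k : genT G K -> cvec R) by exact: (vmeas_gsel B mK KH).
have mX : cmeas (leak P i (other k) : genT G K -> R[i]).
  apply: cmeasM; first exact/cmeas_conj/mh.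
  apply: vmeas_zfdir; first exact: (vmeas_estimate B mK KH).
  exact: (vmeas_estimate B mK KH).
pose c (w : genT G K) := conjc (phase (leak P i (other k) w)) * conjc (hv i w k) *
  conjc (gs P i k w (other k)) * unitphase (gv (other i) k n w) * osign R k.
have mc : cmeas c.
  apply: cmeasM; last exact: cmeas_cst.
  apply: cmeasM; last exact/cmeas_unitphase.
  apply: cmeasM; last exact/cmeas_conj/ma.
  by apply: cmeasM; [exact/cmeas_conj/cmeas_phase|exact/cmeas_conj/mh].
pose m w := - c w * gs P i k w ord0.
have mm : cmeas m by apply: cmeasM; [exact: cmeasN|exact: ma].
pose z0 (w : genT G K) := gv (other i) k n w ord0 * hv (other i) w ord_max / hv (other i) w ord0.
have mz0 : cmeas z0.
  apply: cmeasM; last exact/cmeasV/mh.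
  by apply: cmeasM => //; exact: mh.
pose kap w := complex.Im (- (c w * gs P i k w ord_max * gv (other i) k n w ord0)).
have mkap : measurable_fun setT kap.
  have [_ //] : cmeas (fun w => - (c w * gs P i k w ord_max * gv (other i) k n w ord0)).
  apply: cmeasN; apply: cmeasM => //.
  by apply: cmeasM => //; exact: ma.
have mgo : measurable_fun setT ((fun w => cabs (gv (other i) k n w ord0)) : genT G K -> R).
  exact: measurable_cabs.
have e40 : 0 <= r / e ^+ 4 by rewrite divr_ge0// exprn_ge0// ltW.
have e30 : 0 <= 4 * rho / e ^+ 3 by rewrite divr_ge0 ?exprn_ge0 ?mulr_ge0// ltW.
apply: le_trans (strip_le mG indG lawG nx ny xy mm mz0 mkap mgo (fun=> cabs_ge0 _) e40 e30
  (measurable_bad_second P e r rho i k n) _) _ => //.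
  move=> w /andP[a0 /andP[b0 /andP[ga /and5P[gb th th' hd hr]]]] g.
  have [h1 h2] := strip_second e0 a0 b0 ga gb th hr.
  by split => //; exact: (ball_of_det (l := ord_max)) hd.
have c0 : 0 <= 16 * (r / e ^+ 4 * (4 * rho / e ^+ 3)) by apply: mulr_ge0 => //; exact: mulr_ge0.
rewrite strip_moment// lee_fin le_eqVlt; apply/orP; left; apply/eqP.
by field; rewrite gt_eqF.
Qed.

Lemma Hgood_tame e i w : Hgood G e w -> tame e (hv i w).
Proof.
by case=> h _; apply/and4P; split; case: (h i ord0) => //; case: (h i ord_max).
Qed.

Lemma localized_balanced i j al e P w : localized G B i j al e P w ->
  balanced (P `^ (- e)) (gs P i j w).
Proof.
case=> g0 h0 hb _; have n0 := vnorm_gt0 g0.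
have h l : P `^ (- e) * vnorm (gs P i j w) <= cabs (gs P i j w l).
  by have := hb l; rewrite estimateE cabs_cword// ler_pdivlMr.
by apply/andP; split; exact: h.
Qed.

Lemma localized_det i j al e P w l : localized G B i j al e P w ->
  cabs (det2 l (gs P i j w) (hv i w)) <=
  2 * P `^ (- (al / 2) + e) * (vnorm (gs P i j w) * vnorm (hv i w)).
Proof.
case=> g0 h0 _ hd; have n0 := vnorm_gt0 g0; have nh := vnorm_gt0 h0.
have := det2_near l (vnorm_cword h0) hd.
rewrite estimateE cabs_det2_cword// -invfM mulrC ler_pdivrMr//.
by rewrite mulr_gt0.
Qed.

(** Exponent count: [al] + e from the number of codewords, -[al] - D + e from r rho, and 7e from the
    channel bounds add up to 9e - D, which is -D/2 for D = 18e. *)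
Lemma whp_union_code (E : R -> nat -> set T) i j (al e D : R) :
  0 < e -> D = 18 * e -> (B i j P)%:R / log2 P @[P --> +oo] --> al ->
  (forall P n, measurable (E P n)) ->
  (forall P n, 0 < P -> (Pr (E P n) <= (128 * m2 *
     (P `^ (- (al / 2) - D) * P `^ (- (al / 2) + e) / (P `^ (- e)) ^+ 7))%:E)%E) ->
  whp Pr (fun P => [set w | forall n, (n < 2 ^ B i j P)%N -> ~ E P n w]).
Proof.
move=> e0 DE hB mE hE; have m20 := gmoment2_ge0 R.
have D20 : 0 < D / 2 by lra.
pose F P := [set w | exists2 n, n \in iota 0 (2 ^ B i j P) & E P n w].
refine (whpW (@whp_power _ _ _ Pr F (128 * m2) (D / 2) D20 _ _) _).
- move=> P; case: (@union_bound _ _ _ Pr _ (iota 0 (2 ^ B i j P)) (E P) 1 (mE P)) => // n _.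
  exact: probability_le1.
- near=> P; have P0 : 0 < P by near: P; exact: nbhs_pinfty_gt.
  have [_] := @union_bound _ _ _ Pr _ (iota 0 (2 ^ B i j P)) (E P) _ (mE P) (fun n _ => hE P n P0).
  move=> h; apply: le_trans h _; rewrite lee_fin size_iota.
  have /andP[_ hN] : P `^ (al - e) <= (2 ^ B i j P)%:R <= P `^ (al + e).
    by near: P; exact: near_bits.
  have -> : P `^ (- (al / 2) - D) * P `^ (- (al / 2) + e) / (P `^ (- e)) ^+ 7 =
      P `^ (- al - D + 8 * e).
    rewrite -powR_mulrn ?powR_ge0// -powRrM -powRN -!powR_add//; congr (_ `^ _).
    by field.
  have -> : P `^ (- (D / 2)) = P `^ (al + e) * P `^ (- al - D + 8 * e).
    by rewrite -powR_add//; congr (_ `^ _); rewrite DE; field.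
  rewrite mulrCA ler_wpM2l ?mulr_ge0//.
  by rewrite ler_wpM2r ?powR_ge0.
- near=> P => w nF n nN En; apply: nF; exists n => //.
  by rewrite mem_iota add0n.
Unshelve. all: by end_near. Qed.

(** Bad codewords of the chosen codebook are excluded simultaneously, in particular the selected
    one; [bad_first] serves the codebook for the receiver's own channel, [bad_second] the other. *)
Lemma whp_interference_ge i i' k (al : 'I_2 -> 'I_2 -> R) (D : R) : 0 < D ->
  (forall i j, 0 <= al i j) ->
  (forall i j, (B i j P)%:R / log2 P @[P --> +oo] --> al i j) ->
  whp Pr (fun P => [set w | P `^ (- (al i' k / 2) - D) <=
    cabs (dotH (hv i w) (zfbeam G B P (other i) w))]).
Proof.
move=> D0 al0 hB; pose e := D / 18.
have e0 : 0 < e by rewrite divr_gt0.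
have DE : D = 18 * e by rewrite /e; field.
pose r P := P `^ (- (al i' k / 2) - D); pose rho P := P `^ (- (al i' k / 2) + e).
have hloc i0 := whp_localized mG indG lawG (al0 i0 k) e0 (hB i0 k).
have hH := whp_Hgood mG indG lawG e0.
have sN P i0 w : (selidx G B P i0 k w < 2 ^ B i0 k P)%N.
  by apply: best_index_lt; rewrite expn_gt0.
have [ii|ii] : i' = i \/ i' = other i.
  by case: (ord2P i) => ->; case: (ord2P i') => ->; [left|right|right|left].
- pose E P n := [set w | bad_first P (P `^ (- e)) (r P) (rho P) i k n w].
  have hE := @whp_union_code E i k (al i k) e D e0 DE (hB i k).
  refine (whpW (whpI (whpI hH (whpI (hloc i) (hloc (other i)))) (hE _ _)) _).
  + by move=> P n; exact: measurable_bad_first.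
  + move=> P n P0; rewrite /E /r /rho ii; apply: bad_first_le; rewrite ?powR_ge0//.
    by rewrite powR_gt0.
  near=> P => w [[hHw [l1 l2]] hnE].
  rewrite /mkset leNgt; apply/negP => hlt; apply: (hnE _ (sN P i w)).
  have th := Hgood_tame i hHw.
  apply/andP; split; first by case: l1.
  apply/andP; split; first by case: l2.
  apply/andP; split; first exact: localized_balanced l1.
  apply/and5P; split => //; first exact: localized_balanced l2.
    by rewrite /rho ii; exact: localized_det l1.
  by move: hlt; rewrite (dotH_leak P i k w) => /ltW.
- pose E P n := [set w | bad_second P (P `^ (- e)) (r P) (rho P) i k n w].
  have hE := @whp_union_code E (other i) k (al (other i) k) e D e0 DE (hB _ k).
  refine (whpW (whpI (whpI hH (whpI (hloc i) (hloc (other i)))) (hE _ _)) _).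
  + by move=> P n; exact: measurable_bad_second.
  + move=> P n P0; rewrite /E /r /rho ii; apply: bad_second_le; rewrite ?powR_ge0//.
    by rewrite powR_gt0.
  near=> P => w [[hHw [l1 l2]] hnE].
  rewrite /mkset leNgt; apply/negP => hlt; apply: (hnE _ (sN P (other i) w)).
  have th i0 := Hgood_tame i0 hHw.
  apply/andP; split; first by case: l1.
  apply/andP; split; first by case: l2.
  apply/andP; split; first exact: localized_balanced l1.
  apply/and5P; split => //; first exact: localized_balanced l2.
    by rewrite /rho ii; exact: localized_det l2.
  by move: hlt; rewrite (dotH_leak P i k w) => /ltW.
Unshelve. all: by end_near. Qed.

End InterferenceLowerBound.

(** * The rates *)

Lemma cabs_near_ge (R : realType) (x y : R[i]) (b e : R) :
  cabs x = b -> cabs (y - x) <= e -> b - e <= cabs y.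
Proof. by rewrite cabs_distC => <-; have := cabs_ler_dist x y; lra. Qed.

Lemma cabs_dotH_le (R : realType) (h t : cvec R) : (forall k, cabs (t k) <= 1) ->
  cabs (dotH h t) <= cabs (h ord0) + cabs (h ord_max).
Proof.
move=> ht; rewrite /dotH (big_ord2 _ ord0) other0; apply: le_trans (cabsD _ _) _.
by rewrite !cabsM !cabs_conj; apply: lerD; rewrite ler_piMr ?cabs_ge0.
Qed.

Lemma half_sqr_le (R : realType) (P x y : R) : 0 <= P -> 0 <= x -> x <= y ->
  P / 2 * x ^+ 2 <= P / 2 * y ^+ 2.
Proof.
move=> P0 x0 xy; rewrite ler_wpM2l ?divr_ge0//.
by rewrite ler_sqr ?nnegrE// (le_trans x0 xy).
Qed.

Section RateBounds.
Context (R : realType) (d : measure_display) (T : measurableType d).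
Context (Pr : probability T R) (G : gidx -> T -> R).
Context (B : 'I_2 -> 'I_2 -> R -> nat) (al : 'I_2 -> 'I_2 -> R).
Hypothesis mG : forall k, measurable_fun setT (G k).
Hypothesis indG : mutually_independent Pr G.
Hypothesis lawG : forall k (A : set R), measurable A ->
  Pr (G k @^-1` A) = normal_prob 0 (Num.sqrt (2^-1)) A.
Hypothesis al0 : forall i j, 0 <= al i j.
Hypothesis hB : forall i j, (B i j P)%:R / log2 P @[P --> +oo] --> al i j.
Notation hv := (hvec G).
Notation est := (estimate G B).
Notation zfb := (zfbeam G B).
Notation m2 := (gmoment2 R).

Lemma cabs_dotH_cword (h t : cvec R) : h ord0 != 0 ->
  cabs (dotH h t) = vnorm h * cabs (dotH (cword h) t).
Proof.
move=> h0; have nh := vnorm_gt0 h0.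
have -> : dotH (cword h) t =
    conjc (conjc (h ord0) / ocplx (cabs (h ord0) * vnorm h)) * dotH h t.
  by rewrite /dotH !(big_ord2 _ ord0) !(cwordE _ h0) !conjcM; ring.
by rewrite cabsM cabs_conj cword_coef_abs// mulrA divff ?mul1r// gt_eqF.
Qed.

(** With every estimate within P^(-am/2 + e), the beams are close to those of perfect knowledge,
    whose interference vanishes and whose signal is the channel determinant. *)
Lemma whp_zf_upper i (am D : R) : 0 < am -> 0 < D -> (forall i j, am <= al i j) ->
  whp Pr (fun P => [set w | cabs (dotH (hv i w) (zfb P (other i) w)) <= P `^ (- (am / 2) + D) /\
     P `^ (- D) <= cabs (dotH (hv i w) (zfb P i w))]).
Proof.
move=> am0 D0 ham.
(* The interference loses 5e and the signal 4e, both below [D]; the signal also needs the beam error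
   P^(-am/2 + 4e) negligible against the determinant P^(-3e), that is 7e < am/2. *)
pose e := Num.min (D / 8) (am / 16).
have e0 : 0 < e by rewrite lt_min; apply/andP; split; lra.
have eD : e <= D / 8 by rewrite ge_min lexx.
have ea : e <= am / 16 by rewrite ge_min lexx orbT.
have hloc (p : 'I_2 * 'I_2) := whp_localized mG indG lawG (al0 p.1 p.2) e0 (@hB p.1 p.2).
refine (whpW (whpI (whp_Hgood mG indG lawG e0) (whp_fin hloc)) _).
near=> P => w [hH hl].
have P1 : 1 < P by near: P; exact: nbhs_pinfty_gt.
have P0 : 0 < P by rewrite (lt_trans _ P1).
set rho := P `^ (- (am / 2) + e).
have rho0 : 0 < rho by rewrite powR_gt0.
have near_h i' j l : cabs (est P i' j w l - cword (hv i' w) l) <= rho.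
  have [_ _ _ h] := hl (i', j); apply: le_trans (h l) _; apply: powR_exp_le; first exact: ltW.
  by have /= := ham i' j; lra.
have h0 i' : hv i' w ord0 != 0 by have [_ h _ _] := hl (i', ord0).
have nest i' j : vnorm (est P i' j w) = 1.
  by have [h _ _ _] := hl (i', j); exact: vnorm_cword.
have nh i' : vnorm (cword (hv i' w)) = 1 by exact: vnorm_cword.
set Q := P `^ (- e).
have Q0 : 0 < Q by rewrite powR_gt0.
have th i' : tame Q (hv i' w) by exact: Hgood_tame.
have hn i' : vnorm (hv i' w) <= 2 / Q by exact: tame_vnorm.
have hn' i' : Q <= vnorm (hv i' w) by apply: le_trans (tame_ge ord0 (th i')) (cabs_le_vnorm _ _).
set D1 := cabs (det2 ord0 (cword (hv i w)) (cword (hv (other i) w))).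
have hD1 : Q ^+ 3 / 4 <= D1.
  rewrite /D1 cabs_det2_cword// -invfM [leRHS]mulrC ler_pdivlMr; last first.
    by rewrite mulr_gt0// (lt_le_trans Q0).
  have [_ hd] := hH; apply: le_trans (hd i).
  have : vnorm (hv i w) * vnorm (hv (other i) w) <= (2 / Q) * (2 / Q).
    by apply: ler_pM; rewrite ?vnorm_ge0.
  move=> /(ler_wpM2l (_ : 0 <= Q ^+ 3 / 4)); rewrite divr_ge0 ?exprn_ge0 ?(ltW Q0)// => /(_ isT).
  by rewrite [X in _ <= X](_ : _ = Q)//; field; rewrite gt_eqF.
have D10 : 0 < D1 by rewrite (lt_le_trans _ hD1)// divr_gt0// exprn_gt0.
have D1e : D1 = cabs (det2 ord0 (cword (hv (other i) w)) (cword (hv i w))).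
  by rewrite /D1 det2C cabsN.
have bound : 9 * rho / D1 <= 36 * rho / Q ^+ 3.
  rewrite ler_pdivrMr//; apply: le_trans (ler_wpM2l _ hD1).
    by rewrite [X in _ <= X](_ : _ = 9 * rho)//; field; rewrite gt_eqF.
  by rewrite divr_ge0 ?mulr_ge0 ?exprn_ge0// ltW.
have d1 k : cabs (zfb P (other i) w k - zfdir (cword (hv i w)) (cword (hv (other i) w)) k) <=
    36 * rho / Q ^+ 3.
  apply: le_trans bound; rewrite /zfbeam otherK.
  by apply: zfdir_dist => //; rewrite ?(ltW rho0)// -cabs_gt0.
have d2 k : cabs (zfb P i w k - zfdir (cword (hv (other i) w)) (cword (hv i w)) k) <=
    36 * rho / Q ^+ 3.
  apply: le_trans bound; rewrite /zfbeam D1e.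
  by apply: zfdir_dist => //; rewrite ?(ltW rho0)// -cabs_gt0 -D1e.
have f1 := dotH_le (nh i) d1; have f2 := dotH_le (nh i) d2.
rewrite (dotH_zfdir_self (cword (hv (other i) w)) (nh i)) subr0 in f1.
have Q3 : rho / Q ^+ 3 = P `^ (- (am / 2) + 4 * e).
  rewrite /Q -powR_mulrn ?powR_ge0// -powRrM -powRN -powR_add//; congr (_ `^ _); ring.
split.
  rewrite cabs_dotH_cword//.
  apply: (@le_trans _ _ (2 / Q * (2 * (36 * rho / Q ^+ 3)))).
    by apply: ler_pM; rewrite ?vnorm_ge0 ?cabs_ge0.
  have -> : 2 / Q * (2 * (36 * rho / Q ^+ 3)) = 144 * P `^ (- (am / 2) + 5 * e).
    have -> : P `^ (- (am / 2) + 5 * e) = rho / Q ^+ 3 / Q.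
      by rewrite Q3 /Q -powRN -powR_add//; congr (_ `^ _); ring.
    by field; rewrite gt_eqF.
  by near: P; apply: near_powR_cmp; lra.
have f3 : D1 - 2 * (36 * rho / Q ^+ 3) <= cabs (dotH (cword (hv i w)) (zfb P i w)).
  exact: cabs_near_ge (cabs_dotH_zfdir (cword (hv i w)) (nh (other i))) f2.
have f4 : 576 * P `^ (- (am / 2) + 4 * e) <= P `^ (- (3 * e)).
  by near: P; apply: near_powR_cmp; lra.
have Q3' : Q ^+ 3 = P `^ (- (3 * e)).
  by rewrite /Q -powR_mulrn ?powR_ge0// -powRrM; congr (_ `^ _); ring.
rewrite cabs_dotH_cword//.
apply: (@le_trans _ _ (Q * (Q ^+ 3 / 8))); last first.
  apply: ler_pM; rewrite ?(ltW Q0) ?divr_ge0 ?exprn_ge0 ?(ltW Q0)//.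
  by apply: le_trans f3; rewrite -(mulrA 36) Q3; lra.
have -> : Q * (Q ^+ 3 / 8) = P `^ (- (4 * e)) / 8.
  by rewrite mulrA -exprS /Q -powR_mulrn ?powR_ge0// -powRrM; congr (_ `^ _ / _); ring.
rewrite ler_pdivlMr// mulrC.
by near: P; apply: near_powR_cmp; lra.
Unshelve. all: by end_near. Qed.

Definition Sig P i w := P / 2 * cabs (dotH (hv i w) (zfb P i w)) ^+ 2.
Definition Itf P i w := P / 2 * cabs (dotH (hv i w) (zfb P (other i) w)) ^+ 2.

Lemma rate_integrandE P i w : 0 <= P ->
  rate_integrand G B P i w = log2 (1 + Sig P i w / (1 + Itf P i w)).
Proof.
move=> P0; rewrite /rate_integrand !teffE.
have e (t : cvec R) : abs2 (dotH (hv i w) (scalev (ocplx (Num.sqrt (P / 2))) t)) =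
   P / 2 * cabs (dotH (hv i w) t) ^+ 2.
  have -> : dotH (hv i w) (scalev (ocplx (Num.sqrt (P / 2))) t) =
     ocplx (Num.sqrt (P / 2)) * dotH (hv i w) t.
    by rewrite /dotH !(big_ord2 _ ord0) /scalev; ring.
  rewrite abs2M sqr_cabs; congr (_ * _).
  by rewrite -sqr_cabs cabs_ocplx ger0_norm ?sqrtr_ge0// sqr_sqrtr// divr_ge0.
by congr (log2 (1 + _ / (1 + _))); [exact: (e (zfb P i w))|exact: (e (zfb P (other i) w))].
Qed.

Lemma Sig_ge0 P i w : 0 <= P -> 0 <= Sig P i w.
Proof. by move=> P0; rewrite mulr_ge0 ?sqr_ge0// divr_ge0. Qed.

Lemma Itf_ge0 P i w : 0 <= P -> 0 <= Itf P i w.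
Proof. by move=> P0; rewrite mulr_ge0 ?sqr_ge0// divr_ge0. Qed.

Lemma rate_integrand_ge0 P i w : 0 <= P -> 0 <= rate_integrand G B P i w.
Proof.
move=> P0; rewrite (rate_integrandE i w P0).
move: (Sig_ge0 i w P0) (Itf_ge0 i w P0); move: (Sig P i w) (Itf P i w) => S I S0 I0.
by rewrite divr_ge0 ?ln_ge0 ?ler1n// lerDl divr_ge0// addr_ge0.
Qed.

Definition hpow i w := cabs (hv i w ord0) ^+ 2 + cabs (hv i w ord_max) ^+ 2.

(** The effective beam mixes entries of two different unit vectors, so only its entries are bounded
    by 1; then (x + y)^2 <= 2(x^2 + y^2) cancels the factor 1/2 of the power. *)
Lemma Sig_le P i w : 0 <= P -> Sig P i w <= P * hpow i w.
Proof.
move=> P0.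
have h : cabs (dotH (hv i w) (zfb P i w)) <= cabs (hv i w ord0) + cabs (hv i w ord_max).
  by apply: cabs_dotH_le => k; exact: cabs_normalize_le1.
set x := cabs (hv i w ord0) in h *; set y := cabs (hv i w ord_max) in h *.
have x0 : 0 <= x by exact: cabs_ge0.
have y0 : 0 <= y by exact: cabs_ge0.
have h2 : cabs (dotH (hv i w) (zfb P i w)) ^+ 2 <= (x + y) ^+ 2.
  by rewrite ler_sqr ?nnegrE ?cabs_ge0// addr_ge0.
rewrite /Sig /hpow -/x -/y -mulrA ler_wpM2l// ler_pdivrMl//.
by apply: le_trans h2 _; have := sqr_ge0 (x - y); nra.
Qed.

Lemma whp_rate_le i i' k (D : R) : 0 < D ->
  whp Pr (fun P => [set w | rate_integrand G B P i w <= (al i' k + D) * log2 P]).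
Proof.
move=> D0; pose e := D / 8; have e0 : 0 < e by rewrite divr_gt0.
have hint := whp_interference_ge mG indG lawG i i' k e0 al0 (@hB).
move: (al0 i' k) hint; move: (al i' k) => a a0 hint.
have ex1 : 0 <= a + 4 * e by lra.
have ex2 : a + 4 * e < a + D by rewrite /e; lra.
refine (whpW (whpI (whp_Hgood mG indG lawG e0) hint) _).
near=> P => w [hH hI].
have P1 : 1 < P by near: P; exact: nbhs_pinfty_gt.
have P0 : 0 < P by rewrite (lt_trans _ P1).
have pe (x y : R) : P `^ x * P `^ y = P `^ (x + y) by rewrite powR_add.
have p1 : P `^ 1 = P by rewrite powRr1// ltW.
have hS : Sig P i w <= 2 * P `^ (1 + 2 * e).
  apply: le_trans (Sig_le i w (ltW P0)) _.
  have [hh _] := hH.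
  have hq k' : cabs (hv i w k') ^+ 2 <= P `^ (2 * e).
    have [_ h] := hh i k'; rewrite powRN invrK in h.
    apply: (@le_trans _ _ (P `^ e ^+ 2)); first by rewrite ler_sqr ?nnegrE ?cabs_ge0 ?powR_ge0.
    by rewrite expr2 pe (_ : e + e = 2 * e)//; ring.
  rewrite -pe p1 mulrCA ler_wpM2l ?(ltW P0)//.
  by have := hq ord0; have := hq ord_max; rewrite /hpow; lra.
have hI' : P `^ (1 - a - 2 * e) / 2 <= Itf P i w.
  have -> : P `^ (1 - a - 2 * e) / 2 = P / 2 * P `^ (- (a / 2) - e) ^+ 2.
    rewrite (_ : 1 - a - 2 * e = 1 + ((- (a / 2) - e) + (- (a / 2) - e))); last by field.
    by rewrite -!pe p1; ring.
  exact: (half_sqr_le (ltW P0) (powR_ge0 _ _) hI).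
have h5 : 5 * P `^ (a + 4 * e) <= P `^ (a + D) by near: P; exact: near_powR_cmp.
have q0 : 0 < P `^ (1 - a - 2 * e) by rewrite powR_gt0.
(* Absorbs the summand 1 inside the logarithm, turning the ratio bound 4 P^(a + 4e) into 5 P^(a +
   4e). *)
have h1 : 1 <= P `^ (a + 4 * e).
  by rewrite -[leLHS](powRr0 P); apply: powR_exp_le; [exact: ltW|].
have e1 : P `^ (1 + 2 * e) = P `^ (a + 4 * e) * P `^ (1 - a - 2 * e).
  by rewrite pe; congr (_ `^ _); ring.
rewrite /mkset (rate_integrandE i w (ltW P0)) -log2_powR.
move: (Sig_ge0 i w (ltW P0)) (Itf_ge0 i w (ltW P0)) hS hI'.
move: (Sig P i w) (Itf P i w) => S I S0 I0 hS hI'; clear hH hI.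
have I1 : 0 < 1 + I by lra.
have SI : 0 <= S / (1 + I) by rewrite divr_ge0// ltW.
apply: log2_le; first by lra.
have hr : S / (1 + I) <= 4 * P `^ (a + 4 * e).
  rewrite ler_pdivrMr//; apply: le_trans hS _; rewrite e1.
  have h3 : P `^ (1 - a - 2 * e) <= 2 * (1 + I) by lra.
  have := ler_wpM2l (powR_ge0 P (a + 4 * e)) h3; lra.
by lra.
Unshelve. all: by end_near. Qed.

Lemma whp_rate_ge i (am D : R) : 0 <= am -> am <= 1 -> 0 < D -> (forall i j, am <= al i j) ->
  whp Pr (fun P => [set w | (am - D) * log2 P <= rate_integrand G B P i w]).
Proof.
rewrite le_eqVlt => /orP[/eqP <-|am0] am1 D0 ham.
  (* For [am] = 0 the left side is nonpositive, and the rate is nonnegative. *)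
  apply: whp_near; near=> P; apply/seteqP; split => // w _.
  have P1 : 1 < P by near: P; exact: nbhs_pinfty_gt.
  have P0 : 0 < P by rewrite (lt_trans _ P1).
  apply: le_trans (rate_integrand_ge0 i w (ltW P0)).
  have : 0 <= log2 P by near: P; exact: near_log2_ge.
  by rewrite sub0r mulNr oppr_le0 => h; rewrite mulr_ge0// ltW.
pose e := D / 8; have e0 : 0 < e by rewrite divr_gt0.
have ex1 : 0 <= 1 - am + 2 * e by lra.
have ex2 : am - D < am - 4 * e by rewrite /e; lra.
refine (whpW (whp_zf_upper i am0 e0 ham) _).
near=> P => w [hI hS].
have P1 : 1 < P by near: P; exact: nbhs_pinfty_gt.
have P0 : 0 < P by rewrite (lt_trans _ P1).
have pe (x y : R) : P `^ x * P `^ y = P `^ (x + y) by rewrite powR_add.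
have p1 : P `^ 1 = P by rewrite powRr1// ltW.
have hS' : P `^ (1 - 2 * e) / 2 <= Sig P i w.
  have -> : P `^ (1 - 2 * e) / 2 = P / 2 * P `^ (- e) ^+ 2.
    rewrite (_ : 1 - 2 * e = 1 + (- e + - e)); last by ring.
    by rewrite -!pe p1; ring.
  exact: (half_sqr_le (ltW P0) (powR_ge0 _ _) hS).
have hI' : Itf P i w <= P `^ (1 - am + 2 * e) / 2.
  have -> : P `^ (1 - am + 2 * e) / 2 = P / 2 * P `^ (- (am / 2) + e) ^+ 2.
    rewrite (_ : 1 - am + 2 * e = 1 + ((- (am / 2) + e) + (- (am / 2) + e))); last by field.
    by rewrite -!pe p1; ring.
  exact: (half_sqr_le (ltW P0) (cabs_ge0 _) hI).
(* Here [am <= 1] enters: the noise power 1 stays below the interference bound, so 1 + I keeps the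
   exponent 1 - am + 2e. *)
have h1 : 1 <= P `^ (1 - am + 2 * e).
  by rewrite -[leLHS](powRr0 P); apply: powR_exp_le; [exact: ltW|].
have h4 : 4 * P `^ (am - D) <= P `^ (am - 4 * e).
  by near: P; exact: near_powR_cmp.
have e1 : P `^ (1 - 2 * e) = P `^ (am - 4 * e) * P `^ (1 - am + 2 * e).
  by rewrite pe; congr (_ `^ _); ring.
rewrite /mkset (rate_integrandE i w (ltW P0)) -log2_powR.
move: (Sig_ge0 i w (ltW P0)) (Itf_ge0 i w (ltW P0)) hS' hI'.
move: (Sig P i w) (Itf P i w) => S I S0 I0 hS' hI'; clear hS hI.
have I1 : 0 < 1 + I by lra.
apply: log2_le; first by rewrite powR_gt0.
apply: (@le_trans _ _ (S / (1 + I))); last by rewrite lerDr.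
rewrite ler_pdivlMr//; apply: le_trans hS'; rewrite e1.
have h2 : 1 + I <= 2 * P `^ (1 - am + 2 * e) by lra.
have g1 := ler_wpM2l (powR_ge0 P (am - D)) h2.
have g2 := ler_wpM2r (powR_ge0 P (1 - am + 2 * e)) h4.
by lra.
Unshelve. all: by end_near. Qed.

(** The signal is at most P times the channel power q, so the argument is at most P(1 + q), and ln
    (1 + q) <= q. This dominates the rate on the exceptional event. *)
Lemma rate_integrand_le P i w : 1 <= P ->
  rate_integrand G B P i w <= log2 P + hpow i w / ln 2.
Proof.
move=> P1; have P0 : 0 < P by rewrite (lt_le_trans _ P1).
have h0 : 0 <= hpow i w by rewrite addr_ge0 ?sqr_ge0.
rewrite (rate_integrandE i w (ltW P0)).
move: (Sig_ge0 i w (ltW P0)) (Itf_ge0 i w (ltW P0)) (Sig_le i w (ltW P0)) h0.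
move: (Sig P i w) (Itf P i w) (hpow i w) => S I q S0 I0 Sq q0.
have I1 : 0 < 1 + I by lra.
have SI : 0 <= S / (1 + I) by rewrite divr_ge0// ltW.
have q1 : 0 < 1 + q by lra.
have l2 : 0 < ln (2 : R) by rewrite ln_gt0// ltr1n.
rewrite /log2 -mulrDl ler_pM2r ?invr_gt0//.
apply: (@le_trans _ _ (ln (P * (1 + q)))).
  rewrite ler_ln ?posrE; [|by lra|by rewrite mulr_gt0].
  rewrite mulrDr mulr1 lerD//; apply: le_trans Sq.
  by rewrite ler_pdivrMr// ler_peMr// lerDl.
rewrite lnM ?posrE// lerD2l -{2}(expRK q) ler_ln ?posrE ?expR_gt0//.
exact: expR_ge1Dx.
Qed.

Lemma integral_hpow i : (\int[Pr]_w (hpow i w)%:E = (4 * m2)%:E)%E.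
Proof.
have e k : (\int[Pr]_w (cabs (hv i w k) ^+ 2)%:E = (2 * m2)%:E)%E.
  under eq_integral do rewrite cabs_conj sqr_cabs /abs2 /= EFinD.
  rewrite ge0_integralD//; last 4 first.
  - by move=> w _; rewrite lee_fin sqr_ge0.
  - by apply/measurable_EFinP; exact: measurable_funX.
  - by move=> w _; rewrite lee_fin sqr_ge0.
  - by apply/measurable_EFinP; exact: measurable_funX.
  by rewrite !(gmoment2E mG lawG) -EFinD; congr EFin; ring.
have mh k : measurable_fun setT (fun w => (cabs (hv i w k) ^+ 2)%:E).
  apply/measurable_EFinP; apply: measurable_funX; apply: measurable_cabs.
  exact: (cmeas_hvec (K := setT)).
under eq_integral do rewrite /hpow EFinD.
rewrite ge0_integralD//; last 2 first.
- by move=> w _; rewrite lee_fin sqr_ge0.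
- by move=> w _; rewrite lee_fin sqr_ge0.
by rewrite !e -EFinD; congr EFin; ring.
Qed.

End RateBounds.

(** * From high probability events to expected rates *)

Section MultiplexingGain.
Context (R : realType) (d : measure_display) (T : measurableType d).
Context (Pr : probability T R) (G : gidx -> T -> R).
Context (B : 'I_2 -> 'I_2 -> R -> nat) (al : 'I_2 -> 'I_2 -> R).
Hypothesis mG : forall k, measurable_fun setT (G k).
Hypothesis indG : mutually_independent Pr G.
Hypothesis lawG : forall k (A : set R), measurable A ->
  Pr (G k @^-1` A) = normal_prob 0 (Num.sqrt (2^-1)) A.
Hypothesis al01 : forall i j, 0 <= al i j <= 1.
Hypothesis hB : forall i j, (B i j P)%:R / log2 P @[P --> +oo] --> al i j.
Notation m2 := (gmoment2 R).

Let al0 i j : 0 <= al i j. Proof. by case/andP: (al01 i j). Qed.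

(** The exceptional event contributes at most its probability times log2 P plus the mean channel
    power over ln 2, which is constant and thus negligible against log2 P. Each of the three losses
    is at most [e] log2 P. *)
Lemma rate_near_le i i' k (eps : R) : 0 < eps -> \forall P \near +oo,
  (rate G B Pr P i <= ((al i' k + eps) * log2 P)%:E)%E.
Proof.
move=> eps0; pose e := eps / 4; have e0 : 0 < e by rewrite divr_gt0.
have l2 : 0 < ln (2 : R) by rewrite ln_gt0// ltr1n.
have m20 := gmoment2_ge0 R.
have hw := whp_rate_le mG indG lawG al0 (@hB) i i' k e0.
near=> P.
have P1 : 1 <= P by near: P; exact: near_ge.
have [N [mN PN hN]] : exists N : set T, [/\ measurable N, (Pr N <= e%:E)%E &
    ~` N `<=` [set w | rate_integrand G B P i w <= (al i' k + e) * log2 P]].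
  by near: P; exact: hw.
have lP : 0 <= log2 P by near: P; exact: near_log2_ge.
have lc : 4 * m2 / ln 2 / e <= log2 P by near: P; exact: near_log2_ge.
have P0 : 0 <= P by rewrite (le_trans _ P1).
have a0 : 0 <= (al i' k + e) * log2 P by rewrite mulr_ge0// addr_ge0// ltW.
have h0 w : 0 <= hpow G i w by rewrite addr_ge0 ?sqr_ge0.
have mh : measurable_fun setT (hpow G i).
  by apply: measurable_funD; apply: measurable_funX; apply: measurable_cabs;
    exact: (cmeas_hvec (K := setT)).
apply: (@le_trans _ _ (\int[Pr]_w (((al i' k + e) * log2 P)%:E +
   ((log2 P)%:E * (\1_N w)%:E + (ln 2)^-1%:E * (hpow G i w)%:E)))%E).
  apply: ge0_le_integral_nomeas => w; first by rewrite lee_fin rate_integrand_ge0.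
  rewrite -!EFinM -!EFinD lee_fin indicE.
  have q0 : 0 <= (ln 2)^-1 * hpow G i w by rewrite mulr_ge0// invr_ge0 ltW.
  case: (boolP (w \in N)) => wN.
    apply: le_trans (rate_integrand_le G B i w P1) _.
    by rewrite [hpow _ _ _ / _]mulrC mulr1; lra.
  have /hN : (~` N) w by move=> Nw; move/negP: wN; apply; rewrite inE.
  by move=> h; apply: le_trans h _; rewrite mulr0 add0r lerDl.
have mN1 : measurable_fun setT (fun w => ((log2 P)%:E * (\1_N w)%:E)%E).
  by apply: emeasurable_funM => //; apply/measurable_EFinP; exact: measurable_indic.
have mh1 : measurable_fun setT (fun w => ((ln 2)^-1%:E * (hpow G i w)%:E)%E).
  by apply: emeasurable_funM => //; apply/measurable_EFinP.
have l2i : 0 <= (ln (2 : R))^-1 by rewrite invr_ge0 ltW.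
rewrite ge0_integralD//; last 2 first.
- by move=> w _; rewrite adde_ge0// mule_ge0// lee_fin.
- exact: emeasurable_funD.
rewrite ge0_integralD//; last 2 first.
- by move=> w _; rewrite mule_ge0// lee_fin.
- by move=> w _; rewrite mule_ge0// lee_fin.
rewrite integral_cst//= probability_setT mule1.
rewrite ge0_integralZl//; last by apply/measurable_EFinP; exact: measurable_indic.
rewrite integral_indic// setIT ge0_integralZl//; last 2 first.
- exact/measurable_EFinP.
- by move=> w _; rewrite lee_fin.
rewrite (integral_hpow mG lawG i).
apply: (@le_trans _ _ (((al i' k + e) * log2 P)%:E + ((log2 P)%:E * e%:E + (ln 2)^-1%:E * (4 * m2)%:E))%E).
  by rewrite leeD2l// leeD2r// lee_wpmul2l// lee_fin.
rewrite -!EFinM -!EFinD lee_fin.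
have h : (ln 2)^-1 * (4 * m2) <= e * log2 P.
  by move: lc; rewrite ler_pdivrMr// mulrC [_ * e]mulrC.
have -> : (al i' k + eps) * log2 P = (al i' k + e) * log2 P + 3 * (e * log2 P).
  by rewrite /e; field.
have := mulr_ge0 (ltW e0) lP; lra.
Unshelve. all: by end_near. Qed.

Lemma rate_near_ge i (am eps : R) : 0 <= am -> am <= 1 -> (forall i j, am <= al i j) ->
  0 < eps -> \forall P \near +oo, (((am - eps) * log2 P)%:E <= rate G B Pr P i)%E.
Proof.
move=> am0 am1 ham eps0; pose e := eps / 2; have e0 : 0 < e by rewrite divr_gt0.
have hw := whp_rate_ge mG indG lawG al0 (@hB) i am0 am1 e0 ham.
near=> P.
have P0 : 0 <= P by near: P; exact: near_ge.
have lP : 0 <= log2 P by near: P; exact: near_log2_ge.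
have [N [mN PN hN]] : exists N : set T, [/\ measurable N, (Pr N <= e%:E)%E &
    ~` N `<=` [set w | (am - e) * log2 P <= rate_integrand G B P i w]].
  by near: P; exact: hw.
(* Dropping the exceptional event multiplies the bound by a probability, which requires [am - e] to
   be nonnegative; otherwise the claim is below 0. *)
have [ame|ame] := leP am e.
  apply: (@le_trans _ _ 0%E); last by apply: integral_ge0 => w _; rewrite lee_fin rate_integrand_ge0.
  by rewrite lee_fin mulr_le0_ge0//; rewrite /e in ame; lra.
have c0 : 0 <= (am - e) * log2 P by rewrite mulr_ge0// subr_ge0 ltW.
have mCN := measurableC mN.
apply: (@le_trans _ _ (\int[Pr]_w (((am - e) * log2 P)%:E * (\1_(~` N) w)%:E))%E); last first.
  apply: ge0_le_integral_nomeas => w; first by rewrite mule_ge0// lee_fin.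
  rewrite -EFinM lee_fin indicE; case: (boolP (w \in ~` N)) => wN; last first.
    by rewrite mulr0 rate_integrand_ge0.
  by rewrite mulr1; apply: hN; rewrite inE in wN.
rewrite ge0_integralZl//; last by apply/measurable_EFinP; exact: measurable_indic.
rewrite integral_indic// setIT.
rewrite [X in (_ * X)%E](_ : _ = (1 - Pr N)%E); last exact: probability_setC.
have fN : Pr N \is a fin_num by exact: fin_num_measure.
move: PN fN; move: (Pr N) => [p| |] //; rewrite lee_fin => pe _.
rewrite -EFinB -EFinM lee_fin.
have h1 : 1 - e <= 1 - p by lra.
apply: le_trans (ler_wpM2l c0 h1).
have -> : (am - e) * log2 P * (1 - e) = (am - eps) * log2 P + (e * log2 P) * (1 - am + e).
  by rewrite /e; field.
rewrite lerDl; apply: mulr_ge0; first exact: (mulr_ge0 (ltW e0) lP).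
by lra.
Unshelve. all: by end_near. Qed.

(** The upper bound holds with any single scaling, whichever receiver is considered, and the lower
    bound with any common lower bound of the scalings; at the minimum they meet. *)
Lemma rate_cvg i (am : R) i' k : am = al i' k -> (forall i j, am <= al i j) ->
  (rate G B Pr P i * ((log2 P)^-1)%:E)%E @[P --> +oo] --> am%:E.
Proof.
move=> amE ham; have /andP[am0 am1] : 0 <= am <= 1 by rewrite amE.
have H (eps : R) : 0 < eps -> \forall P \near +oo, exists2 v : R,
    (rate G B Pr P i * ((log2 P)^-1)%:E)%E = v%:E & `|am - v| <= eps.
  move=> eps0; near=> P.
  have h1 : (rate G B Pr P i <= ((am + eps) * log2 P)%:E)%E.
    by rewrite amE; near: P; exact: rate_near_le.
  have h2 : (((am - eps) * log2 P)%:E <= rate G B Pr P i)%E.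
    by near: P; exact: rate_near_ge.
  have lP : 1 <= log2 P by near: P; exact: near_log2_ge.
  move: h1 h2; move: (rate G B Pr P i) => [x| |] //; rewrite !lee_fin => h1 h2.
  have lP0 : 0 < log2 P by rewrite (lt_le_trans _ lP).
  exists (x / log2 P) => //.
  rewrite -ler_pdivrMr// in h1; rewrite -ler_pdivlMr// in h2.
  by rewrite ler_norml; apply/andP; split; lra.
apply/fine_cvgP; split.
  by apply: filterS (H 1 ltr01) => P [v -> _].
apply/cvgrPdist_le => eps eps0; apply: filterS (H eps eps0) => P [v /= -> //].
Unshelve. all: by end_near. Qed.

End MultiplexingGain.

Theorem theorem1 (R : realType) (d : measure_display) (T : measurableType d)
  (Pr : probability T R) (G : gidx -> T -> R)
  (B : 'I_2 -> 'I_2 -> R -> nat) (alpha : 'I_2 -> 'I_2 -> R) :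
  (forall k, measurable_fun setT (G k)) ->
  mutually_independent Pr G ->
  (forall k (A : set R), measurable A ->
     Pr (G k @^-1` A) = normal_prob 0 (Num.sqrt (2^-1)) A) ->
  (forall i j, 0 <= alpha i j <= 1) ->
  (forall i j, ((B i j P)%:R / log2 P) @[P --> +oo%R] --> alpha i j) ->
  exists mg : 'I_2 -> R,
    (forall i, ((rate G B Pr P i) * ((log2 P)^-1)%:E)%E @[P --> +oo%R] --> (mg i)%:E) /\
    mg ord0 + mg ord_max =
      2 * Num.min (Num.min (alpha ord0 ord0) (alpha ord0 ord_max))
                  (Num.min (alpha ord_max ord0) (alpha ord_max ord_max)).
Proof.
move=> mG indG lawG al01 hB.
set am := Num.min _ _.
have ham i j : am <= alpha i j.
  by rewrite /am; case: (ord2P i) => ->; case: (ord2P j) => ->; rewrite !ge_min lexx ?orbT.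
have [i [j amE]] : exists i j, am = alpha i j.
  rewrite /am; case: (leP (alpha ord0 ord0) (alpha ord0 ord_max)) => _;
  case: (leP (alpha ord_max ord0) (alpha ord_max ord_max)) => _;
  case: leP => _; by do 2 eexists.
exists (fun=> am); split; last by ring.
by move=> i0; exact: (rate_cvg mG indG lawG al01 hB i0 amE ham).
Qed.
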